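(* Let $F:U\to\mathbb P^{r',s',t'}$ be a local orthogonal map, where $U\subset\mathbb P^{r,s}$ is a connected open set containing a null point. If $r'+s'\le 2\dim(\mathbb P^{r,s})-1=2(r+s)-3$, then $F$ is either null or quasi-linear. If in addition $F$ maps at least one positive point to a positive point, or at least one negative point to a negative point, then $F$ is quasi-standard.
   Context: Let $r,s,t\ge 0$ be integers with $n=r+s+t>0$. $\mathbb C^{r,s,t}$ denotes $\mathbb C^n$ equipped with the (possibly degenerate, indefinite) Hermitian form $\langle z,w\rangle_{r,s,t}=\sum_{j=1}^{r}z_j\bar w_j-\sum_{j=r+1}^{r+s}z_j\bar w_j$, and $\mathbb P^{r,s,t}$ is its projectivization; $\mathbb P^{r,s}=\mathbb P^{r,s,0}$. A point $[z]$ is positive, negative or null according as $\langle z,z\rangle_{r,s,t}>0$, $<0$ or $=0$; $[z]\perp[w]$ if $\langle z,w\rangle_{r,s,t}=0$. A complex linear subspace $H$ (or $\mathbb PH$) is a null space if the form vanishes identically on $H$. A holomorphic map $F:U\to\mathbb P^{r',s',t'}$ on a connected open set $U$ containing a null point is a local orthogonal map if $F(p)\perp F(q)$ for all $p,q\in U$ with $p\perp q$. $F$ is linear if it extends to a rational map induced by a linear map of the underlying vector spaces; standard if it is induced by a linear isometry $\mathbb C^{r,s,t}\to\mathbb C^{r',s',t'}$ (a linear map $L$ with $\langle Lu,Lv\rangle_{r',s',t'}=\langle u,v\rangle_{r,s,t}$); null if $F(U)$ is contained in a null space. $F$ is quasi-standard (resp. quasi-linear) if either $F$ is standard (resp. linear),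 or there is a decomposition $\mathbb C^{r',s',t'}=A\oplus B$ into nonzero subspaces with $\langle a,b\rangle_{r',s',t'}=0$ for all $a\in A,b\in B$ such that $\pi_A\circ F$ is standard (resp. linear) and $\pi_B\circ F$ is null, where $\pi_A:\mathbb P^{r',s',t'}\dashrightarrow\mathbb PA$, $\pi_B:\mathbb P^{r',s',t'}\dashrightarrow\mathbb PB$ are induced by the linear projections, and $\mathbb PA,\mathbb PB$ carry the restricted forms. *)

(* Defs.v *)
From HB Require Import structures.
From mathcomp Require Import all_boot all_order all_algebra.
From mathcomp Require Import complex.
From mathcomp Require Import all_classical all_reals all_analysis.
Import numFieldNormedType.Exports.
Import Order.TTheory GRing.Theory Num.Theory.
Local Open Scope ring_scope.
Local Open Scope classical_set_scope.

Definition Cplx (R : realType) : Type := R[i].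
HB.instance Definition _ (R : realType) := Num.ClosedField.on (Cplx R).
HB.instance Definition _ (R : realType) := NormedModule.copy (Cplx R) (Cplx R)^o.

Section Hermitian.
Variable R : realType.
Local Notation C := (Cplx R).

Definition hsign (r s j : nat) : C :=
  if (j < r)%N then 1 else if (j < r + s)%N then -1 else 0.

Definition hform (r s t : nat) (z w : 'rV[C]_(r + s + t)) : C :=
  \sum_(j < r + s + t) hsign r s j * z 0 j * (w 0 j)^*.

Definition projeq {m : nat} (u v : 'rV[C]_m) : Prop :=
  u != 0 /\ v != 0 /\ exists c : C, c != 0 /\ u = c *: v.

(* U is the cone (preimage in C^n \ {0}) of a connected open subset of P^{n-1} *)
Definition proj_open_cone {n : nat} (U : set 'rV[C]_n) : Prop :=
  open U /\ connected U /\ ~ U 0 /\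
  (forall (z : 'rV[C]_n) (c : C), U z -> c != 0 -> U (c *: z)).

(* F : 'rV_n -> 'rV_N assigns to each z in the cone U a nonzero representative
   F z of the image point; this describes a holomorphic map from the projective
   set PU to P^{N-1}: the point [F z] depends only on [z], and locally F admits
   holomorphic (complex-differentiable) nonvanishing lifts. *)
Definition proj_holo_map {n N : nat} (U : set 'rV[C]_n)
    (F : 'rV[C]_n -> 'rV[C]_N) : Prop :=
  (forall z, U z -> F z != 0) /\
  (forall z (c : C), U z -> c != 0 -> projeq (F (c *: z)) (F z)) /\
  (forall z0, U z0 -> exists V : set 'rV[C]_n,
      [/\ open V, V z0 & V `<=` U] /\
      exists G : 'rV[C]_n -> 'rV[C]_N,
        (forall z, V z -> differentiable G z) /\
        (forall z, V z -> projeq (G z) (F z))).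

Variables (r s t r' s' t' : nat).
Local Notation n := (r + s + t).
Local Notation N := (r' + s' + t').

Definition local_orthogonal (U : set 'rV[C]_n) (F : 'rV[C]_n -> 'rV[C]_N) : Prop :=
  proj_open_cone U /\
  (exists z, U z /\ hform r s t z z = 0) /\
  proj_holo_map U F /\
  (forall p q, U p -> U q -> hform r s t p q = 0 ->
     hform r' s' t' (F p) (F q) = 0).

Definition null_space (H : 'M[C]_N) : Prop :=
  forall u v : 'rV[C]_N, (u <= H)%MS -> (v <= H)%MS -> hform r' s' t' u v = 0.

(* the (possibly partially defined: undefined where the representative
   vanishes) map z |-> [F z] has image (where defined) in the subspace H *)
Definition maps_into (U : set 'rV[C]_n) (F : 'rV[C]_n -> 'rV[C]_N)
    (H : 'M[C]_N) : Prop :=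
  forall z, U z -> F z != 0 -> (F z <= H)%MS.

(* [F] coincides with the rational map [z |-> z L] wherever both are defined *)
Definition induced_by (U : set 'rV[C]_n) (F : 'rV[C]_n -> 'rV[C]_N)
    (L : 'M[C]_(n, N)) : Prop :=
  forall z, U z -> F z != 0 -> z *m L != 0 -> projeq (F z) (z *m L).

Definition lin_isometry (L : 'M[C]_(n, N)) : Prop :=
  forall z w : 'rV[C]_n, hform r' s' t' (z *m L) (w *m L) = hform r s t z w.

Definition null_map U F : Prop := exists H, null_space H /\ maps_into U F H.

Definition linear_map U F : Prop :=
  exists L : 'M[C]_(n, N), L != 0 /\ induced_by U F L.

Definition standard_map U F : Prop :=
  exists L : 'M[C]_(n, N), L != 0 /\ lin_isometry L /\ induced_by U F L.

Definition orth_decomp (A B : 'M[C]_N) : Prop :=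
  [/\ A != 0, B != 0, (A :&: B <= (0 : 'M[C]_N))%MS, ((1%:M : 'M[C]_N) <= A + B)%MS &
      forall a b : 'rV[C]_N, (a <= A)%MS -> (b <= B)%MS -> hform r' s' t' a b = 0].

Definition projA (A B : 'M[C]_N) (F : 'rV[C]_n -> 'rV[C]_N) :=
  fun z => F z *m proj_mx A B.

Definition quasi_linear U F : Prop :=
  linear_map U F \/
  exists A B : 'M[C]_N, orth_decomp A B /\
    (* pi_A o F is a (somewhere defined) map, and it is linear into A *)
    (exists z, U z /\ projA A B F z != 0) /\
    (exists L : 'M[C]_(n, N), L != 0 /\ (L <= A)%MS /\
        induced_by U (projA A B F) L) /\
    (exists H : 'M[C]_N, (H <= B)%MS /\ null_space H /\
        maps_into U (projA B A F) H).

Definition quasi_standard U F : Prop :=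
  standard_map U F \/
  exists A B : 'M[C]_N, orth_decomp A B /\
    (exists z, U z /\ projA A B F z != 0) /\
    (exists L : 'M[C]_(n, N), L != 0 /\ (L <= A)%MS /\ lin_isometry L /\
        induced_by U (projA A B F) L) /\
    (exists H : 'M[C]_N, (H <= B)%MS /\ null_space H /\
        maps_into U (projA B A F) H).

End Hermitian.

(* Main.v *)
(** Polarization replaces [F] by two holomorphic maps [f], [g] on balls of C^n
    such that [z . w = 0] implies [f z . g w = 0] for the bilinear pairing,
    where [f] and [g] take values in C^m with m <= 2n - 3 and their images span.
    At an orthogonal pair (z1, w1), differentiating this implication gives
      (f z1) . (v Dg) = c (z1 . v),   (u Df) . (v Dg) = c (u . v)
    for u orthogonal to w1 and v orthogonal to z1, and a dimension count finds a
    pair with c <> 0. Iterated intersection with hyperplanes (each step raises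
    the rank of a space of vectors orthogonal to [f], and m <= 2n - 3 leaves
    enough room) upgrades these first-order identities to an identity for
    f z . g w on w1^perp x z1^perp. Moving z1 along the line through z0 and z
    then yields (z0 . w) (f z . g w) = rho(z) (z . w) (f z0 . g w) for all w, so
    that [f] is projectively linear near a point, and unique continuation makes
    it so on [U].

    For the Hermitian statement, the span of the image of [F] is A + S0 with A
    nondegenerate and S0 isotropic and orthogonal to A; the argument applies to
    the component in A (if A = 0 the map is null), and A and its orthogonal
    complement give the required splitting.

    The only complex analysis used is unique continuation along a segment for
    complex differentiable functions, which follows from the Cauchy-Goursat
    theorem on rectangles. *)
Require Import Defs.
From HB Require Import structures.
From mathcomp Require Import all_boot all_order all_algebra.
From mathcomp Require Import complex ring lra zify.
From mathcomp Require Import all_classical all_reals all_analysis.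
Import numFieldNormedType.Exports.
Import Order.TTheory GRing.Theory Num.Theory.
Local Open Scope ring_scope.
Local Open Scope classical_set_scope.
Set Implicit Arguments.
Unset Strict Implicit.
Unset Printing Implicit Defensive.

(** * The Cauchy-Goursat theorem on rectangles *)

Section Contour.
Variable R : realType.
Implicit Types (f g : R -> R) (P Q : R -> R -> R) (a b c x y e d : R).

(** The bound m <= 2n - 3 is a budget. One more hyperplane costs one dimension of the source C^n and
    buys a fixed gain in the rank of the vectors known to be orthogonal to [f]. If no pair were
    transversal, the value and the Jacobian of [g] would both be available, the gain would be 2, and
    n - 1 steps would exhaust C^m as soon as m <= 2n - 2. Once a transversal pair is at hand the
    gain is only 1, but the count starts at n - 1, the rank to reach is at most m - 1, and n - 3
    steps are affordable: m - 1 <= (n - 1) + (n - 3) is the stated bound. The regularity at hand is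
    weak: a lift is differentiable at each point, and no continuity of its Jacobian is assumed.
    Hence Goursat is proved from pointwise differentiability, holomorphy is used only along complex
    lines, and proportionality factors are eliminated before differentiating. Moreover [F] is an
    arbitrary choice of representatives, so only conditions invariant under rescaling (membership in
    a subspace, vanishing of minors) are propagated over [U]. *)

Definition RI f a b := \int[@lebesgue_measure R]_(x in `[a, b]) f x.

Definition cts_on f a b := forall x, a <= x <= b -> {for x, continuous f}.

Lemma cts_on_sub f a b c d : a <= c -> d <= b -> cts_on f a b -> cts_on f c d.
Proof. by move=> ac db fc x /andP[cx xd]; apply: fc; lra. Qed.

Lemma cts_integrable f a b : cts_on f a b ->
  (@lebesgue_measure R).-integrable `[a, b] (EFin \o f).
Proof.
move=> fc; apply: (@continuous_compact_integrable R f).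
  exact: segment_compact.
apply: continuous_in_subspaceT => x; rewrite inE /= in_itv /=; exact: fc.
Qed.

Lemma RI_chasles f a c b : a <= c -> c <= b -> cts_on f a b ->
  RI f a b = RI f a c + RI f c b.
Proof.
move=> ac cb fc.
have fi := cts_integrable fc.
apply/eqP; rewrite addrC -subr_eq; apply/eqP.
rewrite /RI Rintegral_itvB//=.
rewrite Rintegral_itv_obnd_cbnd//.
apply: integrableS fi => //.
by apply: subset_itvr; rewrite bnd_simp.
Qed.

Lemma RI_cst k a b : a <= b -> RI (fun=> k) a b = k * (b - a).
Proof.
move=> ab; rewrite /RI Rintegral_cst//= lebesgue_measure_itv /= lte_fin.
by case: ltgtP ab => //= -> _; rewrite subrr.
Qed.

Lemma cts_cst k a b : cts_on (fun=> k) a b.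
Proof. by move=> x _; apply: cvg_cst. Qed.

Lemma le_RI f g a b : cts_on f a b -> cts_on g a b ->
  (forall x, a <= x <= b -> f x <= g x) -> RI f a b <= RI g a b.
Proof.
move=> fc gc fg; apply: le_Rintegral; [by []|exact: cts_integrable..|].
by move=> x /=; rewrite in_itv /=; apply: fg.
Qed.

Lemma RIB f g a b : cts_on f a b -> cts_on g a b ->
  RI (fun x => f x - g x) a b = RI f a b - RI g a b.
Proof. by move=> fc gc; apply: RintegralB => //; apply: cts_integrable. Qed.

Lemma RI_le_cst f a b k : a <= b -> cts_on f a b ->
  (forall x, a <= x <= b -> f x <= k) -> RI f a b <= k * (b - a).
Proof. by move=> ab fc fk; rewrite -RI_cst//; apply: le_RI => //; exact: cts_cst. Qed.

Lemma RI_ge_cst f a b k : a <= b -> cts_on f a b ->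
  (forall x, a <= x <= b -> k <= f x) -> k * (b - a) <= RI f a b.
Proof. by move=> ab fc fk; rewrite -RI_cst//; apply: le_RI => //; exact: cts_cst. Qed.

Definition has_grad P a b A B := forall e, 0 < e -> exists2 d, 0 < d &
  forall x y, `|x - a| < d -> `|y - b| < d ->
  `|P x y - P a b - A * (x - a) - B * (y - b)| <= e * (`|x - a| + `|y - b|).

(** The shared coefficient [B] is the closedness dP/dy = dQ/dx of the form P dx + Q dy at this
    single point. *)
Definition closed_form_at P Q a b :=
  exists A B D, has_grad P a b A B /\ has_grad Q a b B D.

Lemma has_grad_cont1 P a b A B : has_grad P a b A B ->
  {for a, continuous (P^~ b)}.
Proof.
move=> Pab; apply/cvgrPdist_le => /= e e0.
have [d d0 dP] := Pab 1 ltr01.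
have k0 : 0 < 1 + `|A| by rewrite ltr_pwDl.
near=> x.
have xd : `|x - a| < d by rewrite distrC; near: x; apply/nbhs_ballP; exists d.
have xe : `|x - a| * (1 + `|A|) <= e.
  rewrite -ler_pdivlMr// distrC; near: x.
  by apply/nbhs_ballP; exists (e / (1 + `|A|)) => //=; [exact: divr_gt0|move=> y /ltW].
have := dP x b xd; rewrite subrr normr0 mulr0 subr0 addr0 mul1r => /(_ d0) h.
apply: le_trans xe; rewrite distrC mulrDr mulr1.
rewrite -lerBlDr; apply: le_trans h.
by rewrite mulrC -normrM lerB_dist.
Unshelve. all: by end_near. Qed.

Lemma has_grad_cont2 P a b A B : has_grad P a b A B ->
  {for b, continuous (P a)}.
Proof.
move=> Pab; apply: (@has_grad_cont1 (fun x y => P y x) b a B A) => e e0.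
have [d d0 dP] := Pab e e0; exists d => // x y xd yd.
have := dP y x yd xd.
by rewrite addrAC [`|x - b| + _]addrC.
Qed.

(** The integral of P dx + Q dy along the boundary of the rectangle, counterclockwise from the
    bottom side. *)
Definition contour P Q x1 x2 y1 y2 :=
  RI (P^~ y1) x1 x2 + RI (Q x2) y1 y2 - RI (P^~ y2) x1 x2 - RI (Q x1) y1 y2.

Definition closed_on P Q x1 x2 y1 y2 :=
  forall x y, x1 <= x <= x2 -> y1 <= y <= y2 -> closed_form_at P Q x y.

Lemma closed_on_sub P Q x1 x2 y1 y2 x1' x2' y1' y2' :
  x1 <= x1' -> x2' <= x2 -> y1 <= y1' -> y2' <= y2 ->
  closed_on P Q x1 x2 y1 y2 -> closed_on P Q x1' x2' y1' y2'.
Proof. by move=> ? ? ? ? h x y /andP[? ?] /andP[? ?]; apply: h; lra. Qed.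

Lemma closed_cts1 P Q x1 x2 y : (forall x, x1 <= x <= x2 -> closed_form_at P Q x y) ->
  cts_on (P^~ y) x1 x2.
Proof.
by move=> h x xx; have [A [B [D [PA _]]]] := h x xx; exact: has_grad_cont1 PA.
Qed.

Lemma closed_cts2 P Q y1 y2 x : (forall y, y1 <= y <= y2 -> closed_form_at P Q x y) ->
  cts_on (Q x) y1 y2.
Proof.
by move=> h y yy; have [A [B [D [_ QD]]]] := h y yy; exact: has_grad_cont2 QD.
Qed.

Lemma contour_splitx P Q x1 c x2 y1 y2 : x1 <= c -> c <= x2 ->
  cts_on (P^~ y1) x1 x2 -> cts_on (P^~ y2) x1 x2 ->
  contour P Q x1 x2 y1 y2 = contour P Q x1 c y1 y2 + contour P Q c x2 y1 y2.
Proof.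
move=> h1 h2 c1 c2; rewrite /contour (RI_chasles h1 h2 c1) (RI_chasles h1 h2 c2).
ring.
Qed.

Lemma contour_splity P Q y1 c y2 x1 x2 : y1 <= c -> c <= y2 ->
  cts_on (Q x1) y1 y2 -> cts_on (Q x2) y1 y2 ->
  contour P Q x1 x2 y1 y2 = contour P Q x1 x2 y1 c + contour P Q x1 x2 c y2.
Proof.
move=> h1 h2 c1 c2; rewrite /contour (RI_chasles h1 h2 c1) (RI_chasles h1 h2 c2).
ring.
Qed.

(** Opposite sides are paired: in [P x y1 - P x y2] the terms in [A] cancel, in [Q x2 y - Q x1 y]
    those in [D], and the two contributions of [B] cancel each other after integration. Each
    integrand carries two errors of size [2 * e * k] over a length at most [k], whence the factor
    8. *)
Lemma contour_small P Q a b A B D e x1 x2 y1 y2 k :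
  x1 <= x2 -> y1 <= y2 -> closed_on P Q x1 x2 y1 y2 ->
  x1 <= a <= x2 -> y1 <= b <= y2 -> x2 - x1 <= k -> y2 - y1 <= k -> 0 <= e ->
  (forall x y, x1 <= x <= x2 -> y1 <= y <= y2 ->
    `|P x y - P a b - A * (x - a) - B * (y - b)| <= e * (`|x - a| + `|y - b|)) ->
  (forall x y, x1 <= x <= x2 -> y1 <= y <= y2 ->
    `|Q x y - Q a b - B * (x - a) - D * (y - b)| <= e * (`|x - a| + `|y - b|)) ->
  `|contour P Q x1 x2 y1 y2| <= 8 * e * k ^+ 2.
Proof.
move=> x12 y12 cl /andP[xa ax] /andP[yb by_] xk yk e0 hP hQ.
have k0 : 0 <= k by lra.
have bnd x y : x1 <= x <= x2 -> y1 <= y <= y2 ->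
    e * (`|x - a| + `|y - b|) <= e * (2 * k).
  move=> /andP[? ?] /andP[? ?]; apply: ler_wpM2l => //.
  have : `|x - a| <= k by rewrite ler_norml; apply/andP; split; lra.
  have : `|y - b| <= k by rewrite ler_norml; apply/andP; split; lra.
  lra.
have cP y : y1 <= y <= y2 -> cts_on (P^~ y) x1 x2.
  by move=> yy; apply: (@closed_cts1 P Q) => x xx; exact: cl.
have cQ x : x1 <= x <= x2 -> cts_on (Q x) y1 y2.
  by move=> xx; apply: (@closed_cts2 P Q) => y yy; exact: cl.
have y1i : y1 <= y1 <= y2 by rewrite lexx.
have y2i : y1 <= y2 <= y2 by rewrite lexx y12.
have x1i : x1 <= x1 <= x2 by rewrite lexx.
have x2i : x1 <= x2 <= x2 by rewrite lexx x12.
have -> : contour P Q x1 x2 y1 y2 = RI (fun x => P x y1 - P x y2) x1 x2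
    + RI (fun y => Q x2 y - Q x1 y) y1 y2.
  by rewrite RIB ?RIB; [rewrite /contour; ring|apply: cQ|apply: cQ|apply: cP|apply: cP].
have cPB : cts_on (fun x => P x y1 - P x y2) x1 x2.
  by move=> x xx; apply: cvgB; [apply: cP|apply: cP].
have cQB : cts_on (fun y => Q x2 y - Q x1 y) y1 y2.
  by move=> x xx; apply: cvgB; [apply: cQ|apply: cQ].
have sP x : x1 <= x <= x2 ->
    `|P x y1 - P x y2 - B * (y1 - y2)| <= 4 * e * k.
  move=> xx; have := hP x y1 xx y1i; have := hP x y2 xx y2i.
  move=> /le_trans /(_ (bnd _ _ xx y2i)); rewrite ler_norml => /andP[? ?].
  move=> /le_trans /(_ (bnd _ _ xx y1i)); rewrite ler_norml => /andP[? ?].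
  by rewrite ler_norml; apply/andP; split; lra.
have sQ y : y1 <= y <= y2 ->
    `|Q x2 y - Q x1 y - B * (x2 - x1)| <= 4 * e * k.
  move=> yy; have := hQ x1 y x1i yy; have := hQ x2 y x2i yy.
  move=> /le_trans /(_ (bnd _ _ x2i yy)); rewrite ler_norml => /andP[? ?].
  move=> /le_trans /(_ (bnd _ _ x1i yy)); rewrite ler_norml => /andP[? ?].
  by rewrite ler_norml; apply/andP; split; lra.
have ek : 0 <= 4 * e * k by rewrite mulr_ge0// mulr_ge0.
have l1 : 4 * e * k * (x2 - x1) <= 4 * e * k * k by apply: ler_wpM2l.
have l2 : 4 * e * k * (y2 - y1) <= 4 * e * k * k by apply: ler_wpM2l.
have sP1 : RI (fun x => P x y1 - P x y2) x1 x2 <= (B * (y1 - y2) + 4 * e * k) * (x2 - x1).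
  by apply: RI_le_cst => // x /sP; rewrite ler_norml => /andP[? ?]; lra.
have sP2 : (B * (y1 - y2) - 4 * e * k) * (x2 - x1) <= RI (fun x => P x y1 - P x y2) x1 x2.
  by apply: RI_ge_cst => // x /sP; rewrite ler_norml => /andP[? ?]; lra.
have sQ1 : RI (fun y => Q x2 y - Q x1 y) y1 y2 <= (B * (x2 - x1) + 4 * e * k) * (y2 - y1).
  by apply: RI_le_cst => // x /sQ; rewrite ler_norml => /andP[? ?]; lra.
have sQ2 : (B * (x2 - x1) - 4 * e * k) * (y2 - y1) <= RI (fun y => Q x2 y - Q x1 y) y1 y2.
  by apply: RI_ge_cst => // x /sQ; rewrite ler_norml => /andP[? ?]; lra.
rewrite ler_norml; apply/andP; split; lra.
Qed.
End Contour.

Section Goursat.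
Variable R : realType.
Implicit Types (f g : R -> R) (P Q : R -> R -> R) (a b c x y e d : R).

Lemma contour_quarter P Q x y s t : 0 <= s -> 0 <= t ->
  closed_on P Q x (x + s) y (y + t) ->
  exists p : R * R, [/\ x <= p.1 <= x + s / 2, y <= p.2 <= y + t / 2 &
    `|contour P Q x (x + s) y (y + t)| / 4 <=
    `|contour P Q p.1 (p.1 + s / 2) p.2 (p.2 + t / 2)|].
Proof.
move=> s0 t0 cl.
have cP y' : y <= y' <= y + t -> cts_on (P^~ y') x (x + s).
  by move=> yy; apply: (@closed_cts1 _ P Q) => x' xx; exact: cl.
have cQ x' : x <= x' <= x + s -> cts_on (Q x') y (y + t).
  by move=> yy; apply: (@closed_cts2 _ P Q) => x0 xx; exact: cl.
have -> : contour P Q x (x + s) y (y + t) =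
    contour P Q x (x + s / 2) y (y + t / 2) +
    contour P Q x (x + s / 2) (y + t / 2) (y + t / 2 + t / 2) +
    contour P Q (x + s / 2) (x + s / 2 + s / 2) y (y + t / 2) +
    contour P Q (x + s / 2) (x + s / 2 + s / 2) (y + t / 2) (y + t / 2 + t / 2).
  have -> : x + s / 2 + s / 2 = x + s by field.
  have -> : y + t / 2 + t / 2 = y + t by field.
  rewrite (@contour_splitx _ _ _ _ (x + s / 2)); [|lra|lra|apply: cP; lra|apply: cP; lra].
  rewrite (@contour_splity _ _ _ y (y + t / 2) (y + t)); [|lra|lra|apply: cQ; lra|apply: cQ; lra].
  rewrite (@contour_splity _ _ _ y (y + t / 2) (y + t)); [|lra|lra|apply: cQ; lra|apply: cQ; lra].
  by rewrite !addrA.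
set c1 := contour _ _ _ _ _ _; set c2 := contour _ _ _ _ _ _.
set c3 := contour _ _ _ _ _ _; set c4 := contour _ _ _ _ _ _.
have h : `|c1 + c2 + c3 + c4| <= `|c1| + `|c2| + `|c3| + `|c4|.
  by rewrite (le_trans (ler_normD _ _))// lerD2r (le_trans (ler_normD _ _))// lerD2r ler_normD.
set N := `|_ + c4| in h *.
have [h1|h1] := leP (N / 4) `|c1|; first by exists (x, y); split => //=; lra.
have [h2|h2] := leP (N / 4) `|c2|; first by exists (x, y + t / 2); split => //=; lra.
have [h3|h3] := leP (N / 4) `|c3|; first by exists (x + s / 2, y); split => //=; lra.
have [h4|h4] := leP (N / 4) `|c4|; last lra.
by exists (x + s / 2, y + t / 2); split => //=; lra.
Qed.

Lemma nested_point (u : nat -> R) s : 0 <= s ->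
  (forall n, u n <= u n.+1 <= u n + s / 2 ^+ n.+1) ->
  exists a, forall n, u n <= a <= u n + s / 2 ^+ n.
Proof.
move=> s0 hu.
have hs n : s / 2 ^+ n = s / 2 ^+ n.+1 + s / 2 ^+ n.+1.
  by rewrite exprS; field; rewrite expf_neq0.
have mono n k : u n <= u (n + k)%N.
  elim: k => [|k]; first by rewrite addn0.
  by move=> /le_trans; apply; rewrite addnS; case/andP: (hu (n + k)%N).
have up n k : u (n + k)%N + s / 2 ^+ (n + k) <= u n + s / 2 ^+ n.
  elim: k => [|k]; first by rewrite addn0.
  apply: le_trans; rewrite addnS; case/andP: (hu (n + k)%N) => _ h.
  by rewrite [s / 2 ^+ (n + k)]hs; lra.
have pos n : 0 <= s / 2 ^+ n by rewrite divr_ge0// exprn_ge0.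
have ub n : ubound (range u) (u n + s / 2 ^+ n).
  move=> _ [k _ <-]; have [nk|kn] := leqP n k.
    by have := up n (k - n)%N; rewrite subnKC// => /(le_trans _); apply; rewrite lerDl.
  have := mono k (n - k)%N; rewrite subnKC ?(ltnW kn)// => /le_trans; apply.
  by rewrite lerDl.
have hsup : has_sup (range u) by split; [exists (u 0%N), 0%N|exists (u 0%N + s / 2 ^+ 0); exact: ub].
exists (sup (range u)) => n; apply/andP; split.
  by apply: sup_upper_bound => //; exists n.
by apply: ge_sup; [exists (u 0%N), 0%N|exact: ub].
Qed.

Theorem goursat P Q x1 x2 y1 y2 : x1 <= x2 -> y1 <= y2 ->
  closed_on P Q x1 x2 y1 y2 -> contour P Q x1 x2 y1 y2 = 0.
Proof.
move=> x12 y12 cl.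
pose s := x2 - x1; pose t := y2 - y1.
have s0 : 0 <= s by rewrite /s; lra.
have t0 : 0 <= t by rewrite /t; lra.
(* The bisection step is stated for every level and corner, with closedness as a premise, so that
   choice yields a total function to iterate. *)
have ex : forall q : nat * (R * R), exists p : R * R,
    let x := q.2.1 in let y := q.2.2 in
    let s := s / 2 ^+ q.1 in let t := t / 2 ^+ q.1 in
    closed_on P Q x (x + s) y (y + t) ->
    [/\ x <= p.1 <= x + s / 2, y <= p.2 <= y + t / 2 &
    `|contour P Q x (x + s) y (y + t)| / 4 <=
    `|contour P Q p.1 (p.1 + s / 2) p.2 (p.2 + t / 2)|].
  case=> n [x y] /=.
  have [h|h] := pselect (closed_on P Q x (x + s / 2 ^+ n) y (y + t / 2 ^+ n)).
    have [||p hp] := contour_quarter _ _ h; rewrite ?divr_ge0 ?exprn_ge0//.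
    by exists p.
  by exists (x, y).
have {ex} [F hF] := choice ex.
pose u := fix u n := if n is m.+1 then F (m, u m) else (x1, y1).
have hs (w : R) n : w / 2 ^+ n / 2 = w / 2 ^+ n.+1.
  by rewrite exprS; field; rewrite expf_neq0.
have hu n : [/\ closed_on P Q (u n).1 ((u n).1 + s / 2 ^+ n) (u n).2 ((u n).2 + t / 2 ^+ n),
    x1 <= (u n).1 /\ (u n).1 + s / 2 ^+ n <= x2,
    y1 <= (u n).2 /\ (u n).2 + t / 2 ^+ n <= y2 &
   `|contour P Q x1 x2 y1 y2| / 4 ^+ n <=
   `|contour P Q (u n).1 ((u n).1 + s / 2 ^+ n) (u n).2 ((u n).2 + t / 2 ^+ n)|].
  elim: n => [|n [h1 h2 h3 h4]].
    have ex : x1 + s / 2 ^+ 0 = x2 by rewrite expr0 /s; field.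
    have ey : y1 + t / 2 ^+ 0 = y2 by rewrite expr0 /t; field.
    by rewrite /= ex ey expr0 divr1; split.
  have [] := hF (n, u n) h1; rewrite -[F _]/(u n.+1) /= !hs.
  set v := u n.+1 => /andP[v1 v2] /andP[v3 v4] v5.
  have e1 : s / 2 ^+ n = s / 2 ^+ n.+1 + s / 2 ^+ n.+1 by rewrite -hs; lra.
  have e2 : t / 2 ^+ n = t / 2 ^+ n.+1 + t / 2 ^+ n.+1 by rewrite -hs; lra.
  have w1 : x1 <= v.1 /\ v.1 + s / 2 ^+ n.+1 <= x2 by lra.
  have w2 : y1 <= v.2 /\ v.2 + t / 2 ^+ n.+1 <= y2 by lra.
  split => //; first by apply: closed_on_sub cl; lra.
  apply: le_trans v5; rewrite exprS invfM mulrCA mulrC.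
  by rewrite ler_pM2r// invr_gt0.
have [a ha] : exists a, forall n, (u n).1 <= a <= (u n).1 + s / 2 ^+ n.
  apply: (@nested_point (fun n => (u n).1)) => // n.
  by have [h _ _ _] := hu n; have [] := hF (n, u n) h; rewrite -[F _]/(u n.+1) /= !hs.
have [b hb] : exists b, forall n, (u n).2 <= b <= (u n).2 + t / 2 ^+ n.
  apply: (@nested_point (fun n => (u n).2)) => // n.
  by have [h _ _ _] := hu n; have [] := hF (n, u n) h; rewrite -[F _]/(u n.+1) /= !hs.
have [A [B [D [hP hQ]]]] : closed_form_at P Q a b.
  apply: cl; first by have [_ ? _ _] := hu 0%N; have := ha 0%N; lra.
  by have [_ _ ? _] := hu 0%N; have := hb 0%N; lra.
apply/eqP; rewrite -normr_le0; apply/ler_addgt0Pl => e e0; rewrite addr0.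
(* [k] bounds both side lengths and is positive even for a degenerate rectangle. With [e'] the bound
   of [contour_small] at level n is e / 4^n, the same power that bisection loses. *)
pose k := s + t + 1.
have k0 : 0 < k by rewrite /k; lra.
pose e' := e / (8 * k ^+ 2).
have e'0 : 0 < e' by rewrite divr_gt0// mulr_gt0// exprn_gt0.
have [d1 d10 hd1] := hP _ e'0; have [d2 d20 hd2] := hQ _ e'0.
pose d := Num.min d1 d2.
have d0 : 0 < d by rewrite lt_min d10.
have [n hn] : exists n, k / 2 ^+ n < d.
  have [n nd] : exists n : nat, k / d < n%:R.
    by exists (Num.bound (k / d)); apply: archi_boundP; rewrite divr_ge0// ltW.
  exists n; rewrite ltr_pdivrMr ?exprn_gt0// mulrC -ltr_pdivrMr//.
  apply: lt_le_trans nd _; rewrite -natrX ler_nat ltnW//; exact: ltn_expl.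
have [c1 c2 c3 c4] := hu n.
have p2 : 0 < (2 ^+ n : R) by rewrite exprn_gt0.
have si : s / 2 ^+ n <= k / 2 ^+ n by rewrite ler_pM2r ?invr_gt0// /k; lra.
have ti : t / 2 ^+ n <= k / 2 ^+ n by rewrite ler_pM2r ?invr_gt0// /k; lra.
have sp : 0 <= s / 2 ^+ n by rewrite divr_ge0// ltW.
have tp : 0 <= t / 2 ^+ n by rewrite divr_ge0// ltW.
have near_ x y : (u n).1 <= x <= (u n).1 + s / 2 ^+ n ->
    (u n).2 <= y <= (u n).2 + t / 2 ^+ n -> `|x - a| < d /\ `|y - b| < d.
  move: (ha n) (hb n) hn si ti; clear=> *.
  by split; rewrite ltr_norml; apply/andP; split; lra.
have := @contour_small _ P Q a b A B D e' (u n).1 ((u n).1 + s / 2 ^+ n)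
  (u n).2 ((u n).2 + t / 2 ^+ n) (k / 2 ^+ n).
move=> /(_ _ _ c1 (ha n) (hb n)).
have /[swap]/[apply] : (u n).1 <= (u n).1 + s / 2 ^+ n by rewrite lerDl.
have /[swap]/[apply] : (u n).2 <= (u n).2 + t / 2 ^+ n by rewrite lerDl.
rewrite ![_ + _ - _]addrC !addKr => /(_ si ti (ltW e'0)) h.
have {}h : `|contour P Q x1 x2 y1 y2| / 4 ^+ n <= 8 * e' * (k / 2 ^+ n) ^+ 2.
  apply: le_trans c4 (h _ _) => x y xx yy; have [h1 h2] := near_ x y xx yy.
    by apply: hd1; [apply: lt_le_trans h1 _|apply: lt_le_trans h2 _]; rewrite ge_min lexx.
  by apply: hd2; [apply: lt_le_trans h1 _|apply: lt_le_trans h2 _]; rewrite ge_min lexx orbT.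
have : 8 * e' * (k / 2 ^+ n) ^+ 2 = e / 4 ^+ n.
  rewrite /e' (_ : 4 = 2 ^+ 2 :> R); last by rewrite -natrX.
  by rewrite -exprM mulnC exprM; field; rewrite !gt_eqF.
move=> ee; move: h; rewrite ee ler_pM2r// invr_gt0 exprn_gt0//.
Qed.

End Goursat.

(** * Unique continuation along segments *)

Section CauchyEstimate.
Variable R : realType.
Local Notation C := (Cplx R).
Local Open Scope complex_scope.
Import ComplexField.Normc.
Local Notation normc := (@normc R).
Local Notation Re := (@complex.Re R).
Local Notation Im := (@complex.Im R).

Lemma normr_normc (z : C) : `|z| = (normc z)%:C :> C.
Proof. by case: z. Qed.

Lemma normcD (x y : C) : normc (x + y) <= normc x + normc y.
Proof. by rewrite -lecR rmorphD /= -!normr_normc ler_normD. Qed.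

Lemma normc_ge0 (z : C) : 0 <= normc z.
Proof. by case: z => a b; exact: sqrtr_ge0. Qed.

Lemma sqr_normcE (z : C) : normc z ^+ 2 = Re z ^+ 2 + Im z ^+ 2.
Proof. by case: z => a b /=; rewrite sqr_sqrtr// addr_ge0// sqr_ge0. Qed.

Lemma Re_le_normc (z : C) : `|Re z| <= normc z.
Proof.
rewrite -(@ler_pXn2r _ 2)// ?nnegrE ?normc_ge0//.
by rewrite sqr_normcE real_normK ?num_real// lerDl sqr_ge0.
Qed.

Lemma Im_le_normc (z : C) : `|Im z| <= normc z.
Proof.
rewrite -(@ler_pXn2r _ 2)// ?nnegrE ?normc_ge0//.
by rewrite sqr_normcE real_normK ?num_real// lerDr sqr_ge0.
Qed.

Lemma normc_le_sum (z : C) : normc z <= `|Re z| + `|Im z|.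
Proof.
rewrite -(@ler_pXn2r _ 2)// ?nnegrE ?normc_ge0 ?addr_ge0//.
rewrite sqr_normcE sqrrD !real_normK ?num_real//.
by rewrite lerD2r lerDl mulrn_wge0// mulr_ge0.
Qed.

Lemma nbhs_normc (c : C) (A : set C) :
  nbhs c A <-> exists2 d : R, 0 < d & forall h, normc h < d -> A (c + h).
Proof.
split.
  move=> /nbhs_ballP [e /= e0 eA].
  have [d ed] : exists d : R, e = d%:C.
    by exists (Re e); rewrite RRe_real// gtr0_real.
  exists d; first by rewrite -ltcR -ed.
  move=> h hd; apply: eA; rewrite -ball_normE /=.
  by rewrite opprD addrA subrr add0r normrN normr_normc ed ltcR.
move=> [d d0 dA]; apply/nbhs_ballP; exists d%:C; first by rewrite /= ltcR.
move=> y; rewrite -ball_normE /= => yd.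
have -> : y = c + (y - c) by rewrite addrC subrK.
by apply: dA; rewrite -ltcR -normr_normc distrC.
Qed.

Lemma derivable_eps (f : C -> C) (c : C) : derivable f c 1 ->
  exists L : C, forall e : R, 0 < e -> exists2 d : R, 0 < d &
  forall h, normc h < d -> normc (f (c + h) - f c - L * h) <= e * normc h.
Proof.
move=> fc; exists ('D_1 f c) => e e0.
have /cvgrPdist_le /(_ e%:C) := fc.
rewrite ltcR => /(_ e0) /= /nbhs_normc [d d0 dP].
exists d => // h hd.
have [->|h0] := eqVneq h 0.
  by rewrite addr0 subrr mulr0 subr0 normc0 mulr0.
have := dP h; rewrite add0r => /(_ hd h0).
rewrite -[lim _]/('D_1 f c) -[h *: 1]/(h * 1) mulr1 [h + c]addrC => h1.
rewrite -lecR rmorphM /= -!normr_normc.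
have -> : f (c + h) - f c - 'D_1 f c * h = - (h * ('D_1 f c - h^-1 * (f (c + h) - f c))).
  by field.
by rewrite normrN normrM mulrC ler_wpM2r.
Qed.

(** The form is the imaginary part of f dz, and its closedness is the Cauchy-Riemann system. The
    imaginary part is the one that detects a pole, the integral of dz / z being 2 pi i. *)
Lemma closed_of_derivable (f : C -> C) x y : derivable f (x +i* y : C) 1 ->
  closed_form_at (fun x y => Im (f (x +i* y : C))) (fun x y => Re (f (x +i* y : C))) x y.
Proof.
move=> /derivable_eps [L hL]; exists (Im L), (Re L), (- Im L).
have main (e : R) : 0 < e -> exists2 d : R, 0 < d & forall x' y',
    `|x' - x| < d -> `|y' - y| < d ->
    normc (f (x' +i* y' : C) - f (x +i* y : C) - L * ((x' - x) +i* (y' - y)))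
      <= e * (`|x' - x| + `|y' - y|).
  move=> e0; have [d d0 dP] := hL _ e0; exists (d / 2); first by rewrite divr_gt0.
  move=> x' y' xd yd.
  have hn : normc ((x' - x) +i* (y' - y) : C) <= `|x' - x| + `|y' - y|.
    exact: normc_le_sum.
  have := dP ((x' - x) +i* (y' - y)).
  have -> : (x +i* y : C) + ((x' - x) +i* (y' - y) : C) = (x' +i* y' : C).
    by apply/eqP; rewrite eq_complex /= ![_ + (_ - _)]addrC !subrK !eqxx.
  move=> /(_ _)/le_trans; apply; first by apply: le_lt_trans hn _; lra.
  by apply: ler_wpM2l => //; exact: ltW.
split=> e e0; have [d d0 dP] := main e e0; exists d => // x' y' xd yd;
  apply: le_trans (dP x' y' xd yd).
  apply: le_trans (Im_le_normc _); case: L {hL main dP} => l1 l2 /=.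
  case: (f _) => a b; case: (f _) => a' b' /=.
  by rewrite le_eqVlt; apply/orP; left; apply/eqP; congr `|_|; ring.
apply: le_trans (Re_le_normc _); case: L {hL main dP} => l1 l2 /=.
case: (f _) => a b; case: (f _) => a' b' /=.
by rewrite le_eqVlt; apply/orP; left; apply/eqP; congr `|_|; ring.
Qed.

(** On the boundary of a square of half-side [r], [n2] stands for |z|^2 and [w] for the real or
    imaginary part of f z times the conjugate of z. *)
Lemma side_bound (w n2 M r : R) : 0 < r -> 0 <= M -> r ^+ 2 <= n2 ->
  w ^+ 2 <= M ^+ 2 * n2 -> `|w / n2| <= M / r.
Proof.
move=> r0 M0 rn wM; have r20 : 0 < r ^+ 2 by rewrite exprn_gt0.
have n0 : 0 < n2 by lra.
have h : (w / n2) ^+ 2 <= (M / r) ^+ 2.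
  rewrite !expr_div_n ler_pdivrMr ?exprn_gt0// mulrAC ler_pdivlMr//.
  apply: le_trans (_ : M ^+ 2 * n2 * n2 <= _); last by rewrite -mulrA -expr2.
  by apply: ler_pM => //; exact: sqr_ge0.
have Mr : 0 <= M / r by rewrite divr_ge0// ltW.
by rewrite -ler_sqr ?nnegrE// real_normK ?num_real.
Qed.

Lemma side_main (alpha n2 r : R) : 0 < r -> 0 <= alpha -> n2 <= 2 * r ^+ 2 -> 0 < n2 ->
  alpha / (2 * r) <= alpha * r / n2.
Proof.
move=> r0 a0 n2r n0; rewrite ler_pdivlMr// mulrAC ler_pdivrMr ?mulr_gt0//.
have -> : alpha * r * (2 * r) = alpha * (2 * r ^+ 2) by ring.
exact: ler_wpM2l.
Qed.

(** The gap between the two squares is cut into four rectangles that miss the origin, where the form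
    may be singular: full-width strips below and above, and the two remaining pieces left and
    right. *)
Lemma contour_annulus (P Q : R -> R -> R) (e r : R) : 0 < e -> e <= r ->
  (forall x y, `|x| <= r -> `|y| <= r -> (x != 0) || (y != 0) ->
    closed_form_at P Q x y) ->
  contour P Q (- r) r (- r) r = contour P Q (- e) e (- e) e.
Proof.
move=> e0 er cl; have r0 : 0 < r by apply: lt_le_trans er.
have itv (x : R) : - r <= x <= r -> `|x| <= r by rewrite ler_norml.
have nr : `|- r| = r by rewrite normrN gtr0_norm.
have nr' : `|r| = r by rewrite gtr0_norm.
have r_neq0 : r != 0 by rewrite gt_eqF.
have nr_neq0 : - r != 0 by rewrite oppr_eq0.
have cP (y : R) : `|y| <= r -> y != 0 -> cts_on (P^~ y) (- r) r.
  move=> yr y0; apply: (@closed_cts1 _ P Q) => x xx; apply: cl => //.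
    exact: itv.
  by rewrite y0 orbT.
have cQ (x : R) : `|x| <= r -> x != 0 -> cts_on (Q x) (- r) r.
  move=> yr y0; apply: (@closed_cts2 _ P Q) => y yy; apply: cl => //.
    exact: itv.
  by rewrite y0.
have e_neq0 : e != 0 by rewrite gt_eqF.
have ne : `|e| <= r by rewrite gtr0_norm.
have ne' : `|- e| <= r by rewrite normrN gtr0_norm.
have nz (a b : R) : a <= b -> b < 0 -> a != 0 by move=> *; rewrite lt_eqF//; lra.
have nz' (a b : R) : b <= a -> 0 < b -> a != 0 by move=> *; rewrite gt_eqF//; lra.
rewrite (@contour_splity _ _ _ (- r) (- e) r); [|lra|lra|by apply: cQ; rewrite ?nr|by apply: cQ; rewrite ?nr'].
rewrite (@contour_splity _ _ _ (- e) e r); [|lra|lra| |]; last 2 first.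
  - by apply: (@cts_on_sub _ _ (- r) r); [lra|lra|apply: cQ; rewrite ?nr].
  - by apply: (@cts_on_sub _ _ (- r) r); [lra|lra|apply: cQ; rewrite ?nr'].
rewrite (@contour_splitx _ _ _ (- r) (- e) r (- e) e); [|lra|lra| |]; last 2 first.
  - by apply: cP; rewrite ?oppr_eq0.
  - by apply: cP.
rewrite (@contour_splitx _ _ _ (- e) e r (- e) e); [|lra|lra| |]; last 2 first.
  - by apply: (@cts_on_sub _ _ (- r) r); [lra|lra|apply: cP; rewrite ?oppr_eq0].
  - by apply: (@cts_on_sub _ _ (- r) r); [lra|lra|apply: cP].
rewrite (@goursat _ P Q (- r) r (- r) (- e)); [|lra|lra|]; last first.
    move=> x y xx yy; apply: cl; [apply: itv; lra|apply: itv; lra|].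
    by apply/orP; right; case/andP: yy => _ /nz; apply; lra.
rewrite (@goursat _ P Q (- r) (- e) (- e) e); [|lra|lra|]; last first.
    move=> x y xx yy; apply: cl; [apply: itv; lra|apply: itv; lra|].
    by apply/orP; left; case/andP: xx => _ /nz; apply; lra.
rewrite (@goursat _ P Q e r (- e) e); [|lra|lra|]; last first.
    move=> x y xx yy; apply: cl; [apply: itv; lra|apply: itv; lra|].
    by apply/orP; left; case/andP: xx => /nz' + _; apply; lra.
rewrite (@goursat _ P Q (- r) r e r); [|lra|lra|]; last first.
    move=> x y xx yy; apply: cl; [apply: itv; lra|apply: itv; lra|].
    by apply/orP; right; case/andP: yy => /nz' + _; apply; lra.
  ring.
Qed.

(* If [f 0 > 2 M], all four sides contribute to the contour integral of
   [(f z - f 0) / z] with the same strict sign, although the integral vanishes: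
   by [contour_annulus] it can be taken over arbitrarily small squares. *)
Lemma cauchy_estimate0 (f : C -> C) (r M : R) : 0 < r -> 0 <= M ->
  (forall x y, `|x| <= r -> `|y| <= r -> derivable f (x +i* y : C) 1) ->
  (forall x y, `|x| <= r -> `|y| <= r -> `|x| = r \/ `|y| = r ->
     normc (f (x +i* y : C)) <= M) ->
  0 <= Re (f 0) -> Im (f 0) = 0 -> Re (f 0) <= 2 * M.
Proof.
move=> r0 M0 fd fM a0 im0; set alpha := Re (f 0).
have f0E : f 0 = alpha%:C by rewrite /alpha; case: (f 0) im0 => a b /= ->.
rewrite leNgt; apply/negP => aM.
pose phi (z : C) : C := (f z - alpha%:C) * z^-1.
pose P x y := Im (phi (x +i* y : C)); pose Q x y := Re (phi (x +i* y : C)).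
have cl x y : `|x| <= r -> `|y| <= r -> (x != 0) || (y != 0) ->
    closed_form_at P Q x y.
  move=> xr yr xy0; apply: closed_of_derivable.
  rewrite /phi; apply: (@derivableM _ _ (f - cst alpha%:C) (fun z => z^-1)).
    by apply: derivableB; [exact: fd|exact: derivable_cst].
  by apply: derivableV => //; rewrite eq_complex /= negb_and.
have PE x y : P x y = (Im (f (x +i* y : C)) * x - (Re (f (x +i* y : C)) - alpha) * y) / (x ^+ 2 + y ^+ 2).
  rewrite /P /phi; case: (f _) => u v /=; ring.
have QE x y : Q x y = ((Re (f (x +i* y : C)) - alpha) * x + Im (f (x +i* y : C)) * y) / (x ^+ 2 + y ^+ 2).
  rewrite /Q /phi; case: (f _) => u v /=; ring.
(* Lower bound for the integrand on each side, up to sign: the term of [alpha] is at least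
   [alpha / (2 * r)] because |z|^2 <= 2 r^2 there, and the term of [f] is at most [M / r]. It is
   positive exactly when alpha > 2 M. *)
pose kappa := alpha / (2 * r) - M / r.
have k0 : 0 < kappa.
  rewrite /kappa (_ : M / r = 2 * M / (2 * r)); last by field; rewrite gt_eqF.
  by rewrite -mulrBl divr_gt0 ?mulr_gt0// subr_gt0.
have sides x y : `|x| <= r -> `|y| <= r -> `|x| = r \/ `|y| = r ->
    [/\ `|(Im (f (x +i* y : C)) * x - Re (f (x +i* y : C)) * y) / (x ^+ 2 + y ^+ 2)| <= M / r,
    `|(Re (f (x +i* y : C)) * x + Im (f (x +i* y : C)) * y) / (x ^+ 2 + y ^+ 2)| <= M / r &
    alpha / (2 * r) <= alpha * r / (x ^+ 2 + y ^+ 2)].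
  move=> xr yr xyr; have := fM x y xr yr xyr.
  rewrite -(@ler_pXn2r _ 2)// ?nnegrE ?normc_ge0// sqr_normcE.
  case: (f _) => u v /= uv.
  have sq a : `|a| <= r -> a ^+ 2 <= r ^+ 2.
    by move=> ?; rewrite -(real_normK (num_real a)) ler_pXn2r// ?nnegrE// ltW.
  have sq' a : `|a| = r -> a ^+ 2 = r ^+ 2 by move=> <-; rewrite real_normK ?num_real.
  have n1 : r ^+ 2 <= x ^+ 2 + y ^+ 2.
    by case: xyr => /sq' ->; rewrite ?lerDl ?lerDr sqr_ge0.
  have n2 : x ^+ 2 + y ^+ 2 <= 2 * r ^+ 2 by have := sq _ xr; have := sq _ yr; lra.
  have r20 : 0 < r ^+ 2 by rewrite exprn_gt0.
  have np : 0 < x ^+ 2 + y ^+ 2 by lra.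
  have cs : (u ^+ 2 + v ^+ 2) * (x ^+ 2 + y ^+ 2) <= M ^+ 2 * (x ^+ 2 + y ^+ 2).
    by rewrite ler_pM2r.
  split; last exact: side_main.
  - apply: side_bound => //; apply: le_trans cs.
    have -> : (u ^+ 2 + v ^+ 2) * (x ^+ 2 + y ^+ 2) = (v * x - u * y) ^+ 2 + (u * x + v * y) ^+ 2 by ring.
    by rewrite lerDl sqr_ge0.
  - apply: side_bound => //; apply: le_trans cs.
    have -> : (u ^+ 2 + v ^+ 2) * (x ^+ 2 + y ^+ 2) = (v * x - u * y) ^+ 2 + (u * x + v * y) ^+ 2 by ring.
    by rewrite lerDr sqr_ge0.
have nr : `|- r| = r by rewrite normrN gtr0_norm.
have nr' : `|r| = r by rewrite gtr0_norm.
have itv (x : R) : - r <= x <= r -> `|x| <= r by rewrite ler_norml.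
have cP (y e : R) : `|y| <= r -> e <= r -> y != 0 -> cts_on (P^~ y) (- e) e.
  move=> yr er y0; apply: (@closed_cts1 _ P Q) => x xx; apply: cl => //.
    by apply: itv; lra.
  by rewrite y0 orbT.
have cQ (x e : R) : `|x| <= r -> e <= r -> x != 0 -> cts_on (Q x) (- e) e.
  move=> yr er y0; apply: (@closed_cts2 _ P Q) => y yy; apply: cl => //.
    by apply: itv; lra.
  by rewrite y0.
have r_neq0 : r != 0 by rewrite gt_eqF.
have nr_neq0 : - r != 0 by rewrite oppr_eq0.
have rr : - r <= r by lra.
have Q1 : RI (Q r) (- r) r <= - kappa * (r - - r).
  apply: RI_le_cst => //; first by apply: cQ; rewrite ?nr'.
  move=> y yr; have [|||_ h1 h2] := @sides r y; [by rewrite nr'|exact: itv|by left|].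
  by move: h1; rewrite QE ler_norml /kappa => /andP[h h']; lra.
have P1 : RI (P^~ (- r)) (- r) r <= - kappa * (r - - r).
  apply: RI_le_cst => //; first by apply: cP; rewrite ?nr.
  move=> x xr; have [|||h1 _ h2] := @sides x (- r); [exact: itv|by rewrite nr|by right|].
  by move: h1; rewrite PE ler_norml /kappa => /andP[h h']; lra.
have P2 : kappa * (r - - r) <= RI (P^~ r) (- r) r.
  apply: RI_ge_cst => //; first by apply: cP; rewrite ?nr'.
  move=> x xr; have [|||h1 _ h2] := @sides x r; [exact: itv|by rewrite nr'|by right|].
  by move: h1; rewrite PE ler_norml /kappa => /andP[h h']; lra.
have Q2 : kappa * (r - - r) <= RI (Q (- r)) (- r) r.
  apply: RI_ge_cst => //; first by apply: cQ; rewrite ?nr.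
  move=> y yr; have [|||_ h1 h2] := @sides (- r) y; [by rewrite nr|exact: itv|by left|].
  by move: h1; rewrite QE ler_norml /kappa => /andP[h h']; lra.
have Sr : contour P Q (- r) r (- r) r <= - (8 * (kappa * r)).
  by rewrite /contour; move: Q1 P1 P2 Q2; clear; lra.
have Seq (e : R) : 0 < e -> e <= r -> contour P Q (- r) r (- r) r = contour P Q (- e) e (- e) e.
  by move=> e0 er; exact: contour_annulus.
have : derivable f (0 : C) 1 by apply: fd; rewrite normr0 ltW.
move=> /derivable_eps [L /(_ 1 ltr01) [d d0 dP]].
pose K := normc L + 1.
have K1 : 1 <= K by rewrite /K lerDr normc_ge0.
have phiK (z : C) : z != 0 -> normc z < d -> normc (phi z) <= K.
  move=> z0 zd; have := dP z zd; rewrite add0r mul1r f0E => h.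
  have nz0 : 0 < normc z.
    by rewrite lt_neqAle normc_ge0 andbT eq_sym; apply: contra z0 => /eqP /eq0_normc ->.
  rewrite /phi normcM normcV ler_pdivrMr// /K mulrDl mul1r.
  rewrite -normcM -lerBlDl; apply: le_trans h.
  rewrite lerBlDl.
  have := normcD (L * z) (f z - alpha%:C - L * z).
  by rewrite [L * z + _]addrC subrK.
(* The small square lies in the disc where [phi] is bounded by [K]. Its perimeter is [8 * e], and
   [2 * K * e <= kappa * r] makes its contour at least -4 kappa r, while the large contour is at
   most -8 kappa r. *)
pose e := Num.min (Num.min (r / 2) (d / 3)) (kappa * r / (2 * K)).
have kr0 : 0 < kappa * r by rewrite mulr_gt0.
have e0 : 0 < e by rewrite /e !lt_min !divr_gt0 ?mulr_gt0//; lra.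
have er : e <= r / 2 by rewrite /e !ge_min lexx.
have ed : e <= d / 3 by rewrite /e !ge_min lexx orbT.
have ek : e * (2 * K) <= kappa * r.
  by rewrite -ler_pdivlMr ?mulr_gt0//; [rewrite /e !ge_min lexx orbT|lra].
have smallz x y : `|x| <= e -> `|y| <= e -> normc (x +i* y : C) < d.
  move=> xe ye; apply: le_lt_trans (normc_le_sum _) _; rewrite /=; lra.
have ne : `|e| = e by rewrite gtr0_norm.
have ne' : `|- e| = e by rewrite normrN gtr0_norm.
have e_neq0 : e != 0 by rewrite gt_eqF.
have ne_neq0 : - e != 0 by rewrite oppr_eq0.
have bQ x y : `|x| = e -> - e <= y <= e -> - K <= Q x y <= K.
  move=> xe; rewrite -ler_norml => ye; rewrite -ler_norml.
  apply: le_trans (Re_le_normc _) _; apply: phiK; last by apply: smallz; rewrite ?xe.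
  by rewrite eq_complex /= negb_and; apply/orP; left; rewrite -normr_eq0 xe.
have bP x y : `|y| = e -> - e <= x <= e -> - K <= P x y <= K.
  move=> xe; rewrite -ler_norml => ye; rewrite -ler_norml.
  apply: le_trans (Im_le_normc _) _; apply: phiK; last by apply: smallz; rewrite ?xe.
  by rewrite eq_complex /= negb_and; apply/orP; right; rewrite -normr_eq0 xe.
have ee : - e <= e by move: e0; clear; lra.
have ler : e <= r by move: er r0; clear; lra.
have s1 : - K * (e - - e) <= RI (Q e) (- e) e.
  by apply: RI_ge_cst => //; [apply: cQ; rewrite ?ne|move=> y /(bQ e y ne) /andP[]].
have s2 : - K * (e - - e) <= RI (P^~ (- e)) (- e) e.
  by apply: RI_ge_cst => //; [apply: cP; rewrite ?ne'|move=> y /(bP y (- e) ne') /andP[]].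
have s3 : RI (P^~ e) (- e) e <= K * (e - - e).
  by apply: RI_le_cst => //; [apply: cP; rewrite ?ne|move=> y /(bP y e ne) /andP[]].
have s4 : RI (Q (- e)) (- e) e <= K * (e - - e).
  by apply: RI_le_cst => //; [apply: cQ; rewrite ?ne'|move=> y /(bQ (- e) y ne') /andP[]].
have : - (8 * (K * e)) <= contour P Q (- e) e (- e) e.
  by rewrite /contour; move: s1 s2 s3 s4; clear; lra.
rewrite -(Seq e e0 ler); move: Sr ek kr0; clear; lra.
Qed.

End CauchyEstimate.

Section UniqueContinuation.
Variable R : realType.
Local Notation C := (Cplx R).
Local Open Scope complex_scope.
Import ComplexField.Normc.
Local Notation normc := (@normc R).
Local Notation Re := (@complex.Re R).
Local Notation Im := (@complex.Im R).

Lemma derivable_translate (f : C -> C) (c z : C) :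
  derivable f (c + z) 1 -> derivable (fun z => f (c + z)) z 1.
Proof.
rewrite /derivable => fd.
rewrite (_ : (fun h => _) = fun h => h^-1 *: ((f \o shift (c + z)) (h *: 1) - f (c + z)))//.
by apply/funext => h; rewrite /shift /= [c + (_ + _)]addrCA.
Qed.

Lemma derivable_mul (f g : C -> C) (c : C) : derivable f c 1 -> derivable g c 1 ->
  derivable (fun z => f z * g z) c 1.
Proof. by move=> df dg; apply: (derivableM df dg). Qed.

Lemma derivable1_continuous (f : C -> C) (c : C) : derivable f c 1 ->
  {for c, continuous f}.
Proof. by move=> /derivable1_diffP /differentiable_continuous. Qed.

(** Multiplying by the conjugate of [f c] makes the central value real and nonnegative. The
    constraint [2 * r < rho] keeps the square of half-side [r] inside the disc, and the boundary of
    that square is at distance at least [r] from the centre. *)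
Lemma cauchy_estimate (f : C -> C) (c : C) (rho r M : R) :
  0 < r -> 2 * r < rho ->
  (forall z, normc (z - c) < rho -> derivable f z 1) ->
  (forall z, r <= normc (z - c) -> normc (z - c) < rho -> normc (f z) <= M) ->
  normc (f c) <= 2 * M.
Proof.
move=> r0 rrho fd fM.
have M0 : 0 <= M.
  apply: le_trans (normc_ge0 (f (c + r%:C))) (fM _ _ _); rewrite addrAC subrr add0r /=;
    rewrite expr0n addr0 sqrtr_sqr gtr0_norm//; lra.
have [fc0|fc0] := eqVneq (normc (f c)) 0; first by rewrite fc0; lra.
have {}fc0 : 0 < normc (f c) by rewrite lt_neqAle eq_sym fc0 normc_ge0.
pose g (z : C) : C := conjc (f c) * f (c + z).
have ncj (z : C) : normc (conjc z) = normc z by case: z => a b /=; rewrite sqrrN.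
have g0E : g 0 = (normc (f c) ^+ 2)%:C.
  rewrite /g addr0 sqr_normcE; case: (f c) => a b.
  by apply/eqP; rewrite eq_complex /=; apply/andP; split; apply/eqP; ring.
have small (x y : R) : `|x| <= r -> `|y| <= r -> normc (x +i* y : C) < rho.
  by move=> xr yr; apply: le_lt_trans (normc_le_sum _) _; rewrite /=; lra.
have := @cauchy_estimate0 _ g r (normc (f c) * M) r0.
rewrite g0E /= expr2 mulrCA ler_pM2l// => /(_ _ _ _ _ _)-> //.
- by rewrite mulr_ge0// ltW.
- move=> x y xr yr; apply: (@derivable_mul (cst (conjc (f c))) (fun z => f (c + z))).
    exact: derivable_cst.
  by apply: derivable_translate; apply: fd; rewrite addrAC subrr add0r; apply: small.
- move=> x y xr yr xyr; rewrite /g normcM ncj ler_pM2l//; apply: fM.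
    rewrite addrAC subrr add0r.
    by case: xyr => <-; [apply: Re_le_normc (x +i* y : C)|apply: Im_le_normc (x +i* y : C)].
  by rewrite addrAC subrr add0r; apply: small.
by rewrite mulr_ge0// ltW.
Qed.

Lemma normcB (x y : C) : normc (x - y) = normc (y - x).
Proof. by apply: complexI; rewrite -!normr_normc distrC. Qed.

Lemma normc_tri (x y z : C) : normc (x - z) <= normc (x - y) + normc (y - z).
Proof. by apply: le_trans _ (normcD _ _); rewrite addrA subrK. Qed.

Lemma normcX (x : C) k : normc (x ^+ k) = normc x ^+ k.
Proof. by elim: k => [|k IH]; rewrite ?expr0 ?normc1// !exprS normcM IH. Qed.

Lemma derivable_expn (f : C -> C) (c : C) k : derivable f c 1 ->
  derivable (fun z => f z ^+ k) c 1.
Proof.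
move=> fc; elim: k => [|k IH].
  by under eq_fun do rewrite expr0; exact: derivable_cst.
under eq_fun do rewrite exprS.
exact: derivable_mul.
Qed.

(* Since [f] vanishes near [b], [f z ((e - b) / (z - b)) ^ k] is holomorphic; its
   value at [e] is [f e], and the Cauchy estimate at [e] is geometric in [k]. *)
Lemma uc_local (f : C -> C) (c b e : C) (rho M : R) : 0 < rho ->
  (forall z, normc (z - c) < rho -> derivable f z 1) ->
  (forall z, normc (z - c) < rho -> normc (f z) <= M) ->
  (\near b, f b = 0) -> normc (b - c) < rho / 40 -> normc (e - c) < rho / 40 ->
  f e = 0.
Proof.
move=> rho0 fd fM fb bc ec.
have [<-|q0] := eqVneq b e; first exact: nbhs_singleton fb.
have M0 : 0 <= M.
  by apply: le_trans (normc_ge0 _) (fM c _); rewrite subrr normc0.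
have eb : normc (e - b) <= rho / 20.
  by apply: le_trans (normc_tri e c b) _; rewrite [normc (c - b)]normcB; lra.
have main k : normc (f e) <= 2 * (M * (3^-1) ^+ k).
  pose g (z : C) : C := f z * ((e - b) * (z - b)^-1) ^+ k.
  have -> : f e = g e by rewrite /g divff ?expr1n ?mulr1// subr_eq0 eq_sym.
  have insub z : normc (z - e) < rho / 2 -> normc (z - c) < rho.
    by move=> ze; apply: le_lt_trans (normc_tri z e c) _; lra.
  (* At distance at least rho/5 from [e], |z - b| >= rho/5 - rho/20 = 3 rho/20 while |e - b| <=
     rho/20, so the factor is at most 1/3. The disc of radius rho/2 about [e] stays within distance
     [rho] of [c]. *)
  apply: (@cauchy_estimate g e (rho / 2) (rho / 5)); [lra|lra| |].
    move=> z ze; have [->|zb] := eqVneq z b.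
      apply: (@near_eq_derivable _ _ _ (cst 0)).
        by near=> w; rewrite /g (near fb w _) ?mul0r//; near: w.
      exact: derivable_cst.
    apply: (@derivable_mul f (fun z => ((e - b) * (z - b)^-1) ^+ k)).
      by apply: fd; apply: insub.
    apply: (@derivable_expn (fun z => (e - b) * (z - b)^-1)).
    apply: (@derivable_mul (cst (e - b)) (fun z => (z - b)^-1)).
      exact: derivable_cst.
    apply: (@derivableV _ _ (fun z => z - b)); first by rewrite subr_eq0.
    by apply: derivableB; [exact: derivable_id|exact: derivable_cst].
  move=> z z1 z2; rewrite /g normcM; apply: ler_pM; rewrite ?normc_ge0//.
    by apply: fM; apply: insub.
  rewrite normcX lerXn2r ?nnegrE ?normc_ge0 ?invr_ge0// normcM normcV.
  have zb : rho * 3 / 20 <= normc (z - b).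
    by have := normc_tri z b e; rewrite [normc (b - e)]normcB; lra.
  rewrite ler_pdivrMr; last by apply: lt_le_trans zb; lra.
  lra.
apply: eq0_normc; apply/eqP; rewrite eq_le normc_ge0 andbT.
rewrite leNgt; apply/negP => fe0.
have [k hk] : exists k : nat, 2 * M / normc (f e) < k%:R.
  by exists (Num.bound (2 * M / normc (f e))); apply: archi_boundP; rewrite divr_ge0 ?mulr_ge0// ltW.
have := main k; apply/negP; rewrite -ltNge mulrA exprVn ltr_pdivrMr ?exprn_gt0//.
rewrite [_ * 3 ^+ k]mulrC -ltr_pdivrMr//; apply: lt_trans hk _.
by rewrite -natrX ltr_nat ltn_expl.
Unshelve. all: by end_near. Qed.

(** Continuity method: let [s] be the supremum of the parameters up to which [f] vanishes in
    neighbourhoods. Starting from a parameter just below [s], [uc_local] carries the vanishing past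
    [s]. *)
Lemma uc_segment (f : C -> C) :
  (forall t : R, 0 <= t <= 1 -> \forall z \near (t%:C : C), derivable f z 1) ->
  (\forall z \near (0 : C), f z = 0) -> f 1 = 0.
Proof.
move=> fd f0.
pose Z (t : R) := \forall z \near (t%:C : C), f z = 0.
pose S : set R := [set t | 0 <= t <= 1 /\ forall u, 0 <= u <= t -> Z u].
have S0 : S 0.
  split; first by rewrite lexx ler01.
  by move=> u u0; have -> : u = 0 by lra.
have hs : has_sup S by split; [exists 0|exists 1 => t [/andP[]]].
pose s := sup S.
have s0 : 0 <= s by apply: sup_upper_bound.
have s1 : s <= 1 by apply: ge_sup; [exists 0|move=> t [/andP[]]].
have [rho rho0 hrho] : exists2 rho : R, 0 < rho & forall z, normc (z - s%:C) < rho ->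
    derivable f z 1 /\ normc (f z) <= normc (f s%:C) + 1.
  have fds : \forall z \near (s%:C : C), derivable f z 1 by apply: fd; rewrite s0.
  have := nbhs_singleton fds => /derivable1_continuous /cvgrPdist_le /(_ 1 ltr01) /= fc.
  have [d1 d10 h1] := (nbhs_normc _ _).1 fds.
  have [d2 d20 h2] := (nbhs_normc _ _).1 fc.
  exists (Num.min d1 d2); first by rewrite lt_min d10.
  move=> z; rewrite lt_min => /andP[z1 z2].
  have zE : z = s%:C + (z - s%:C) by rewrite addrC subrK.
  split; first by rewrite zE; apply: h1.
  have := h2 _ z2; rewrite -zE distrC normr_normc -[1]/(1%:C) lecR => h.
  rewrite -[f z](subrK (f s%:C)); apply: le_trans (normcD _ _) _.
  by rewrite addrC lerD2l.
have [t St ts] : exists2 t, S t & s - rho / 40 < t.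
  by apply: sup_adherent => //; rewrite divr_gt0.
have tles : t <= s by apply: sup_upper_bound.
have nR (u v : R) : normc (u%:C - v%:C) = `|u - v|.
  by rewrite -rmorphB /= expr0n addr0 sqrtr_sqr.
have zero (e : C) : normc (e - s%:C) < rho / 40 -> f e = 0.
  move=> es; have zt : Z t by case: St => /andP[t0 _] /(_ t); apply; rewrite t0 lexx.
  have td : normc (t%:C - s%:C) < rho / 40.
    by rewrite nR ltr_norml; apply/andP; split; lra.
  exact: (uc_local rho0 (fun z zs => (hrho z zs).1) (fun z zs => (hrho z zs).2) zt td es).
have Zn (u : R) : `|u - s| < rho / 40 -> Z u.
  move=> us; apply/nbhs_normc; exists (rho / 40 - `|u - s|); first by lra.
  move=> h hh; apply: zero; rewrite addrAC.
  by apply: le_lt_trans (normcD _ _) _; rewrite nR; lra.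
have [s1'|s1'] := ltP s 1.
  pose u := Num.min 1 (s + rho / 80).
  have u1 : u <= 1 by rewrite ge_min lexx.
  have u2 : u <= s + rho / 80 by rewrite ge_min lexx orbT.
  have su : s < u by rewrite lt_min s1' ltrDl divr_gt0.
  have : S u.
    split; first by apply/andP; split; lra.
    move=> v /andP[v0 vu]; have [vt|tv] := leP v t.
      by case: St => _; apply; rewrite v0.
    by apply: Zn; rewrite ltr_norml; apply/andP; split; lra.
  by move=> /(sup_upper_bound hs); rewrite leNgt su.
have -> : (1 : C) = s%:C by have -> : s = 1 by lra.
by apply: zero; rewrite subrr normc0 divr_gt0.
Qed.

End UniqueContinuation.

(** * The bilinear pairing *)

Section Dotp.
Variable R : realType.
Local Notation F := (Cplx R).

Definition dotp m (a b : 'rV[F]_m) : F := (a *m b^T) 0 0.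

Lemma dotpE m (a b : 'rV[F]_m) : dotp a b = \sum_i a 0 i * b 0 i.
Proof. by rewrite /dotp mxE; apply: eq_bigr => i _; rewrite mxE. Qed.

Lemma dotpC m (a b : 'rV[F]_m) : dotp a b = dotp b a.
Proof. by rewrite !dotpE; apply: eq_bigr => i _; rewrite mulrC. Qed.

Lemma dotpDl m (a b c : 'rV[F]_m) : dotp (a + b) c = dotp a c + dotp b c.
Proof. by rewrite /dotp mulmxDl mxE. Qed.
Lemma dotpDr m (a b c : 'rV[F]_m) : dotp a (b + c) = dotp a b + dotp a c.
Proof. by rewrite dotpC dotpDl ![dotp _ a]dotpC. Qed.
Lemma dotpZl m k (a b : 'rV[F]_m) : dotp (k *: a) b = k * dotp a b.
Proof. by rewrite /dotp -scalemxAl mxE. Qed.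
Lemma dotpZr m k (a b : 'rV[F]_m) : dotp a (k *: b) = k * dotp a b.
Proof. by rewrite dotpC dotpZl dotpC. Qed.
Lemma dotp0l m (a : 'rV[F]_m) : dotp 0 a = 0.
Proof. by rewrite /dotp mul0mx mxE. Qed.
Lemma dotp0r m (a : 'rV[F]_m) : dotp a 0 = 0.
Proof. by rewrite dotpC dotp0l. Qed.
Lemma dotpNl m (a b : 'rV[F]_m) : dotp (- a) b = - dotp a b.
Proof. by rewrite /dotp mulNmx mxE. Qed.
Lemma dotpNr m (a b : 'rV[F]_m) : dotp a (- b) = - dotp a b.
Proof. by rewrite dotpC dotpNl dotpC. Qed.
Lemma dotpBl m (a b c : 'rV[F]_m) : dotp (a - b) c = dotp a c - dotp b c.
Proof. by rewrite dotpDl dotpNl. Qed.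
Lemma dotpBr m (a b c : 'rV[F]_m) : dotp a (b - c) = dotp a b - dotp a c.
Proof. by rewrite dotpDr dotpNr. Qed.

Lemma dotp_mx0 m (a b : 'rV[F]_m) : dotp a b = 0 <-> a *m b^T = 0.
Proof.
split=> [h|h]; last by rewrite /dotp h mxE.
by apply/matrixP => i j; rewrite !ord1 [RHS]mxE.
Qed.

Lemma dotp_delta m (a : 'rV[F]_m) i : dotp a (delta_mx 0 i) = a 0 i.
Proof.
rewrite dotpE (bigD1 i)//= mxE !eqxx mulr1 big1 ?addr0// => j ji.
by rewrite mxE eqxx (negbTE ji) mulr0.
Qed.

Lemma dotp_neq0 m (a : 'rV[F]_m) : a != 0 -> exists b, dotp a b != 0.
Proof. by move=> /rV0Pn [i ai]; exists (delta_mx 0 i); rewrite dotp_delta. Qed.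

Lemma dotp_neq1 m (a : 'rV[F]_m) : a != 0 -> exists b, dotp a b = 1.
Proof.
by move=> /dotp_neq0 [b ab]; exists ((dotp a b)^-1 *: b); rewrite dotpZr mulVf.
Qed.

Lemma dotp_trmx m p (a : 'rV[F]_m) (M : 'M[F]_(p, m)) (c : 'rV[F]_p) :
  dotp a (c *m M) = dotp (a *m M^T) c.
Proof. by rewrite /dotp trmx_mul mulmxA. Qed.

Lemma orth_sub m p q (z : 'rV[F]_m) (A : 'M[F]_(p, m)) (B : 'M[F]_(q, m)) :
  (B <= A)%MS -> z *m A^T = 0 -> z *m B^T = 0.
Proof. by move=> /submxP [D ->] zA; rewrite trmx_mul mulmxA zA mul0mx. Qed.

Lemma orth_adds m p q (z : 'rV[F]_m) (A : 'M[F]_(p, m)) (B : 'M[F]_(q, m)) :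
  z *m A^T = 0 -> z *m B^T = 0 -> z *m (A + B)%MS^T = 0.
Proof.
move=> zA zB; apply: (@orth_sub _ _ _ _ (col_mx A B)); first by rewrite addsmxE.
by rewrite tr_col_mx mul_mx_row zA zB row_mx0.
Qed.

Lemma orth_dotp m p (z a : 'rV[F]_m) (A : 'M[F]_(p, m)) :
  z *m A^T = 0 -> (a <= A)%MS -> dotp z a = 0.
Proof. by move=> zA aA; apply/dotp_mx0; apply: orth_sub aA zA. Qed.

Lemma notin_sub m p (w : 'rV[F]_m) (W : 'M[F]_(p, m)) : ~~ (w <= W)%MS ->
  exists2 x : 'rV[F]_m, x *m W^T = 0 & dotp x w != 0.
Proof.
rewrite submxE => /rV0Pn [i wi]; exists (cokermx W *m delta_mx i 0)^T.
  by rewrite -trmx_mul mulmxA mulmx_coker mul0mx trmx0.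
by rewrite dotpC /dotp trmxK mulmxA -colE mxE.
Qed.

Lemma orth_mx0 m p (z : 'rV[F]_m) (A : 'M[F]_(p, m)) :
  (forall a : 'rV[F]_m, (a <= A)%MS -> dotp z a = 0) -> z *m A^T = 0.
Proof.
move=> h; apply/rowP => i; have := h (row i A) (row_sub _ _).
move=> zA; transitivity (dotp z (row i A)); last by rewrite zA mxE.
by rewrite dotpE mxE; apply: eq_bigr => j _; rewrite !mxE.
Qed.

Lemma rank_full_sub m p q (A : 'M[F]_(p, m)) (B : 'M[F]_(q, m)) :
  (A <= B)%MS -> (\rank B <= \rank A)%N -> (B <= A)%MS.
Proof.
by move=> AB rr; move: (geq_leqif (mxrank_leqif_sup AB)); rewrite rr => /esym.
Qed.

(** The span of a possibly infinite family: among the subspaces contained in every subspace that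
    contains the family, one of maximal rank contains each member, since adding a missing one would
    raise the rank. *)
Lemma family_span m (X : 'rV[F]_m -> Prop) : exists S : 'M[F]_m,
  (forall x, X x -> (x <= S)%MS) /\
  (forall p (M : 'M[F]_(p, m)), (forall x, X x -> (x <= M)%MS) -> (S <= M)%MS).
Proof.
pose gen (S : 'M[F]_m) := forall p (M : 'M[F]_(p, m)), (forall x, X x -> (x <= M)%MS) -> (S <= M)%MS.
have ex : exists k, `[< exists2 S : 'M[F]_m, gen S & \rank S = k >].
  by exists 0%N; apply/asboolP; exists 0; [move=> p M _; exact: sub0mx|rewrite mxrank0].
have ub k : `[< exists2 S : 'M[F]_m, gen S & \rank S = k >] -> (k <= m)%N.
  by move=> /asboolP [S _ <-]; exact: rank_leq_row.
case: (ex_maxnP ex ub) => k /asboolP [S gS rS] kmax.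
exists S; split => // x Xx; apply/negPn/negP => xS.
have := kmax (\rank (S + x)%MS); have -> : `[< exists2 S0, gen S0 & \rank S0 = \rank (S + x)%MS >].
  apply/asboolP; exists (S + x)%MS => // p M hM.
  by rewrite addsmx_sub (gS _ M hM) hM.
move=> /(_ isT); rewrite -rS leqNgt => /negP; apply.
rewrite ltn_neqAle mxrankS ?addsmxSl// andbT.
apply: contra xS => /eqP rr; have := rank_full_sub (addsmxSl S x).
by rewrite -rr leqnn addsmx_sub => /(_ isT) /andP[].
Qed.

Lemma rank_addrow_gt m p q (A : 'M[F]_(p, m)) (x : 'rV[F]_m) (B : 'M[F]_(q, m)) :
  (x <= B)%MS -> ~~ (x <= A)%MS -> (\rank A + 1 <= \rank (A + B)%MS)%N.
Proof.
move=> xB xA; rewrite addn1 ltn_neqAle mxrankS ?addsmxSl// andbT.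
apply: contra xA => /eqP rr; have := rank_full_sub (addsmxSl A B).
rewrite -rr leqnn addsmx_sub => /(_ isT) /andP[_]; exact: submx_trans.
Qed.

Lemma rank_addrow_le m p (A : 'M[F]_(p, m)) (x : 'rV[F]_m) :
  (\rank (A + x)%MS <= \rank A + 1)%N.
Proof.
by apply: leq_trans (mxrank_adds_leqif _ _) _; rewrite leq_add2l rank_leq_row.
Qed.

End Dotp.

(** * Continuity of the pairing and neighbourhoods along complex lines *)

Section Topology.
Variable R : realType.
Local Notation C := (Cplx R).

#[global] Instance cplx_pfilter (t : C) : ProperFilter (nbhs t).
Proof. exact: nbhs_pfilter. Qed.
#[global] Instance cplx_filter (t : C) : Filter (nbhs t).
Proof. exact: nbhs_filter. Qed.
#[global] Instance rV_pfilter m (t : 'rV[C]_m) : ProperFilter (nbhs t).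
Proof. exact: nbhs_pfilter. Qed.
#[global] Instance rV_filter m (t : 'rV[C]_m) : Filter (nbhs t).
Proof. exact: nbhs_filter. Qed.

Lemma dotp_cvg (T : Type) (G : set_system T) {FG : Filter G} m (f g : T -> 'rV[C]_m) (a b : 'rV[C]_m) :
  f @ G --> a -> g @ G --> b -> (fun t => dotp (f t) (g t)) @ G --> dotp a b.
Proof.
move=> fa gb; rewrite dotpE.
under eq_fun do rewrite dotpE.
apply: cvg_big => //; first by move=> x; exact: add_continuous.
move=> i _.
have ci (x : 'rV[C]_m) : (fun M : 'rV[C]_m => M 0 i) @ x --> x 0 i by exact: coord_continuous.
apply: cvgM; first exact: cvg_comp fa (ci a).
exact: cvg_comp gb (ci b).
Qed.

Lemma dotp_cvgl (T : Type) (G : set_system T) {FG : Filter G} m (f : T -> 'rV[C]_m) (a b : 'rV[C]_m) :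
  f @ G --> a -> (fun t => dotp (f t) b) @ G --> dotp a b.
Proof. by move=> fa; apply: (@dotp_cvg T G FG m f (fun=> b) a b fa); exact: cvg_cst. Qed.

Lemma dotp_cvgr (T : Type) (G : set_system T) {FG : Filter G} m (f : T -> 'rV[C]_m) (a b : 'rV[C]_m) :
  f @ G --> a -> (fun t => dotp b (f t)) @ G --> dotp b a.
Proof. by move=> fa; apply: (@dotp_cvg T G FG m (fun=> b) f b a _ fa); exact: cvg_cst. Qed.

Lemma dotp_continuous m (x : 'rV[C]_m) : continuous (fun w : 'rV[C]_m => dotp x w).
Proof. by move=> w; apply: dotp_cvgr; exact: cvg_id. Qed.

Lemma dotp_continuousl m (x : 'rV[C]_m) : continuous (fun w : 'rV[C]_m => dotp w x).
Proof. by move=> w; apply: dotp_cvgl; exact: cvg_id. Qed.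

Lemma line_cvg m (z u : 'rV[C]_m) (t : C) : (fun s : C => z + s *: u) @ t --> z + t *: u.
Proof.
by apply: cvgD; [exact: cvg_cst|apply: cvgZr_tmp; exact: cvg_id].
Qed.

Lemma near_line m (V : set 'rV[C]_m) (z u : 'rV[C]_m) (t : C) : nbhs (z + t *: u) V ->
  \forall s \near t, V (z + s *: u).
Proof. exact: line_cvg. Qed.

Lemma near_line0 m (V : set 'rV[C]_m) (z u : 'rV[C]_m) : nbhs z V ->
  \forall s \near (0 : C), V (z + s *: u).
Proof. by move=> Vz; apply: near_line; rewrite scale0r addr0. Qed.

Lemma near0_neq0 (A : set C) : nbhs (0 : C) A -> exists2 s : C, s != 0 & A s.
Proof.
move=> /nbhs_normc [d d0 dA]; exists ((d / 2)%:C)%C.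
  by rewrite eq_complex /= eqxx andbT gt_eqF// divr_gt0.
rewrite -[X in A X]add0r; apply: dA; rewrite /= expr0n addr0 sqrtr_sqr gtr0_norm; lra.
Qed.

End Topology.

(** * Orthogonality through iterated hyperplane sections *)

Section DenseOrthogonality.
Variable R : realType.
Local Notation C := (Cplx R).

Lemma nbhs_neq0 (c : C) : c != 0 -> nbhs c [set x | x != 0].
Proof.
move=> c0; apply/nbhs_normc; exists (ComplexField.Normc.normc c).
  rewrite lt_neqAle normc_ge0 andbT eq_sym.
  by apply: contra c0 => /eqP /ComplexField.Normc.eq0_normc ->.
move=> h hc /=; apply: contraTN hc => /eqP ch.
have -> : h = - c by apply/eqP; rewrite -addr_eq0 addrC ch.
by rewrite -[- c]sub0r normcB subr0 ltxx.
Qed.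

Lemma mulmx_orth_cvg n m p (f : 'rV[C]_n -> 'rV[C]_m) (A : 'M[C]_(p, m)) (z : 'rV[C]_n) :
  (forall a : 'rV[C]_m, (fun z => dotp (f z) a) @ z --> dotp (f z) a) ->
  (forall N, nbhs z N -> exists2 z', N z' & f z' *m A^T = 0) -> f z *m A^T = 0.
Proof.
move=> fc h; apply: orth_mx0 => a aA; apply/eqP/negPn/negP => fz.
have fac := fc a.
have [z' fz' h'] : exists2 z', dotp (f z') a != 0 & f z' *m A^T = 0.
  have [|z' Nz' h'] := h (fun z => dotp (f z) a != 0); last by exists z'.
  exact: (fac _ (nbhs_neq0 fz)).
by move: fz'; rewrite (orth_dotp h' aA) eqxx.
Qed.

Lemma near_scale_exists n (V : set 'rV[C]_n) (w d : 'rV[C]_n) : nbhs w V ->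
  exists2 s : C, s != 0 & V (w + s *: d).
Proof. by move=> Vw; have [s s0 Vs] := near0_neq0 (near_line0 d Vw); exists s. Qed.

(* [W] collects the points [w'] used so far and [Y] the sum of their [T w']:
   every [z] orthogonal to [W] has [f z] orthogonal to [Y]. Each step moves the
   current point slightly so that it becomes orthogonal to a further [w'] with
   [T w'] not contained in [Y]; after [J] steps [Y = S], at points
   accumulating at [zs]. *)
Lemma dense_orthogonality n m p a b (f : 'rV[C]_n -> 'rV[C]_m)
    (T : 'rV[C]_n -> 'M[C]_(p, m)) (V V' : set 'rV[C]_n)
    (W0 : 'M[C]_(a, n)) (Z0 : 'M[C]_(b, n)) (Y0 S : 'M[C]_m) (g J : nat)
    (zs ws : 'rV[C]_n) :
  open V -> open V' ->
  (forall a : 'rV[C]_m, (fun z => dotp (f z) a) @ zs --> dotp (f zs) a) ->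
  (forall z, V z -> z *m W0^T = 0 -> f z *m Y0^T = 0) ->
  (forall z w, V z -> V' w -> z *m W0^T = 0 -> w *m Z0^T = 0 -> dotp z w = 0 ->
     f z *m (T w)^T = 0) ->
  (Y0 <= S)%MS ->
  (forall Y : 'M[C]_m, (Y0 <= Y)%MS -> (Y <= S)%MS -> (\rank Y < \rank S)%N ->
     forall w, V' w -> w *m Z0^T = 0 -> forall N, nbhs w N ->
     exists w' : 'rV[C]_n, [/\ N w', V' w', w' *m Z0^T = 0, (T w' <= S)%MS &
       (minn (\rank S) (\rank Y + g) <= \rank (Y + T w')%MS)%N]) ->
  V zs -> zs *m W0^T = 0 -> V' ws -> ws *m Z0^T = 0 -> dotp zs ws = 0 ->
  (\rank S <= \rank Y0 + g * J)%N -> (\rank W0 + J + 1 + \rank Z0 <= n)%N ->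
  f zs *m S^T = 0.
Proof.
move=> oV oV' fc fY0 fT Y0S grow Vzs zsW V'ws wsZ zsws rS rn.
suff main j : (j <= J)%N -> forall N, nbhs zs N ->
    exists (z w : 'rV[C]_n) (W : 'M[C]_n) (Y : 'M[C]_m),
    [/\ [/\ N z, V z, (W0 <= W)%MS, (\rank W <= \rank W0 + j)%N & z *m W^T = 0],
        [/\ V' w, w *m Z0^T = 0 & dotp z w = 0],
        [/\ (Y0 <= Y)%MS, (Y <= S)%MS & (minn (\rank S) (\rank Y0 + g * j) <= \rank Y)%N] &
        forall z', V z' -> z' *m W^T = 0 -> f z' *m Y^T = 0].
  apply: mulmx_orth_cvg fc _ => N Nzs.
  have [z [w [W [Y [[Nz Vz _ _ zW] _ [_ YS rY] fY]]]]] := main J (leqnn _) N Nzs.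
  exists z => //; apply: orth_sub (fY z Vz zW).
  apply: rank_full_sub YS _; apply: leq_trans rY.
  by rewrite leq_min leqnn.
elim: j => [_ N Nzs|j IH jJ N Nzs].
  exists zs, ws, <<W0>>%MS, Y0; split; [split|split|split|] => //.
  - exact: nbhs_singleton.
  - by rewrite genmxE.
  - by rewrite genmxE addn0.
  - by apply: orth_sub zsW; rewrite genmxE.
  - by rewrite muln0 addn0 geq_minr.
  - by move=> z' Vz' z'W; apply: fY0 => //; apply: orth_sub z'W; rewrite genmxE.
have Ni : nbhs zs (N° `&` V).
  by apply: filterI; [apply: open_nbhs_nbhs; split; [exact: open_interior|]|exact: open_nbhs_nbhs].
have [z [w [W [Y [[[Nz _] Vz W0W rW zW] [V'w wZ zw] [Y0Y YS rY] fY]]]]] := IH (ltnW jJ) _ Ni.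
have [rYS|rYS] := leqP (\rank S) (\rank Y).
  exists z, w, W, Y; split; [split|split|split|] => //.
  - exact: interior_subset.
  - by apply: leq_trans rW _; rewrite addnS.
  - by apply: leq_trans rYS; exact: geq_minl.
(* If [w] lies in [W], it is moved inside the common orthogonal of [z] and [Z0]: that space has
   dimension at least n - 1 - rank Z0, which exceeds rank W as long as j < J. *)
have [w0 [V'w0 w0Z zw0 w0W]] : exists w0, [/\ V' w0, w0 *m Z0^T = 0, dotp z w0 = 0 & ~~ (w0 <= W)%MS].
  have [wW|wW] := boolP (w <= W)%MS; last by exists w.
  pose K := kermx (row_mx z^T Z0^T).
  have : ~~ (K <= W)%MS.
    apply/negP => /mxrankS; rewrite mxrank_ker.
    have r1 : (\rank (row_mx z^T Z0^T) <= 1 + \rank Z0)%N.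
      rewrite -mxrank_tr tr_row_mx !trmxK -addsmxE.
      apply: leq_trans (mxrank_adds_leqif _ _) _; rewrite leq_add2r; exact: rank_leq_row.
    move=> h; move: rn jJ rW r1 h; clear; lia.
  move=> /row_subPn [i Ki].
  have [s s0 V's] := near_scale_exists (row i K) (open_nbhs_nbhs (conj oV' V'w)).
  have Kz : row i K *m row_mx z^T Z0^T = 0 by rewrite -row_mul mulmx_ker row0.
  move: Kz; rewrite mul_mx_row => /eqP; rewrite row_mx_eq0 => /andP[/eqP Kz /eqP KZ].
  exists (w + s *: row i K); split => //.
  - by rewrite mulmxDl wZ -scalemxAl KZ scaler0 addr0.
  - rewrite dotpDr zw dotpZr add0r dotpC; have /dotp_mx0 -> := Kz; exact: mulr0.
  - apply: contra Ki => h; rewrite -(eqmx_scale _ s0).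
    have -> : s *: row i K = (w + s *: row i K) - w by rewrite addrAC subrr add0r.
    by rewrite addmx_sub// eqmx_opp.
(* Moving [z] along [x] keeps it orthogonal to [W], and the multiple in [c w'] makes it orthogonal
   to [w']. The correction vanishes at [w0] because [z] is orthogonal to [w0], so [c w'] is close to
   [z] for [w'] close to [w0]. *)
have [x xW xw0] := notin_sub w0W.
pose c (w' : 'rV[C]_n) := z - (dotp z w' / dotp x w') *: x.
have cc : c @ w0 --> z.
  rewrite -[X in _ --> X]subr0 -(scale0r x) -(mul0r (dotp x w0)^-1) -zw0.
  apply: cvgB; first exact: cvg_cst.
  apply: cvgZr_tmp; apply: cvgM; first exact: dotp_continuous.
  by apply: cvgV => //; exact: dotp_continuous.
have nN : nbhs w0 [set w' | (N° `&` V) (c w') /\ dotp x w' != 0].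
  apply: filterI.
    apply: cc; apply: filterI; apply: open_nbhs_nbhs; split => //; exact: open_interior.
  have xc : (fun w => dotp x w) @ w0 --> dotp x w0 by exact: dotp_continuous.
  exact: (xc _ (nbhs_neq0 xw0)).
have [w' [[[Nc Vc] xw'] V'w' w'Z TS rT]] := grow Y Y0Y YS rYS w0 V'w0 w0Z _ nN.
have cw' : dotp (c w') w' = 0 by rewrite /c dotpBl dotpZl divfK// subrr.
exists (c w'), w', (W + w')%MS, (Y + T w')%MS; split; [split|split|split|] => //.
- exact: interior_subset.
- exact: submx_trans W0W (addsmxSl _ _).
- by apply: leq_trans (rank_addrow_le _ _) _; move: rW; clear; lia.
- apply: orth_adds; last exact/dotp_mx0.
  by rewrite /c mulmxBl zW -scalemxAl xW scaler0 subrr.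
- exact: submx_trans Y0Y (addsmxSl _ _).
- by rewrite addsmx_sub YS.
- apply: leq_trans rT; rewrite leq_min geq_minl /= mulnS.
  move: rY; rewrite geq_min => /orP[|rY]; first by rewrite leqNgt rYS.
  by apply: leq_trans (geq_minr _ _) _; rewrite [(g + _)%N]addnC addnA leq_add2r.
move=> z' Vz' z'W.
have z'1 := orth_sub (addsmxSl W w') z'W.
have z'2 := orth_dotp z'W (addsmxSr W w').
apply: orth_adds; first exact: fY.
by apply: fT => //; exact: orth_sub W0W z'1.
Qed.

End DenseOrthogonality.

(** * Holomorphy along lines, Jacobians, unique continuation on convex sets *)

Section Hol.
Variable R : realType.
Local Notation C := (Cplx R).

(** Holomorphy is asked on affine complex lines only, which is what one-variable unique continuation
    along segments consumes. *)
Definition lhol n (V : set 'rV[C]_n) (psi : 'rV[C]_n -> C) :=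
  forall z u, V z -> derivable (fun s : C => psi (z + s *: u)) 0 1.

Definition convexC n (V : set 'rV[C]_n) :=
  forall z z' : 'rV[C]_n, V z -> V z' -> forall t : R, 0 <= t <= 1 -> V (z + (t%:C)%C *: (z' - z)).

(* [D] is the Jacobian matrix, acting on row vectors on the right; continuity is
   only asked of the coordinates. *)
Definition hol_at n m (f : 'rV[C]_n -> 'rV[C]_m) (z : 'rV[C]_n) (D : 'M[C]_(n, m)) :=
  (forall phi : 'rV[C]_m, (fun z' => dotp (f z') phi) @ z --> dotp (f z) phi) /\
  forall (u : 'rV[C]_n) (phi : 'rV[C]_m),
    is_derive (0 : C) (1 : C) (fun s : C => dotp (f (z + s *: u)) phi) (dotp (u *m D) phi).

Definition hol n m (V : set 'rV[C]_n) (f : 'rV[C]_n -> 'rV[C]_m) :=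
  forall z, V z -> exists D, hol_at f z D.

Lemma derivable_line n (psi : 'rV[C]_n -> C) (z u : 'rV[C]_n) (t : C) :
  derivable (fun s : C => psi (z + t *: u + s *: u)) 0 1 ->
  derivable (fun s : C => psi (z + s *: u)) t 1.
Proof.
rewrite /derivable => fd.
rewrite (_ : (fun h => _) = fun h => h^-1 *: (((fun s : C => psi (z + t *: u + s *: u)) \o shift 0) (h *: 1) - psi (z + t *: u + 0 *: u)))//.
apply/funext => h; rewrite /shift /= scale0r !addr0.
by rewrite scalerDl addrCA [_ + (z + _)]addrC.
Qed.

Lemma uc_line n (V : set 'rV[C]_n) (psi : 'rV[C]_n -> C) (z z' : 'rV[C]_n) :
  open V -> convexC V -> lhol V psi -> V z -> V z' ->
  (\forall s \near (0 : C), psi (z + s *: (z' - z)) = 0) -> psi z' = 0.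
Proof.
move=> oV cV lp Vz Vz' near0.
have := @uc_segment R (fun s => psi (z + s *: (z' - z))) _ near0.
rewrite scale1r [z + (_ - z)]addrC subrK; apply => t t01.
have := near_line (open_nbhs_nbhs (conj oV (cV z z' Vz Vz' t t01))).
by apply: filterS => s Vs; apply: derivable_line; exact: lp.
Qed.

Lemma uc_nbhs n (V : set 'rV[C]_n) (psi : 'rV[C]_n -> C) (z z' : 'rV[C]_n) :
  open V -> convexC V -> lhol V psi -> V z -> V z' ->
  (\forall w \near z, psi w = 0) -> psi z' = 0.
Proof.
move=> oV cV lp Vz Vz' near0; apply: (uc_line oV cV lp Vz Vz').
exact: (@near_line0 R n (fun w => psi w = 0) z (z' - z) near0).
Qed.

(** The witness stays on the line from [z] to [z'], so linear conditions shared by both points, such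
    as orthogonality to a fixed vector, carry over to it. *)
Lemma uc_dense_line n (V N : set 'rV[C]_n) (psi : 'rV[C]_n -> C) (z z' : 'rV[C]_n) :
  open V -> convexC V -> lhol V psi -> V z -> V z' -> psi z' != 0 -> nbhs z N ->
  exists s : C, [/\ N (z + s *: (z' - z)), V (z + s *: (z' - z)) &
    psi (z + s *: (z' - z)) != 0].
Proof.
move=> oV cV lp Vz Vz' p0 Nz; apply: contrapT => h.
move/negP: p0; apply; apply/eqP; apply: (uc_line oV cV lp Vz Vz').
have h1 := near_line0 (z' - z) Nz.
have h2 := near_line0 (z' - z) (open_nbhs_nbhs (conj oV Vz)).
near=> s; apply/eqP/negPn/negP => ps; apply: h; exists s; split => //.
  by near: s.
by near: s.
Unshelve. all: by end_near.
Qed.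

Lemma uc_dense n (V N : set 'rV[C]_n) (psi : 'rV[C]_n -> C) (z z' : 'rV[C]_n) :
  open V -> convexC V -> lhol V psi -> V z -> V z' -> psi z' != 0 -> nbhs z N ->
  exists w, [/\ N w, V w & psi w != 0].
Proof.
move=> oV cV lp Vz Vz' p0 Nz.
by have [s] := uc_dense_line oV cV lp Vz Vz' p0 Nz; exists (z + s *: (z' - z)).
Qed.

Lemma derivable_add (f g : C -> C) (c : C) : derivable f c 1 -> derivable g c 1 ->
  derivable (fun z => f z + g z) c 1.
Proof. by move=> df dg; apply: (derivableD df dg). Qed.

Lemma lhol_cst n (V : set 'rV[C]_n) (c : C) : lhol V (fun=> c).
Proof. by move=> z u _; exact: derivable_cst. Qed.

Lemma lholM n (V : set 'rV[C]_n) (p q : 'rV[C]_n -> C) :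
  lhol V p -> lhol V q -> lhol V (fun z => p z * q z).
Proof.
move=> hp hq z u Vz.
exact: (derivable_mul (hp z u Vz) (hq z u Vz)).
Qed.

Lemma lholD n (V : set 'rV[C]_n) (p q : 'rV[C]_n -> C) :
  lhol V p -> lhol V q -> lhol V (fun z => p z + q z).
Proof.
move=> hp hq z u Vz.
exact: (derivable_add (hp z u Vz) (hq z u Vz)).
Qed.

Lemma lholN n (V : set 'rV[C]_n) (p : 'rV[C]_n -> C) :
  lhol V p -> lhol V (fun z => - p z).
Proof.
move=> hp z u Vz; exact: (derivableN (hp z u Vz)).
Qed.

Lemma lholB n (V : set 'rV[C]_n) (p q : 'rV[C]_n -> C) :
  lhol V p -> lhol V q -> lhol V (fun z => p z - q z).
Proof. by move=> hp hq; exact: (lholD hp (lholN hq)). Qed.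

Lemma lhol_dotp n (V : set 'rV[C]_n) (phi : 'rV[C]_n) : lhol V (fun z => dotp z phi).
Proof.
move=> z u Vz; under eq_fun do rewrite dotpDl dotpZl.
have h1 : derivable (fun s : C => s) 0 1 by exact: derivable_id.
exact: (derivable_add (derivable_cst _ _ _) (derivable_mul h1 (derivable_cst _ _ _))).
Qed.

Lemma lhol_hol n m (V : set 'rV[C]_n) (f : 'rV[C]_n -> 'rV[C]_m) (phi : 'rV[C]_m) :
  hol V f -> lhol V (fun z => dotp (f z) phi).
Proof. by move=> hf z u Vz; have [D [_ /(_ u phi) [h _]]] := hf z Vz. Qed.

Lemma hol_at_cont n m (f : 'rV[C]_n -> 'rV[C]_m) (z : 'rV[C]_n) D :
  hol_at f z D -> forall phi, (fun z' => dotp (f z') phi) @ z --> dotp (f z) phi.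
Proof. by case. Qed.

Lemma is_derive_mul (f g : C -> C) (c df dg : C) : is_derive c 1 f df -> is_derive c 1 g dg ->
  is_derive c 1 (fun z => f z * g z) (f c * dg + g c * df).
Proof. by move=> hf hg; exact: (is_deriveM hf hg). Qed.

Lemma is_derive_add (f g : C -> C) (c df dg : C) : is_derive c 1 f df -> is_derive c 1 g dg ->
  is_derive c 1 (fun z => f z + g z) (df + dg).
Proof. by move=> hf hg; exact: (is_deriveD hf hg). Qed.

Lemma is_derive_sumr k (f : 'I_k -> C -> C) (df : 'I_k -> C) (c : C) :
  (forall i, is_derive c 1 (f i) (df i)) ->
  is_derive c 1 (fun z => \sum_i f i z) (\sum_i df i).
Proof.
move=> hf; elim: k f df hf => [|k IH] f df hf.
  by under eq_fun do rewrite big_ord0; rewrite big_ord0; exact: is_derive_cst.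
under eq_fun do rewrite big_ord_recl; rewrite big_ord_recl.
exact: (is_derive_add (hf ord0) (IH (fun i => f (lift ord0 i)) (fun i => df (lift ord0 i)) (fun i => hf (lift ord0 i)))).
Qed.

Lemma is_derive_near (f g : C -> C) (c df dg : C) :
  is_derive c 1 f df -> is_derive c 1 g dg -> (\forall s \near c, f s = g s) -> df = dg.
Proof.
move=> hf hg fg; have h := near_eq_is_derive fg hf.
by rewrite -(@derive_val _ _ _ _ _ _ _ h) -(@derive_val _ _ _ _ _ _ _ hg).
Qed.

Lemma hol_at_dot2 n n' m (f : 'rV[C]_n -> 'rV[C]_m) (g : 'rV[C]_n' -> 'rV[C]_m)
    (z u : 'rV[C]_n) (w v : 'rV[C]_n') Df Dg :
  hol_at f z Df -> hol_at g w Dg ->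
  is_derive (0 : C) (1 : C) (fun s : C => dotp (f (z + s *: u)) (g (w + s *: v)))
    (dotp (u *m Df) (g w) + dotp (f z) (v *m Dg)).
Proof.
move=> [_ hf] [_ hg].
under eq_fun do rewrite dotpE.
have -> : dotp (u *m Df) (g w) + dotp (f z) (v *m Dg) =
    \sum_i (f z 0 i * (v *m Dg) 0 i + g w 0 i * (u *m Df) 0 i).
  rewrite !dotpE -big_split; apply: eq_bigr => i _ /=.
  by rewrite addrC; congr (_ + _); rewrite mulrC.
apply: is_derive_sumr => i.
have := is_derive_mul (hf u (delta_mx 0 i)) (hg v (delta_mx 0 i)).
rewrite !scale0r !addr0 !dotp_delta.
by under eq_fun do rewrite !dotp_delta.
Qed.

Lemma hol_at_dotl n m (f : 'rV[C]_n -> 'rV[C]_m) (z u : 'rV[C]_n) phi D :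
  hol_at f z D -> is_derive (0 : C) (1 : C) (fun s : C => dotp (f (z + s *: u)) phi) (dotp (u *m D) phi).
Proof. by case. Qed.

Lemma is_derive_dotp_line n (z u phi : 'rV[C]_n) :
  is_derive (0 : C) (1 : C) (fun s : C => dotp (z + s *: u) phi) (dotp u phi).
Proof.
under eq_fun do rewrite dotpDl dotpZl.
have h0 (c : C) : is_derive (0 : C) (1 : C) (fun _ : C => c) 0 by exact: is_derive_cst.
have h1 : is_derive (0 : C) (1 : C) (fun s : C => s) 1 by exact: is_derive_id.
have := is_derive_add (h0 (dotp z phi)) (is_derive_mul h1 (h0 (dotp u phi))).
by rewrite /= mul0r !add0r mulr1.
Qed.

End Hol.

(** * Functions with zero complex derivative *)

Section ZeroDerivative.
Variable R : realType.
Local Notation C := (Cplx R).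
Import ComplexField.Normc.
Local Notation normc := (@normc R).
Local Notation Re := (@complex.Re R).
Local Notation Im := (@complex.Im R).
Local Open Scope complex_scope.

Lemma is_derive0_real (h : R -> R) (x : R) :
  (forall e : R, 0 < e -> exists2 d : R, 0 < d & forall k, `|k| < d -> `|h (x + k) - h x| <= e * `|k|) ->
  is_derive x 1 h 0.
Proof.
move=> hx.
have cv : (fun k => k^-1 *: ((h \o shift x) (k *: 1) - h x)) @ 0^' --> (0 : R).
  apply/cvgrPdist_le => e e0; have [d d0 dP] := hx e e0.
  rewrite /dnbhs /within /=; apply/nbhs_ballP; exists d => //= k; rewrite /ball /= sub0r normrN => kd k0.
  rewrite sub0r normrN normrM normfV ler_pdivrMl ?normr_gt0// mulrC.
  by rewrite [_ *: 1]mulr1 [k + x]addrC; exact: dP.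
apply: DeriveDef; first by apply/cvg_ex; exists 0.
exact: cvg_lim cv.
Qed.

Lemma zero_deriv_const (q : C -> C) (s : C) :
  (forall t : R, 0 <= t <= 1 -> is_derive (t%:C * s : C) 1 q 0) -> q s = q 0.
Proof.
move=> hq.
have main (t : R) : 0 <= t <= 1 -> forall e : R, 0 < e ->
    exists2 d : R, 0 < d & forall k : R, `|k| < d ->
    normc (q ((t + k)%:C * s) - q (t%:C * s)) <= e * `|k|.
  move=> t01 e e0; have [hd he] := hq t t01.
  have /cvgrPdist_le := hd.
  rewrite -[lim _]/('D_1 q (t%:C * s)) he => cv.
  pose M := normc s + 1.
  have M0 : 0 < M by rewrite ltr_wpDl// normc_ge0.
  have eM : 0 < (e / M)%:C :> C by rewrite ltcR divr_gt0.
  have /nbhs_normc [d d0 dP] := cv _ eM.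
  exists (d / M); first by rewrite divr_gt0.
  move=> k kd; have [->|k0] := eqVneq k 0.
    by rewrite addr0 subrr normc0 normr0 mulr0.
  have [s0|s0] := eqVneq s 0.
    by rewrite s0 !mulr0 subrr normc0 mulr_ge0// ltW.
  have nk : normc (k%:C * s) = `|k| * normc s by rewrite normcM /= expr0n addr0 sqrtr_sqr.
  have ksM : `|k| * normc s <= `|k| * M by rewrite ler_wpM2l// /M lerDl.
  have lt1 : `|k| * normc s < d by apply: le_lt_trans ksM _; rewrite -ltr_pdivlMr.
  have nz : k%:C * s != 0 :> C by rewrite mulf_neq0// eq_complex /= eqxx andbT.
  have := dP (k%:C * s); rewrite add0r nk => /(_ lt1 nz).
  rewrite [_ *: 1]mulr1 sub0r normrN normrM normfV.
  rewrite /shift /= [k%:C * s + _]addrC -mulrDl -rmorphD /= !normr_normc nk.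
  rewrite -fmorphV -rmorphM /= lecR => h.
  have nks : 0 < `|k| * normc s.
    rewrite mulr_gt0 ?normr_gt0// lt_neqAle normc_ge0 andbT eq_sym.
    by apply: contra s0 => /eqP /eq0_normc ->.
  move: h; rewrite ler_pdivrMl// => /le_trans; apply.
  rewrite [_ * (e / M)]mulrA ler_pdivrMr//.
  have -> : `|k| * normc s * e = e * `|k| * normc s by ring.
  rewrite ler_wpM2l ?mulr_ge0//; first exact: ltW.
  by rewrite /M lerDl.
have part (p : C -> R) : (forall z w, p (z - w) = p z - p w) ->
    (forall z, `|p z| <= normc z) -> p (q s) = p (q 0).
  move=> pB pn; pose h (t : R) := p (q (t%:C * s)).
  have hd (t : R) : 0 <= t <= 1 -> is_derive t 1 h 0.
    move=> t01; apply: is_derive0_real => e e0; have [d d0 dP] := main t t01 e e0.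
    exists d => // k kd; rewrite /h -pB; exact: le_trans (pn _) (dP k kd).
  have cont : {within `[0, 1], continuous h}.
    apply: derivable_within_continuous => x; rewrite in_itv /= => x01.
    by have [] := hd x x01.
  have hd' (x : R) : x \in `]0, 1[%R -> is_derive x 1 h ((fun=> 0) x).
    by rewrite in_itv /= => /andP[x0 x1]; apply: hd; rewrite !ltW.
  have [c _] := MVT_segment ler01 hd' cont.
  by rewrite mul0r /h mul1r mul0r => /eqP; rewrite subr_eq0 => /eqP.
apply/eqP; rewrite eq_complex; apply/andP; split; apply/eqP.
  apply: (part Re); last exact: Re_le_normc.
  by case=> a b [c d].
apply: (part Im); last exact: Im_le_normc.
by case=> a b [c d].
Qed.

Lemma is_derive_inv (f : C -> C) (c df : C) : is_derive c 1 f df -> f c != 0 ->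
  is_derive c 1 (fun z => (f z)^-1) (- ((f c)^-1 ^+ 2 * df)).
Proof.
move=> [h1 h2] f0; apply: DeriveDef; first exact: (derivableV f0 h1).
have := deriveV f0 h1; rewrite h2 => e; rewrite -exprVn in e.
by transitivity (- ((f c)^-1 ^+ 2 *: df)); [rewrite -scaleNr; exact: e|].
Qed.

(** The vanishing Wronskian gives [N / D] zero derivative near 0, hence the constant value it has at
    0. *)
Lemma ratio_const (N D dN dD : C -> C) :
  (\forall s \near (0 : C), [/\ is_derive (s : C) (1 : C) N (dN s), is_derive (s : C) (1 : C) D (dD s),
     dN s * D s = N s * dD s & D s != 0]) ->
  N 0 = 0 -> \forall s \near (0 : C), N s = 0.
Proof.
move=> /nbhs_normc [d d0 dP] N0; apply/nbhs_normc; exists d => // s sd.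
rewrite add0r; have [hN hD e D0] := dP s sd.
suff : N s * (D s)^-1 = N 0 * (D 0)^-1.
  rewrite N0 mul0r => /eqP; rewrite mulf_eq0 invr_eq0 add0r in D0 * .
  by rewrite (negbTE D0) orbF => /eqP.
apply: (@zero_deriv_const (fun s => N s * (D s)^-1)) => t t01.
have ts : normc (t%:C * s) < d.
  apply: le_lt_trans sd; rewrite normcM /= expr0n addr0 sqrtr_sqr.
  rewrite ler_piMl ?normc_ge0// ger0_norm; lra.
have [] := dP _ ts; rewrite add0r => hN1 hD1 e' D0'.
have := is_derive_mul hN1 (is_derive_inv hD1 D0').
have -> : dN (t%:C * s) = N (t%:C * s) * dD (t%:C * s) / D (t%:C * s) by rewrite -e' mulfK.
by set x := (X in is_derive _ _ _ X -> _); have -> : x = 0 by rewrite /x; field.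
Qed.

End ZeroDerivative.

(** * Pairs of holomorphic maps preserving orthogonality *)

Section NullPairs.
Variable R : realType.
Local Notation C := (Cplx R).

Definition null_orth n m (V V' : set 'rV[C]_n) (f g : 'rV[C]_n -> 'rV[C]_m) :=
  forall z w, V z -> V' w -> dotp z w = 0 -> dotp (f z) (g w) = 0.

Definition spanning n m (V : set 'rV[C]_n) (f : 'rV[C]_n -> 'rV[C]_m) :=
  forall phi : 'rV[C]_m, (forall z, V z -> dotp (f z) phi = 0) -> phi = 0.

Lemma null_orthC n m (V V' : set 'rV[C]_n) (f g : 'rV[C]_n -> 'rV[C]_m) :
  null_orth V V' f g -> null_orth V' V g f.
Proof. by move=> h w z Vw Vz wz; rewrite dotpC; apply: h => //; rewrite dotpC. Qed.

(** For [v] orthogonal to [z] the line w + s v stays orthogonal to [z], so the functional v |-> f z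
    . (v Dg) vanishes on the orthogonal of [z] and is a multiple of z . v. *)
Lemma null_deriv n m (V V' : set 'rV[C]_n) (f g : 'rV[C]_n -> 'rV[C]_m)
    (z w : 'rV[C]_n) (Dg : 'M[C]_(n, m)) :
  open V' -> null_orth V V' f g -> V z -> V' w -> z != 0 -> dotp z w = 0 ->
  hol_at g w Dg ->
  exists kap : C, forall v, dotp (f z) (v *m Dg) = dotp z v * kap.
Proof.
move=> oV' h Vz V'w z0 zw hg.
have ker v : dotp z v = 0 -> dotp (f z) (v *m Dg) = 0.
  move=> zv; have := hol_at_dotl v (f z) hg; rewrite [dotp (f z) _]dotpC => hd.
  apply: (is_derive_near hd (is_derive_cst (0 : C) (0 : C) (1 : C))).
  apply: filterS (near_line0 v (open_nbhs_nbhs (conj oV' V'w))) => s V's.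
  by rewrite dotpC; apply: h => //; rewrite dotpDr dotpZr zw zv mulr0 addr0.
have [v0 zv0] := dotp_neq1 z0.
exists (dotp (f z) (v0 *m Dg)) => v.
have := ker (v - dotp z v *: v0); rewrite dotpBr dotpZr zv0 mulr1 subrr => /(_ erefl).
by rewrite mulmxBl -scalemxAl dotpBr dotpZr => /eqP; rewrite subr_eq0 => /eqP.
Qed.

(** With z . v = 1, u . w = -1 and u . v = 0, the pair (z + s u, w + s v) is orthogonal for every s;
    differentiating f . g along it gives kap - lam = 0. *)
Lemma null_deriv_eq n m (V V' : set 'rV[C]_n) (f g : 'rV[C]_n -> 'rV[C]_m)
    (z w : 'rV[C]_n) (Df Dg : 'M[C]_(n, m)) (kap lam : C) :
  open V -> open V' -> null_orth V V' f g -> V z -> V' w -> z != 0 -> w != 0 ->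
  dotp z w = 0 -> hol_at f z Df -> hol_at g w Dg ->
  (forall v, dotp (f z) (v *m Dg) = dotp z v * kap) ->
  (forall u, dotp (u *m Df) (g w) = dotp u w * lam) -> kap = lam.
Proof.
move=> oV oV' h Vz V'w z0 w0 zw hf hg hk hl.
have [v zv] := dotp_neq1 z0; have [u0 wu0] := dotp_neq1 w0.
pose u := - u0 + dotp u0 v *: z.
have uw : dotp u w = -1 by rewrite /u dotpDl dotpNl dotpZl zw mulr0 addr0 dotpC wu0.
have uv : dotp u v = 0 by rewrite /u dotpDl dotpNl dotpZl zv mulr1 addNr.
clearbody u.
have := is_derive_near (hol_at_dot2 u v hf hg) (is_derive_cst (0 : C) (0 : C) (1 : C)) _.
rewrite hk hl zv uw mul1r mulN1r => hh.
suff /hh /eqP : \forall s \near (0 : C), dotp (f (z + s *: u)) (g (w + s *: v)) = 0.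
  by rewrite addrC subr_eq0 => /eqP.
have h1 := near_line0 u (open_nbhs_nbhs (conj oV Vz)).
have h2 := near_line0 v (open_nbhs_nbhs (conj oV' V'w)).
near=> s; apply: h; [by near: s|by near: s|].
by rewrite !(dotpDl, dotpDr, dotpZl, dotpZr) zw zv uw uv !mulr0 mulr1 mulrN1 addr0 add0r subrr.
Unshelve. all: by end_near. Qed.

(** Along z + s u, which stays orthogonal to [w], the factor of [null_deriv] varies with s and is
    not known to be differentiable. It is eliminated by comparing the directions [v] and [v0], and
    the resulting equality of products is differentiated. *)
Lemma null_deriv2 n m (V V' : set 'rV[C]_n) (f g : 'rV[C]_n -> 'rV[C]_m)
    (z w : 'rV[C]_n) (Df Dg : 'M[C]_(n, m)) (c : C) (u v : 'rV[C]_n) :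
  open V -> open V' -> ~ V 0 -> null_orth V V' f g -> V z -> V' w ->
  dotp z w = 0 -> hol_at f z Df -> hol_at g w Dg ->
  (forall v, dotp (f z) (v *m Dg) = dotp z v * c) ->
  dotp u w = 0 -> dotp z v = 0 ->
  dotp (u *m Df) (v *m Dg) = c * dotp u v.
Proof.
move=> oV oV' V0 h Vz V'w zw hf hg hc uw zv.
have nz z' : V z' -> z' != 0 by apply: contraPneq => ->.
have [v0 zv0] := dotp_neq1 (nz z Vz).
have h1 := hol_at_dotl u (v *m Dg) hf.
have h2 := hol_at_dotl u (v0 *m Dg) hf.
have l2 := is_derive_dotp_line z u v0.
have ls : is_derive (0 : C) (1 : C) (fun s : C => s * dotp u v) (dotp u v).
  have hid : is_derive (0 : C) (1 : C) (fun s : C => s) 1 by exact: is_derive_id.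
  have hcst : is_derive (0 : C) (1 : C) (fun _ : C => dotp u v) 0 by exact: is_derive_cst.
  by have := is_derive_mul hid hcst; rewrite mul0r add0r mulr1.
have := is_derive_near (is_derive_mul h1 l2) (is_derive_mul ls h2).
rewrite !scale0r !addr0 !hc zv zv0 !mul0r !add0r !mul1r => ->.
  by [].
apply: filterS (near_line0 u (open_nbhs_nbhs (conj oV Vz))) => s Vs.
have zsw : dotp (z + s *: u) w = 0 by rewrite dotpDl dotpZl zw uw mulr0 addr0.
have [kap hk] := null_deriv oV' h Vs V'w (nz _ Vs) zsw hg.
by rewrite !hk dotpDl dotpZl zv add0r; ring.
Qed.

End NullPairs.

(** * Growth of first jets and existence of a transversal pair *)

Section Transversality.
Variable R : realType.
Local Notation C := (Cplx R).

Lemma annihilator m p (Y : 'M[C]_(p, m)) : (\rank Y < m)%N ->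
  exists2 phi : 'rV[C]_m, phi != 0 & phi *m Y^T = 0.
Proof.
move=> rY; have : kermx Y^T != 0.
  by rewrite -mxrank_eq0 mxrank_ker mxrank_tr -lt0n subn_gt0.
by move=> /rowV0Pn [phi /sub_kermxP h phi0]; exists phi.
Qed.

Lemma open_interiorI n (V N : set 'rV[C]_n) (w : 'rV[C]_n) :
  open V -> V w -> nbhs w N -> nbhs w (N° `&` V).
Proof.
move=> oV Vw Nw; apply: filterI; last exact: open_nbhs_nbhs.
by apply: open_nbhs_nbhs; split; [exact: open_interior|].
Qed.

Lemma is_derive_line n (psi : 'rV[C]_n -> C) (z u : 'rV[C]_n) (t d : C) :
  is_derive (0 : C) (1 : C) (fun s : C => psi (z + t *: u + s *: u)) d ->
  is_derive (t : C) (1 : C) (fun s : C => psi (z + s *: u)) d.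
Proof.
move=> [h1 h2]; apply: DeriveDef; first exact: derivable_line.
rewrite -h2 /derive.
suff -> : (fun h : C => h^-1 *: (((fun s : C => psi (z + s *: u)) \o shift t) (h *: 1) - psi (z + t *: u))) =
  fun h => h^-1 *: (((fun s : C => psi (z + t *: u + s *: u)) \o shift 0) (h *: 1) - psi (z + t *: u + 0 *: u)) by [].
apply/funext => h; rewrite /shift /= scale0r !addr0.
by rewrite scalerDl addrCA [_ + (z + _)]addrC.
Qed.

(* Otherwise [D w'] would map into [Y + <g w'>], so that the class of [g] modulo
   [Y] would have constant direction along lines (by [ratio_const]), against
   [spanning]. *)
Lemma jet_growth n m (V : set 'rV[C]_n) (g : 'rV[C]_n -> 'rV[C]_m)
    (D : 'rV[C]_n -> 'M[C]_(n, m)) (Y : 'M[C]_m) (w : 'rV[C]_n) (N : set 'rV[C]_n) :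
  open V -> convexC V -> (forall w, V w -> hol_at g w (D w)) -> spanning V g ->
  (\rank Y < m)%N -> V w -> nbhs w N ->
  exists w', [/\ N w', V w' &
    (minn m (\rank Y + 2) <= \rank (Y + col_mx (g w') (D w'))%MS)%N].
Proof.
move=> oV cV hg sg rY Vw Nw; apply: contrapT => noex.
have H w' : N w' -> V w' -> (\rank (Y + col_mx (g w') (D w'))%MS < minn m (\rank Y + 2))%N.
  by move=> Nw' Vw'; rewrite ltnNge; apply/negP => h; apply: noex; exists w'.
have hol_g : hol V g by move=> z Vz; exists (D z); exact: hg.
have [psi psi0 psiY] := annihilator rY.
have [w2 Vw2 gw2] : exists2 w2, V w2 & dotp (g w2) psi != 0.
  apply: contrapT => h; move/negP: psi0; apply; apply/eqP; apply: sg => z Vz.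
  by apply/eqP/negPn/negP => gz; apply: h; exists z.
have [w1 [[Nw1 _] Vw1 gw1]] := uc_dense oV cV (@lhol_hol R n m V g psi hol_g) Vw Vw2 gw2 (open_interiorI oV Vw Nw).
have notinY w' : dotp (g w') psi != 0 -> ~~ (g w' <= Y)%MS.
  by apply: contra => gY; rewrite dotpC (orth_dotp psiY gY).
have gT w' : (g w' <= col_mx (g w') (D w'))%MS by rewrite -addsmxE addsmxSl.
have DT w' : (D w' <= col_mx (g w') (D w'))%MS by rewrite -addsmxE addsmxSr.
have subT w' : N w' -> V w' -> dotp (g w') psi != 0 ->
    (Y + col_mx (g w') (D w') <= Y + g w')%MS.
  move=> Nw' Vw' gw'; apply: rank_full_sub.
    by rewrite addsmx_sub addsmxSl (submx_trans (gT w') (addsmxSr _ _)).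
  have := rank_addrow_gt (submx_refl (g w')) (notinY _ gw').
  have := H w' Nw' Vw'; rewrite leq_min => /andP[_].
  by clear; lia.
pose Y1 := (Y + g w1)%MS.
have [rY1|rY1] := ltnP (\rank Y1) m; last first.
  have := H w1 (interior_subset Nw1) Vw1; rewrite ltnNge => /negP; apply.
  apply: leq_trans (geq_minl _ _) (leq_trans rY1 _); apply: mxrankS.
  by rewrite addsmx_sub addsmxSl (submx_trans (gT w1) (addsmxSr _ _)).
have [phi phi0 phiY1] := annihilator rY1.
move/negP: phi0; apply; apply/eqP; apply: sg => w3 Vw3.
have phiY := orth_sub (addsmxSl Y (g w1)) phiY1.
have phig := orth_dotp phiY1 (addsmxSr Y (g w1)).
apply: (uc_line oV cV (@lhol_hol R n m V g phi hol_g) Vw1 Vw3).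
have psic : (fun w => dotp (g w) psi) @ w1 --> dotp (g w1) psi.
  exact: (hol_at_cont (hg w1 Vw1)).
have O : nbhs w1 [set w' | (N° `&` V) w' /\ dotp (g w') psi != 0].
  apply: filterI; last exact: (psic _ (nbhs_neq0 gw1)).
  by apply: filterI; apply: open_nbhs_nbhs; split => //; exact: open_interior.
pose v := w3 - w1.
apply: (@ratio_const R (fun s => dotp (g (w1 + s *: v)) phi) (fun s => dotp (g (w1 + s *: v)) psi)
  (fun s => dotp (v *m D (w1 + s *: v)) phi) (fun s => dotp (v *m D (w1 + s *: v)) psi)); last first.
  by rewrite scale0r addr0 dotpC.
apply: filterS (near_line0 v O) => s [[Ns Vs] gs].
have der chi : is_derive (s : C) (1 : C) (fun s => dotp (g (w1 + s *: v)) chi) (dotp (v *m D (w1 + s *: v)) chi).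
  have [_ /(_ v chi) h1] := hg _ Vs.
  exact: (@is_derive_line n (fun w => dotp (g w) chi) w1 v s _ h1).
split => //.
have vD : (v *m D (w1 + s *: v)%R <= Y + g (w1 + s *: v)%R)%MS.
  apply: submx_trans (subT _ (interior_subset Ns) Vs gs).
  apply: submx_trans (addsmxSr _ _); apply: submx_trans (DT _); exact: submxMl.
have [[a b] /= ab] := sub_addsmxP vD.
have [l bl] : exists l, b *m g (w1 + s *: v) = l *: g (w1 + s *: v).
  by exists (b 0 0); rewrite [b]mx11_scalar mul_scalar_mx mxE eqxx.
have ya chi : chi *m Y^T = 0 -> dotp (a *m Y) chi = 0.
  by move=> cY; rewrite dotpC; apply: orth_dotp cY (submxMl _ _).
rewrite ab !dotpDl !ya// bl !dotpZl; ring.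
Qed.

(** A fixed partner [w] of [z] is corrected along [e] into a partner of [z']; the correction tends
    to 0 as [z'] tends to [z]. *)
Lemma near_perp n (z w e : 'rV[C]_n) (N : set 'rV[C]_n) :
  dotp z w = 0 -> dotp z e != 0 -> nbhs w N ->
  \forall z' \near z, [/\ dotp z' e != 0, N (w - (dotp z' w / dotp z' e) *: e) &
     dotp z' (w - (dotp z' w / dotp z' e) *: e) = 0].
Proof.
move=> zw ze Nw.
have c1 : (fun z' : 'rV[C]_n => w - (dotp z' w / dotp z' e) *: e) @ z --> w.
  rewrite -[X in _ --> X]subr0 -(scale0r e) -(mul0r (dotp z e)^-1) -zw.
  apply: cvgB; first exact: cvg_cst.
  apply: cvgZr_tmp; apply: cvgM; first exact: dotp_continuousl.
  by apply: cvgV => //; exact: dotp_continuousl.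
have c2 := @dotp_continuousl R n e z _ (nbhs_neq0 ze).
near=> z'.
have ze' : dotp z' e != 0 by near: z'; exact: c2.
split => //; first by near: z'; exact: (c1 _ Nw).
by rewrite dotpBr dotpZr divfK// subrr.
Unshelve. all: by end_near. Qed.

(** Otherwise f z is orthogonal to the whole first jet of [g] at every partner of z. By [jet_growth]
    each hyperplane then gains rank 2, and n - 1 of them reach C^m, so [f] vanishes at every point
    that has a partner. By [near_perp] these points fill a neighbourhood of [z0], hence [f] is zero,
    against [spanning] and 0 < m. *)
Lemma exists_transversal n m (V V' : set 'rV[C]_n) (f g : 'rV[C]_n -> 'rV[C]_m)
    (z0 w0 : 'rV[C]_n) :
  open V -> convexC V -> open V' -> convexC V' -> ~ V 0 ->
  hol V f -> hol V' g -> null_orth V V' f g -> spanning V f -> spanning V' g ->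
  V z0 -> V' w0 -> dotp z0 w0 = 0 -> (0 < m)%N -> (m + 2 <= 2 * n)%N ->
  exists z w Dg v, [/\ V z, V' w, dotp z w = 0, hol_at g w Dg & dotp (f z) (v *m Dg) != 0].
Proof.
move=> oV cV oV' cV' V0 hf hg h sf sg Vz0 V'w0 z0w0 m0 mn.
apply: contrapT => noex.
have H z w Dg v : V z -> V' w -> dotp z w = 0 -> hol_at g w Dg -> dotp (f z) (v *m Dg) = 0.
  move=> Vz V'w zw hgw; apply/eqP/negPn/negP => nz; apply: noex.
  by exists z, w, Dg, v.
have ex (w : 'rV[C]_n) : exists D : 'M[C]_(n, m), V' w -> hol_at g w D.
  have [/hg [D hD]|nV] := pselect (V' w); first by exists D.
  by exists 0.
have [D hD] := choice ex.
have f0 zs ws : V zs -> V' ws -> dotp zs ws = 0 -> f zs = 0.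
  move=> Vzs V'ws zsws; have [Df hDf] := hf _ Vzs.
  suff : f zs *m (1%:M : 'M[C]_m)^T = 0 by rewrite trmx1 mulmx1.
  apply: (@dense_orthogonality R n m (1 + n) 1 1 f (fun w => col_mx (g w) (D w)) V V'
    (0 : 'M[C]_(1, n)) (0 : 'M[C]_(1, n)) 0 1%:M 2 n.-1 zs ws) => //.
  - by move=> a; exact: (hol_at_cont hDf).
  - by move=> z _ _; rewrite trmx0 mulmx0.
  - move=> z w Vz V'w _ _ zw; rewrite tr_col_mx mul_mx_row.
    apply/eqP; rewrite row_mx_eq0; apply/andP; split; apply/eqP.
      by apply/dotp_mx0; exact: h.
    apply: orth_mx0 => a /submxP [v ->]; exact: (H z w (D w) v Vz V'w zw (hD w V'w)).
  - exact: sub0mx.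
  - move=> Y _ _ rY w V'w _ N Nw; rewrite mxrank1 in rY *.
    have [w' [Nw' V'w' rw']] := jet_growth oV' cV' hD sg rY V'w Nw.
    by exists w'; split; rewrite ?trmx0 ?mulmx0 ?submx1.
  - by rewrite trmx0 mulmx0.
  - by rewrite trmx0 mulmx0.
  - by rewrite mxrank1 mxrank0; move: mn m0; clear; lia.
  - by rewrite !mxrank0; move: mn m0; clear; lia.
have z0n : z0 != 0 by apply: contraPneq V0 => <-.
have [e z0e] := dotp_neq0 z0n.
suff : (const_mx 1 : 'rV[C]_m) = 0.
  by move=> /rowP /(_ (Ordinal m0)); rewrite !mxE => /eqP; rewrite oner_eq0.
apply: sf => z Vz; apply: (uc_nbhs oV cV (@lhol_hol R n m V f _ hf) Vz0 Vz).
have nV := open_nbhs_nbhs (conj oV Vz0).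
have np := near_perp z0w0 z0e (open_nbhs_nbhs (conj oV' V'w0)).
near=> z'.
have [_ V'w zw] : [/\ dotp z' e != 0, V' (w0 - (dotp z' w0 / dotp z' e) *: e) &
     dotp z' (w0 - (dotp z' w0 / dotp z' e) *: e) = 0] by near: z'; exact: np.
by rewrite (f0 z' _ _ V'w zw) ?dotp0l//; near: z'; exact: nV.
Unshelve. all: by end_near. Qed.

End Transversality.

(** * From first-order identities at one pair to an identity on two hyperplanes *)

Section TransversalIdentity.
Variable R : realType.
Local Notation C := (Cplx R).

Lemma perp_perp n (x w : 'rV[C]_n) :
  (forall u, dotp u w = 0 -> dotp u x = 0) -> (x <= w)%MS.
Proof.
move=> h; apply/negPn/negP => /notin_sub [u uw ux].
by move: ux; rewrite h ?eqxx//; exact/dotp_mx0.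
Qed.

(** Only the pair (z1, w1) is known to be transversal; [z] and [w] are arbitrary on the hyperplanes
    orthogonal to [w1] and [z1]. The identity amounts to the orthogonality of [alpha z] and
    [beta w], which is obtained by making [alpha z] orthogonal to all [beta w'] at once. *)
Lemma transversal_identity n m (V V' : set 'rV[C]_n) (f g : 'rV[C]_n -> 'rV[C]_m)
    (z1 w1 : 'rV[C]_n) (Df Dg : 'M[C]_(n, m)) (c : C) :
  open V -> open V' -> convexC V' -> ~ V 0 -> ~ V' 0 ->
  hol V f -> hol V' g -> null_orth V V' f g -> (m + 3 <= 2 * n)%N ->
  V z1 -> V' w1 -> dotp z1 w1 = 0 -> hol_at f z1 Df -> hol_at g w1 Dg -> c != 0 ->
  (forall v, dotp (f z1) (v *m Dg) = dotp z1 v * c) ->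
  forall z w kap lam, V z -> V' w -> dotp z w1 = 0 -> dotp z1 w = 0 ->
  (forall v, dotp (f z) (v *m Dg) = dotp z v * kap) ->
  (forall u, dotp (u *m Df) (g w) = dotp u w * lam) ->
  c * dotp (f z) (g w) = kap * lam * dotp z w.
Proof.
move=> oV oV' cV' V0 V'0 hf hg h mn Vz1 V'w1 zw1 hDf hDg c0 hc z w kap lam Vz V'w zw zw' hk hl.
have nz z' : V z' -> z' != 0 by apply: contraPneq => ->.
have nz' w' : V' w' -> w' != 0 by apply: contraPneq => ->.
have hc' u : dotp (u *m Df) (g w1) = dotp u w1 * c.
  have wz1 : dotp w1 z1 = 0 by rewrite dotpC.
  have [lam1 hl1] := null_deriv oV (null_orthC h) V'w1 Vz1 (nz' _ V'w1) wz1 hDf.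
  have hl1' u' : dotp (u' *m Df) (g w1) = dotp u' w1 * lam1 by rewrite dotpC hl1 dotpC.
  by rewrite hl1' (null_deriv_eq oV oV' h Vz1 V'w1 (nz _ Vz1) (nz' _ V'w1) zw1 hDf hDg hc hl1').
have h2 u v : dotp u w1 = 0 -> dotp z1 v = 0 -> dotp (u *m Df) (v *m Dg) = c * dotp u v.
  exact: (null_deriv2 oV oV' V0 h Vz1 V'w1 zw1 hDf hDg hc).
have [v zv] := dotp_neq0 (nz _ Vz).
have [u] := dotp_neq0 (nz' _ V'w); rewrite dotpC => uw.
(* Both vectors are normalized so that [dotp (alpha z') (beta w')] is a multiple
   of the difference of the two sides of the claim, and vanishes when
   [dotp z' w' = 0]. *)
pose alpha z' := (dotp z' v * c) *: f z' - dotp (f z') (v *m Dg) *: (z' *m Df).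
pose beta w' := (dotp u w' * c) *: g w' - dotp (u *m Df) (g w') *: (w' *m Dg).
pose K1 := kermx z1^T.
have K1P k : (k <= K1)%MS -> dotp z1 k = 0.
  by move=> /sub_kermxP kz; rewrite dotpC; exact/dotp_mx0.
have K1M (a : 'rV[C]_m) : (a <= K1 *m Dg)%MS -> exists2 k, dotp z1 k = 0 & a = k *m Dg.
  move=> /submxP [d ->]; exists (d *m K1); last by rewrite mulmxA.
  by apply: K1P; exact: submxMl.
(* On the orthogonal of [w1] every [alpha z'] is orthogonal to [Y0] by the relations at (z1, w1)
   alone; this is the head start of the rank count. *)
pose Y0 := (g w1 + K1 *m Dg)%MS.
have [S' [hS' minS']] := family_span (fun b => exists w', [/\ V' w', dotp z1 w' = 0 & b = beta w']).
pose S := (Y0 + S')%MS.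
have betaS w' : V' w' -> dotp z1 w' = 0 -> (beta w' <= S)%MS.
  by move=> V'w' zw''; apply: submx_trans (addsmxSr _ _); apply: hS'; exists w'.
have rK1 : \rank K1 = n.-1.
  by rewrite mxrank_ker mxrank_tr rank_rV nz// subn1.
(* [Df^T] sends [g w1] to [c *: w1] and, by [h2], sends [k *m Dg] to [c *: k] modulo [w1] when [k]
   is orthogonal to [z1]. The image of [Y0] therefore contains the orthogonal of [z1]. *)
have rY0 : (n.-1 <= \rank Y0)%N.
  rewrite -rK1; apply: leq_trans (mxrankM_maxl Y0 Df^T); apply: mxrankS.
  have w1Y : (w1 <= Y0 *m Df^T)%MS.
    have -> : w1 = c^-1 *: (g w1 *m Df^T).
      apply/rowP => i; rewrite mxE; apply: (mulfI c0); rewrite mulVKf//.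
      rewrite -!dotp_delta -dotpZl; have := hc' (delta_mx 0 i).
      by rewrite dotpC dotp_trmx => ->; rewrite dotpZl mulrC [dotp w1 _]dotpC.
    by apply: scalemx_sub; apply: submxMr; exact: addsmxSl.
  apply/row_subP => i; set k := row i K1.
  have zk : dotp z1 k = 0 by apply: K1P; exact: row_sub.
  have kY : (k *m Dg *m Df^T <= Y0 *m Df^T)%MS.
    apply: submxMr; apply: submx_trans (addsmxSr _ _); apply: submxMr; exact: row_sub.
  have -> : k = c^-1 *: (k *m Dg *m Df^T) - c^-1 *: (k *m Dg *m Df^T - c *: k).
    by rewrite scalerBr opprB addrC subrK scalerK.
  apply: addmx_sub; first exact: scalemx_sub.
  rewrite eqmx_opp; apply: scalemx_sub; apply: submx_trans w1Y.
  apply: perp_perp => u' u'w; rewrite dotpBr dotpZr -(h2 u' k)//.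
  by rewrite [dotp (u' *m Df) _]dotpC dotp_trmx [dotp u' _]dotpC subrr.
(* All of [S] is orthogonal to the nonzero vector [f z1], which saves one dimension of C^m. *)
have fz1S : f z1 *m S^T = 0.
  apply: orth_adds; first apply: orth_adds.
  - by apply/dotp_mx0; exact: h.
  - by apply: orth_mx0 => a /K1M [k zk ->]; rewrite hc zk mul0r.
  apply: (@orth_sub _ _ _ _ _ (kermx (f z1)^T)); last first.
    by apply: trmx_inj; rewrite trmx_mul trmxK mulmx_ker trmx0.
  apply: minS' => _ [w' [V'w' zw'' ->]]; apply/sub_kermxP/dotp_mx0.
  rewrite dotpC /beta dotpBr !dotpZr hc zw'' (h z1 w')// !mul0r !mulr0 ?subrr//.
have fz1 : f z1 != 0.
  have [v1 zv1] := dotp_neq1 (nz _ Vz1); apply: contra_neq c0 => fz1.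
  by have := hc v1; rewrite fz1 dotp0l zv1 mul1r.
have rS : (\rank S + 1 <= m)%N.
  have : (S <= kermx (f z1)^T)%MS.
    by apply/sub_kermxP; apply: trmx_inj; rewrite trmx_mul trmxK fz1S trmx0.
  move=> /mxrankS; rewrite mxrank_ker mxrank_tr rank_rV fz1.
  move=> hr; have := rank_leq_col (f z1); rewrite rank_rV fz1; move: hr; clear; lia.
have Y0S : (Y0 <= S)%MS by exact: addsmxSl.
have n3 : (3 <= n)%N.
  by have := mxrankS Y0S; move: rY0 rS mn; clear; lia.
have kapP z' : V z' -> dotp z' w1 = 0 -> exists kap', forall v', dotp (f z') (v' *m Dg) = dotp z' v' * kap'.
  by move=> Vz' z'w; exact: null_deriv oV' h Vz' V'w1 (nz _ Vz') z'w hDg.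
have lamP w' : V' w' -> dotp z1 w' = 0 -> exists lam', forall u', dotp (u' *m Df) (g w') = dotp u' w' * lam'.
  move=> V'w' z'w; have wz : dotp w' z1 = 0 by rewrite dotpC.
  have [lam1 hl1] := null_deriv oV (null_orthC h) V'w' Vz1 (nz' _ V'w') wz hDf.
  by exists lam1 => u'; rewrite dotpC hl1 dotpC.
have expand z' w' kap' lam' : dotp z' w1 = 0 -> dotp z1 w' = 0 ->
    (forall v', dotp (f z') (v' *m Dg) = dotp z' v' * kap') ->
    (forall u', dotp (u' *m Df) (g w') = dotp u' w' * lam') ->
    dotp (alpha z') (beta w') = dotp z' v * dotp u w' * c *
      (c * dotp (f z') (g w') - kap' * lam' * dotp z' w').
  move=> z'w z1w hk' hl'; rewrite /alpha /beta !(dotpBl, dotpBr, dotpZl, dotpZr).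
  by rewrite !hk' !hl' h2//; ring.
have main : alpha z *m S^T = 0.
  (* Budget: [W0] and [Z0] are the lines of [w1] and [z1], so 1 + (n - 3) + 1 + 1 = n allows n - 3
     steps, and rank S <= m - 1 <= (n - 1) + (n - 3) uses m <= 2n - 3 in full. *)
  apply: (@dense_orthogonality R n m 1 1 1 alpha beta V V' w1 z1 Y0 S 1 (n - 3) z w1) => //.
  - have [D hD] := hf z Vz; have fc := hol_at_cont hD => a.
    have -> : (fun z' => dotp (alpha z') a) = fun z' => dotp z' v * c * dotp (f z') a -
        dotp (f z') (v *m Dg) * dotp z' (a *m Df^T).
      apply/funext => z'; rewrite /alpha dotpBl !dotpZl.
      by rewrite [dotp (z' *m Df) a]dotpC [dotp a (z' *m Df)]dotp_trmx [dotp (a *m _) z']dotpC.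
    rewrite /alpha dotpBl !dotpZl [dotp (z *m Df) a]dotpC [dotp a (z *m Df)]dotp_trmx [dotp (a *m _) z]dotpC.
    have c1 : (fun z' : 'rV[C]_n => dotp z' v * c * dotp (f z') a) @ z --> dotp z v * c * dotp (f z) a.
      apply: cvgM; last exact: fc.
      by apply: cvgM; [exact: dotp_continuousl|exact: cvg_cst].
    have c2 : (fun z' : 'rV[C]_n => dotp (f z') (v *m Dg) * dotp z' (a *m Df^T)) @ z --> dotp (f z) (v *m Dg) * dotp z (a *m Df^T).
      by apply: cvgM; [exact: fc|exact: dotp_continuousl].
    exact: (cvgB c1 c2).
  - move=> z' Vz' /dotp_mx0 z'w; have [kap' hk'] := kapP z' Vz' z'w.
    apply: orth_adds.
      apply/dotp_mx0; rewrite /alpha dotpBl !dotpZl (h z' w1)// hc' z'w.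
      by rewrite mul0r !mulr0 subrr.
    apply: orth_mx0 => _ /K1M [k zk ->].
    by rewrite /alpha dotpBl !dotpZl !hk' h2//; ring.
  - move=> z' w' Vz' V'w' /dotp_mx0 z'w /dotp_mx0; rewrite dotpC => z1w z'w'.
    have [kap' hk'] := kapP z' Vz' z'w; have [lam' hl'] := lamP w' V'w' z1w.
    apply/dotp_mx0; rewrite (expand z' w' kap' lam')// (h z' w')// z'w'.
    by rewrite !mulr0 subrr mulr0.
  - move=> Y Y0Y YS rY w' V'w' /dotp_mx0; rewrite dotpC => zw'' N Nw'.
    (* [S] is generated by [Y0] and the vectors [beta w'], so one of them escapes [Y]. Unique
       continuation along the line from [w'] to [w2], which stays orthogonal to [z1], finds such a
       point close to [w']. *)
    have [w2 [V'w2 zw2 bw2]] : exists w2, [/\ V' w2, dotp z1 w2 = 0 & ~~ (beta w2 <= Y)%MS].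
      apply: contrapT => noex; move: rY; rewrite ltnNge => /negP; apply.
      apply: mxrankS; rewrite addsmx_sub Y0Y; apply: minS' => _ [w2 [V'w2 zw2 ->]].
      by apply/negPn/negP => bw2; apply: noex; exists w2.
    have [phi phiY phib] := notin_sub bw2.
    have lb : lhol V' (fun w => dotp phi (beta w)).
      have -> : (fun w => dotp phi (beta w)) = fun w => dotp w u * c * dotp (g w) phi -
          dotp (g w) (u *m Df) * dotp w (phi *m Dg^T).
        apply/funext => w3; rewrite /beta dotpBr !dotpZr.
        by rewrite [dotp u w3]dotpC [dotp phi (g w3)]dotpC [dotp (u *m Df) (g w3)]dotpC [dotp phi (w3 *m Dg)]dotp_trmx [dotp (phi *m Dg^T) w3]dotpC.
      apply: (lholB (lholM (lholM (@lhol_dotp R n V' u) (@lhol_cst R n V' c)) (@lhol_hol R n m V' g phi hg))).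
      exact: (lholM (@lhol_hol R n m V' g (u *m Df) hg) (@lhol_dotp R n V' (phi *m Dg^T))).
    have [s [Ns V's bs]] := uc_dense_line oV' cV' lb V'w' V'w2 phib Nw'.
    have zs : dotp z1 (w' + s *: (w2 - w')) = 0.
      by rewrite dotpDr dotpZr dotpBr zw'' zw2 subrr mulr0 addr0.
    exists (w' + s *: (w2 - w')); split => //.
    + by apply/dotp_mx0; rewrite dotpC.
    + exact: betaS.
    apply: leq_trans (geq_minr _ _) _; apply: rank_addrow_gt (submx_refl _) _.
    by apply: contra bs => bY; apply/eqP; exact: orth_dotp phiY bY.
  - exact/dotp_mx0.
  - by apply/dotp_mx0; rewrite dotpC.
  - by move: rS rY0 mn; clear; lia.
  - by rewrite !rank_rV (nz _ Vz1) (nz' _ V'w1); move: n3; clear; lia.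
have := orth_dotp main (betaS w V'w zw').
rewrite (expand z w kap lam)// => /eqP; rewrite !mulf_eq0 (negbTE zv) (negbTE uw) (negbTE c0) /=.
by rewrite subr_eq0 => /eqP.
Qed.

End TransversalIdentity.

(** * Projective linearity near a point *)

Section LocalLinearity.
Variable R : realType.
Local Notation C := (Cplx R).

Lemma hol_near_neq0 n m (f : 'rV[C]_n -> 'rV[C]_m) (z : 'rV[C]_n) D phi :
  hol_at f z D -> dotp (f z) phi != 0 -> \forall z' \near z, dotp (f z') phi != 0.
Proof.
move=> hD fz.
have fc : (fun z' => dotp (f z') phi) @ z --> dotp (f z) phi.
  exact: (hol_at_cont hD).
exact: (fc _ (nbhs_neq0 fz)).
Qed.

Lemma dotp_near_neq0 n (x w : 'rV[C]_n) :
  dotp x w != 0 -> \forall w' \near w, dotp x w' != 0.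
Proof. by move=> xw; exact: (@dotp_continuous R n x w _ (nbhs_neq0 xw)). Qed.

(** For w near a point [ws] orthogonal to [z0] but not to [z], the line through [z0] and [z] meets
    the orthogonal of w at a point [z1] close to [z0], so that (z1, w0) is still transversal.
    [transversal_identity] at that pair expresses f z . g w and f z0 . g w with the same [lam],
    which depends on [z1] and w only. Eliminating it leaves the factor kap / kap0, independent of w,
    and unique continuation in w reaches all of [V']. *)
Lemma two_point n m (V V' : set 'rV[C]_n) (f g : 'rV[C]_n -> 'rV[C]_m)
    (z0 w0 z : 'rV[C]_n) (Dg : 'M[C]_(n, m)) (kap0 : C) :
  open V -> open V' -> convexC V' -> ~ V 0 -> ~ V' 0 ->
  hol V f -> hol V' g -> null_orth V V' f g -> (m + 3 <= 2 * n)%N ->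
  V z0 -> V' w0 -> dotp z0 w0 = 0 -> hol_at g w0 Dg -> kap0 != 0 ->
  (forall v, dotp (f z0) (v *m Dg) = dotp z0 v * kap0) ->
  V z -> dotp z w0 = 0 -> ~~ (z <= z0)%MS ->
  exists rho : C, forall w, V' w ->
    dotp z0 w * dotp (f z) (g w) = rho * (dotp z w * dotp (f z0) (g w)).
Proof.
move=> oV oV' cV' V0 V'0 hf hg h mn Vz0 V'w0 z0w0 hDg kap00 hk0 Vz zw0 zz0.
have nz z' : V z' -> z' != 0 by apply: contraPneq => ->.
have nz' w' : V' w' -> w' != 0 by apply: contraPneq => ->.
have [kap hk] := null_deriv oV' h Vz V'w0 (nz _ Vz) zw0 hDg.
exists (kap / kap0) => w3 V'w3.
apply: (mulfI kap00); apply/eqP; rewrite -subr_eq0; apply/eqP.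
have -> : kap0 * (kap / kap0 * (dotp z w3 * dotp (f z0) (g w3))) =
  kap * (dotp z w3 * dotp (f z0) (g w3)) by field.
have [e /dotp_mx0] := notin_sub zz0; rewrite dotpC => z0e; rewrite dotpC => ze.
have [s s0 V's] := near_scale_exists e (open_nbhs_nbhs (conj oV' V'w0)).
pose psi w := kap0 * (dotp z0 w * dotp (f z) (g w)) - kap * (dotp z w * dotp (f z0) (g w)).
have lpsi : lhol V' psi.
  have -> : psi = fun w => kap0 * (dotp w z0 * dotp (g w) (f z)) - kap * (dotp w z * dotp (g w) (f z0)).
    by apply/funext => w; rewrite /psi ![dotp _ w]dotpC ![dotp _ (g w)]dotpC.
  have lg := fun phi => @lhol_hol R n m V' g phi hg.
  have ld := @lhol_dotp R n V'; have lc := @lhol_cst R n V'.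
  exact: (lholB (lholM (lc kap0) (lholM (ld z0) (lg (f z)))) (lholM (lc kap) (lholM (ld z) (lg (f z0))))).
apply: (uc_nbhs oV' cV' lpsi V's V'w3).
set ws := w0 + s *: e.
have [v0 z0v0] := dotp_neq1 (nz _ Vz0).
have c0 : dotp (z - z0) ws != 0.
  by rewrite /ws dotpDr dotpZr !dotpBl zw0 z0w0 z0e !subr0 add0r mulf_neq0.
have z0ws : dotp z0 ws = 0 by rewrite /ws dotpDr dotpZr z0w0 z0e mulr0 addr0.
(* the point [z0 + tau w *: (z - z0)] of the line [z0 z] is orthogonal to [w] *)
pose tau w := - (dotp z0 w / dotp (z - z0) w).
have ctau : tau @ ws --> (0 : C).
  rewrite -[X in _ --> X]oppr0 -(mul0r (dotp (z - z0) ws)^-1) -z0ws.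
  apply: cvgN; apply: cvgM; first exact: dotp_continuous.
  by apply: cvgV => //; exact: dotp_continuous.
have nV : \forall t \near (0 : C), V (z0 + t *: (z - z0)).
  exact: near_line0 (open_nbhs_nbhs (conj oV Vz0)).
have nK : \forall t \near (0 : C), dotp (f (z0 + t *: (z - z0))) (v0 *m Dg) != 0.
  have [D hD] := hf z0 Vz0.
  have fz0 : dotp (f z0) (v0 *m Dg) != 0 by rewrite hk0 z0v0 mul1r.
  exact: (near_line0 (z - z0) (hol_near_neq0 hD fz0)).
have nV' : \forall w \near ws, V' w by exact: open_nbhs_nbhs (conj oV' V's).
have nc : \forall w \near ws, dotp (z - z0) w != 0 by exact: dotp_near_neq0.
near=> w.
have V'w : V' w by near: w; exact: nV'.
have cw : dotp (z - z0) w != 0 by near: w; exact: nc.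
have Vz1 : V (z0 + tau w *: (z - z0)) by near: w; exact: (ctau _ nV).
have K1 : dotp (f (z0 + tau w *: (z - z0))) (v0 *m Dg) != 0 by near: w; exact: (ctau _ nK).
have z1w : dotp (z0 + tau w *: (z - z0)) w = 0.
  by rewrite dotpDl dotpZl /tau mulNr divfK// subrr.
have z1w0 : dotp (z0 + tau w *: (z - z0)) w0 = 0.
  by rewrite dotpDl dotpZl dotpBl zw0 z0w0 subrr mulr0 addr0.
set z1 := z0 + tau w *: (z - z0) in Vz1 K1 z1w z1w0.
have [D1 hD1] := hf z1 Vz1.
have [c1 hc1] := null_deriv oV' h Vz1 V'w0 (nz _ Vz1) z1w0 hDg.
have c10 : c1 != 0 by move: K1; rewrite hc1 mulf_eq0 negb_or => /andP[].
have wz1 : dotp w z1 = 0 by rewrite dotpC.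
have [lam hl] := null_deriv oV (null_orthC h) V'w Vz1 (nz' _ V'w) wz1 hD1.
have hl' u : dotp (u *m D1) (g w) = dotp u w * lam by rewrite dotpC hl dotpC.
have TI := transversal_identity oV oV' cV' V0 V'0 hf hg h mn Vz1 V'w0 z1w0 hD1 hDg c10 hc1.
have e1 := TI z w kap lam Vz V'w zw0 z1w hk hl'.
have e2 := TI z0 w kap0 lam Vz0 V'w z0w0 z1w hk0 hl'.
apply: (mulfI c10); rewrite mulr0 /psi mulrBr.
have -> : c1 * (kap0 * (dotp z0 w * dotp (f z) (g w))) = kap0 * dotp z0 w * (c1 * dotp (f z) (g w)) by ring.
have -> : c1 * (kap * (dotp z w * dotp (f z0) (g w))) = kap * dotp z w * (c1 * dotp (f z0) (g w)) by ring.
by rewrite e1 e2; ring.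
Unshelve. all: by end_near. Qed.

Lemma local_pencil n m (V V' : set 'rV[C]_n) (f g : 'rV[C]_n -> 'rV[C]_m)
    (za wa : 'rV[C]_n) :
  open V -> convexC V -> open V' -> convexC V' -> ~ V 0 -> ~ V' 0 ->
  hol V f -> hol V' g -> null_orth V V' f g -> spanning V f -> spanning V' g ->
  V za -> V' wa -> dotp za wa = 0 -> (0 < m)%N -> (m + 3 <= 2 * n)%N ->
  exists z0 zs : 'rV[C]_n, [/\ V z0, f z0 != 0, V zs &
    \forall z \near zs, exists rho : C, forall w, V' w ->
    dotp z0 w * dotp (f z) (g w) = rho * (dotp z w * dotp (f z0) (g w))].
Proof.
move=> oV cV oV' cV' V0 V'0 hf hg h sf sg Vza V'wa zawa m0 mn.
have nz z' : V z' -> z' != 0 by apply: contraPneq => ->.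
have nz' w' : V' w' -> w' != 0 by apply: contraPneq => ->.
have mn2 : (m + 2 <= 2 * n)%N by move: mn; clear; lia.
have [z0 [w0 [Dg [v [Vz0 V'w0 zw0 hDg fv]]]]] :=
  exists_transversal oV cV oV' cV' V0 hf hg h sf sg Vza V'wa zawa m0 mn2.
have [Df hDf] := hf z0 Vz0.
have [kap0 hk0] := null_deriv oV' h Vz0 V'w0 (nz _ Vz0) zw0 hDg.
have kap00 : kap0 != 0 by move: fv; rewrite hk0 mulf_eq0 negb_or => /andP[].
have fz0 : f z0 != 0 by apply: contra fv => /eqP ->; rewrite dotp0l.
have wz0 : dotp w0 z0 = 0 by rewrite dotpC.
have [lam0 hl0] := null_deriv oV (null_orthC h) V'w0 Vz0 (nz' _ V'w0) wz0 hDf.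
have hl0' u : dotp (u *m Df) (g w0) = dotp u w0 * lam0 by rewrite dotpC hl0 dotpC.
have kl := null_deriv_eq oV oV' h Vz0 V'w0 (nz _ Vz0) (nz' _ V'w0) zw0 hDf hDg hk0 hl0'.
have [u0 wu0] := dotp_neq1 (nz' _ V'w0).
have gu0 : dotp (u0 *m Df) (g w0) != 0 by rewrite hl0' dotpC wu0 mul1r -kl.
have gw0 : g w0 != 0 by apply: contra gu0 => /eqP ->; rewrite dotp0r.
(* For m = 1 the nonzero scalars [f z0] and [g w0] would have product zero. Hence m >= 2 and n >= 3,
   which leaves room for a direction [d] orthogonal to [w0] and independent of [z0]. *)
have n3 : (3 <= n)%N.
  suff : (1 < m)%N by move: mn; clear; lia.
  rewrite ltn_neqAle m0 andbT; apply/negP => /eqP m1.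
  have [i fi] := rV0Pn _ fz0; have [j gj] := rV0Pn _ gw0.
  have hi k : k = i by apply: val_inj; case: (k) (i) => a ha [b hb] /=; move: ha hb; rewrite -m1 !ltnS !leqn0 => /eqP -> /eqP ->.
  have /eqP := h z0 w0 Vz0 V'w0 zw0.
  rewrite dotpE (bigD1 i)//= big1; last by move=> k; rewrite (hi k) eqxx.
  by rewrite addr0 mulf_eq0 (negbTE fi) -(hi j) (negbTE gj).
have [d w0d dz0] : exists2 d : 'rV[C]_n, dotp d w0 = 0 & ~~ (d <= z0)%MS.
  have : ~~ (kermx w0^T <= z0)%MS.
    apply/negP => /mxrankS; rewrite mxrank_ker mxrank_tr !rank_rV (nz _ Vz0) (nz' _ V'w0).
    by move: n3; clear; lia.
  move=> /row_subPn [i di]; exists (row i (kermx w0^T)) => //.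
  by apply/dotp_mx0; rewrite -row_mul mulmx_ker row0.
have [e /dotp_mx0] := notin_sub dz0; rewrite dotpC => z0e; rewrite dotpC => de.
have [s s0 Vs] := near_scale_exists d (open_nbhs_nbhs (conj oV Vz0)).
exists z0, (z0 + s *: d); split => //.
set zs := z0 + s *: d in Vs *.
have zsw0 : dotp zs w0 = 0 by rewrite /zs dotpDl dotpZl zw0 w0d mulr0 addr0.
have zse : dotp zs e != 0 by rewrite /zs dotpDl dotpZl z0e add0r mulf_neq0.
have [Dg0 hDg0] := hg w0 V'w0.
(* The factor [kap'] at a nearby point involves the Jacobian of [g] there, whose continuity is not
   known. By [null_deriv_eq] it equals [lam'], which is read off from [g] itself with [Df] fixed, so
   its nonvanishing is an open condition. *)
have nN : nbhs w0 [set w | V' w /\ dotp (u0 *m Df) (g w) != 0].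
  rewrite dotpC in gu0.
  apply: filterI; first exact: open_nbhs_nbhs (conj oV' V'w0).
  by apply: filterS (hol_near_neq0 hDg0 gu0) => w; rewrite dotpC.
have np := near_perp zsw0 zse nN.
have nV := open_nbhs_nbhs (conj oV Vs).
near=> z.
have Vz : V z by near: z; exact: nV.
have [ze [V'w uw] zw] : [/\ dotp z e != 0, [set w | V' w /\ dotp (u0 *m Df) (g w) != 0] (w0 - (dotp z w0 / dotp z e) *: e) &
     dotp z (w0 - (dotp z w0 / dotp z e) *: e) = 0] by near: z; exact: np.
have z0w : dotp z0 (w0 - (dotp z w0 / dotp z e) *: e) = 0.
  by rewrite dotpBr dotpZr zw0 z0e mulr0 subrr.
set w' := w0 - _ in V'w uw zw z0w.
have [Dg' hDg'] := hg w' V'w.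
have [kap' hk'] := null_deriv oV' h Vz0 V'w (nz _ Vz0) z0w hDg'.
have w'z0 : dotp w' z0 = 0 by rewrite dotpC.
have [lam' hl] := null_deriv oV (null_orthC h) V'w Vz0 (nz' _ V'w) w'z0 hDf.
have hl' u : dotp (u *m Df) (g w') = dotp u w' * lam' by rewrite dotpC hl dotpC.
have kl' := null_deriv_eq oV oV' h Vz0 V'w (nz _ Vz0) (nz' _ V'w) z0w hDf hDg' hk' hl'.
have kap'0 : kap' != 0 by move: uw; rewrite hl' -kl' mulf_eq0 negb_or => /andP[].
apply: (two_point oV oV' cV' V0 V'0 hf hg h mn Vz0 V'w z0w hDg' kap'0 hk' Vz zw).
apply: contra ze => /sub_rVP [a ->]; by rewrite dotpZl z0e mulr0.
Unshelve. all: by end_near. Qed.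

Lemma basis_of_family n m (P : 'rV[C]_n -> Prop) (g : 'rV[C]_n -> 'rV[C]_m) :
  (forall phi, (forall w, P w -> dotp (g w) phi = 0) -> phi = 0) ->
  forall k, (k <= m)%N -> exists W : 'M[C]_(k, n),
    (forall i, P (row i W)) /\ \rank (\matrix_i g (row i W)) = k.
Proof.
move=> sp; elim=> [_|k IH km].
  by exists 0; split; [case|apply/eqP; rewrite -leqn0 rank_leq_row].
have [W [PW rW]] := IH (ltnW km).
have [phi phi0 phiW] : exists2 phi : 'rV[C]_m, phi != 0 & phi *m (\matrix_i g (row i W))^T = 0.
  by apply: annihilator; rewrite rW.
have [w Pw gw] : exists2 w, P w & dotp (g w) phi != 0.
  apply: contrapT => hno; move/negP: phi0; apply; apply/eqP; apply: sp => w Pw.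
  by apply/eqP/negPn/negP => hw; apply: hno; exists w.
have notin : ~~ (g w <= \matrix_i g (row i W))%MS.
  by apply: contra gw => gw; rewrite dotpC (orth_dotp phiW gw).
suff [h1 h2] : (forall i : 'I_(1 + k), P (row i (col_mx w W))) /\
    \rank (\matrix_(i < 1 + k) g (row i (col_mx w W))) = k.+1 by exists (col_mx w W).
split.
  move=> i; case: (split_ordP i) => j ->; last by rewrite rowKd.
  by rewrite rowKu row_id.
have -> : \matrix_(i < 1 + k) g (row i (col_mx w W)) = col_mx (g w) (\matrix_i g (row i W)).
  apply/row_matrixP => i; rewrite rowK; case: (split_ordP i) => j ->.
    by rewrite !rowKu !row_id.
  by rewrite !rowKd rowK.
apply/eqP; rewrite eqn_leq rank_leq_row /=.
rewrite -addsmxE addsmxC.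
have := rank_addrow_gt (submx_refl (g w)) notin; rewrite rW; clear; lia.
Qed.

(** The second relation is the dual of the linearity of [f]: paired with any z near [zs] it is the
    relation of [local_pencil], and a linear form vanishing on an open set is zero. It later
    determines the Gram matrix of [L]. *)
Theorem local_linear n m (V V' : set 'rV[C]_n) (f g : 'rV[C]_n -> 'rV[C]_m)
    (za wa : 'rV[C]_n) :
  open V -> convexC V -> open V' -> convexC V' -> ~ V 0 -> ~ V' 0 ->
  hol V f -> hol V' g -> null_orth V V' f g -> spanning V f -> spanning V' g ->
  V za -> V' wa -> dotp za wa = 0 -> (0 < m)%N -> (m + 3 <= 2 * n)%N ->
  exists (z0 zs : 'rV[C]_n) (L : 'M[C]_(n, m)), [/\ V z0, f z0 != 0, V zs,
    \forall z \near zs, exists2 rho : C, rho != 0 & f z = rho *: (z *m L) &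
    forall w, V' w -> dotp z0 w *: (g w *m L^T) = dotp (f z0) (g w) *: w].
Proof.
move=> oV cV oV' cV' V0 V'0 hf hg h sf sg Vza V'wa zawa m0 mn.
have [z0 [zt [Vz0 fz0 Vzt nzt]]] := local_pencil oV cV oV' cV' V0 V'0 hf hg h sf sg Vza V'wa zawa m0 mn.
have [phi fphi] := dotp_neq0 fz0.
have [zs [nzs Vzs fzs]] := uc_dense oV cV (@lhol_hol R n m V f phi hf) Vzt Vz0 fphi (open_interiorI oV Vzt nzt).
have z0n : z0 != 0 by apply: contraPneq V0 => <-.
have [W [PW rW]] : exists W : 'M[C]_(m, n),
    (forall i, V' (row i W) /\ dotp z0 (row i W) != 0) /\ \rank (\matrix_i g (row i W)) = m.
  apply: (@basis_of_family n m (fun w => V' w /\ dotp z0 w != 0) g) => // chi hchi.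
  have [e z0e] := dotp_neq0 z0n.
  have [wb [V'wb z0wb]] : exists wb, V' wb /\ dotp z0 wb != 0.
    have [s s0 V's] := near_scale_exists e (open_nbhs_nbhs (conj oV' V'wa)).
    have [zw|zw] := eqVneq (dotp z0 wa) 0; last by exists wa.
    by exists (wa + s *: e); split => //; rewrite dotpDr dotpZr zw add0r mulf_neq0.
  apply: sg => w V'w; apply: (uc_nbhs oV' cV' (@lhol_hol R n m V' g chi hg) V'wb V'w).
  have n1 := open_nbhs_nbhs (conj oV' V'wb).
  have n2 := dotp_near_neq0 z0wb.
  near=> w'; apply: hchi; split; first by near: w'; exact: n1.
  by near: w'; exact: n2.
pose M := \matrix_i g (row i W).
have Mu : M \in unitmx by rewrite -row_free_unit /row_free rW.
(* [L] solves the relation of [local_pencil] at m points whose images under [g] form a basis;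
   dividing by z0 . w is allowed because these points avoid the orthogonal of [z0]. *)
pose gam := \row_i (dotp (f z0) (g (row i W)) / dotp z0 (row i W)).
pose L := W^T *m diag_mx gam *m invmx M^T.
have LE z rho : (forall w, V' w -> dotp z0 w * dotp (f z) (g w) = rho * (dotp z w * dotp (f z0) (g w))) ->
    f z = rho *: (z *m L).
  move=> hz; have MT : M^T \in unitmx by rewrite unitmx_tr.
  rewrite /L !mulmxA scalemxAl -[LHS](mulmxK MT); congr (_ *m _).
  apply/rowP => i; have [V'i zi] := PW i.
  rewrite mul_mx_diag !mxE.
  have -> : \sum_j f z 0 j * M^T j i = dotp (f z) (g (row i W)).
    by rewrite dotpE; apply: eq_bigr => j _; rewrite !mxE.
  have -> : \sum_j z 0 j * W^T j i = dotp z (row i W).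
    by rewrite dotpE; apply: eq_bigr => j _; rewrite !mxE.
  apply: (mulfI zi); rewrite hz//.
  by field.
exists z0, zs, L.
have near1 : \forall z \near zs, exists2 rho : C, rho != 0 & (forall w, V' w -> dotp z0 w * dotp (f z) (g w) = rho * (dotp z w * dotp (f z0) (g w))).
  have [D hD] := hf zs Vzs.
  have n1 := hol_near_neq0 hD fzs.
  have n2 : nbhs zs ([set z | exists rho : C, forall w, V' w ->
    dotp z0 w * dotp (f z) (g w) = rho * (dotp z w * dotp (f z0) (g w))]°).
    by apply: open_nbhs_nbhs; split; [exact: open_interior|case: nzs].
  near=> z.
  have fz : dotp (f z) phi != 0 by near: z; exact: n1.
  have : [set z | exists rho : C, forall w, V' w ->
    dotp z0 w * dotp (f z) (g w) = rho * (dotp z w * dotp (f z0) (g w))]° z by near: z; exact: n2.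
  move=> /interior_subset [rho hrho]; exists rho => //.
  by apply: contra fz => /eqP rho0; rewrite (LE z rho hrho) rho0 scale0r dotp0l.
split => //.
  apply: filterS near1 => z [rho rho0 hrho]; exists rho => //; exact: LE.
move=> w V'w; apply/eqP; rewrite -subr_eq0; apply/eqP.
set x := _ - _.
have nx : \forall z \near zs, dotp z x = 0.
  apply: filterS near1 => z [rho rho0 hrho].
  have := hrho w V'w; rewrite {1}(LE z rho hrho) dotpZl mulrCA => /(mulfI rho0) hz.
  rewrite /x dotpBr !dotpZr.
  have -> : dotp z (g w *m L^T) = dotp (z *m L) (g w) by rewrite dotp_trmx trmxK.
  by rewrite hz mulrC subrr.
have x0 y : dotp y x = 0.
  apply: (@uc_nbhs R n setT (fun y => dotp y x) zs y openT) => //.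
  exact: lhol_dotp.
by apply/eqP/negPn/negP => /dotp_neq0 [y]; rewrite dotpC x0 eqxx.
Unshelve. all: by end_near. Qed.

End LocalLinearity.

(** * The Hermitian form *)

Section Polarization.
Variable R : realType.
Local Notation C := (Cplx R).

Definition cj m p (A : 'M[C]_(m, p)) : 'M[C]_(m, p) := map_mx Num.conj A.

Lemma cjK m p (A : 'M[C]_(m, p)) : cj (cj A) = A.
Proof. by apply/matrixP => i j; rewrite !mxE conjCK. Qed.

Lemma cjM m p q (A : 'M[C]_(m, p)) (B : 'M[C]_(p, q)) : cj (A *m B) = cj A *m cj B.
Proof. exact: map_mxM. Qed.

Lemma cjT m p (A : 'M[C]_(m, p)) : cj A^T = (cj A)^T.
Proof. by rewrite /cj map_trmx. Qed.

Lemma cjZ m p (a : C) (A : 'M[C]_(m, p)) : cj (a *: A) = a^* *: cj A.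
Proof. by apply/matrixP => i j; rewrite !mxE rmorphM. Qed.

Lemma cjD m p (A B : 'M[C]_(m, p)) : cj (A + B) = cj A + cj B.
Proof. by apply/matrixP => i j; rewrite !mxE rmorphD. Qed.

Lemma cj0 m p : cj (0 : 'M[C]_(m, p)) = 0.
Proof. by apply/matrixP => i j; rewrite !mxE rmorph0. Qed.

Lemma cj_eq0 m p (A : 'M[C]_(m, p)) : (cj A == 0) = (A == 0).
Proof. by apply/eqP/eqP => [h|->]; [rewrite -[A]cjK h cj0|exact: cj0]. Qed.

Lemma dotp_cj m (a b : 'rV[C]_m) : dotp (cj a) (cj b) = (dotp a b)^*.
Proof. by rewrite /dotp -cjT -cjM mxE. Qed.

Definition gram (r s t : nat) : 'M[C]_(r + s + t) := diag_mx (\row_j hsign R r s j).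

Lemma hsign_conj r s j : (hsign R r s j)^* = hsign R r s j.
Proof. by rewrite /hsign; case: ifP => _; [|case: ifP => _]; rewrite ?rmorphN ?rmorph1 ?rmorph0. Qed.

Lemma cj_gram r s t : cj (gram r s t) = gram r s t.
Proof.
apply/matrixP => i j; rewrite !mxE; case: eqP => _; rewrite ?mulr1n ?mulr0n ?rmorph0//.
exact: hsign_conj.
Qed.

Lemma tr_gram r s t : (gram r s t)^T = gram r s t.
Proof. exact: tr_diag_mx. Qed.

Lemma hformE r s t (u v : 'rV[C]_(r + s + t)) :
  hform R r s t u v = dotp (u *m gram r s t) (cj v).
Proof.
rewrite dotpE; apply: eq_bigr => j _.
by rewrite mul_mx_diag !mxE [u 0 j * _]mulrC.
Qed.

Lemma hform_conj r s t (u v : 'rV[C]_(r + s + t)) :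
  (hform R r s t u v)^* = hform R r s t v u.
Proof.
rewrite !hformE -dotp_cj cjM cj_gram cjK dotpC -[in RHS]dotpC.
by rewrite dotp_trmx tr_gram dotpC.
Qed.

Lemma gram_sqr r s : gram r s 0 *m gram r s 0 = 1%:M.
Proof.
apply/matrixP => i j; rewrite mul_mx_diag !mxE.
case: eqP => [<-|_]; rewrite ?mulr1n ?mulr0n ?mul0r//.
rewrite /hsign; case: ifP => _; rewrite ?mulr1//.
have -> : (i < r + s)%N by rewrite -[X in (_ < X)%N]addn0; exact: ltn_ord.
by rewrite mulrNN mulr1.
Qed.

Lemma rank_gram r s t : (\rank (gram r s t) <= r + s)%N.
Proof.
have -> : gram r s t = pid_mx (r + s) *m gram r s t.
  apply/matrixP => i j; rewrite mul_mx_diag !mxE.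
  case: eqP => [<-|ij].
    rewrite eqxx mulr1n /hsign; case: (ltnP i r) => [ir|ir].
      by rewrite (leq_trans ir (leq_addr _ _)) /= mulr1.
    by case: ltnP => _ /=; rewrite ?mul1r ?mulr0 ?mul0r.
  rewrite mulr0n; case: (_ =P _) => [e|_]; last by rewrite mul0r.
  by case: ij; apply: val_inj.
by apply: leq_trans (mxrankM_maxl _ _) _; rewrite rank_pid_mx// leq_addr.
Qed.

(** The antilinear map that turns the Hermitian form into the bilinear pairing, <z, y> = z . kappa
    y. With t = 0 the Gram matrix is its own inverse and has diagonal entries of modulus 1, so this
    is an involution that preserves balls. *)
Definition kappa r s (w : 'rV[C]_(r + s + 0)) := cj (w *m gram r s 0).

Lemma kappaK r s (w : 'rV[C]_(r + s + 0)) : kappa (kappa w) = w.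
Proof. by rewrite /kappa cjM cjK cj_gram -mulmxA gram_sqr mulmx1. Qed.

Lemma kappaE r s (w : 'rV[C]_(r + s + 0)) : kappa w = cj w *m gram r s 0.
Proof. by rewrite /kappa cjM cj_gram. Qed.

Lemma kappa_line r s (w u : 'rV[C]_(r + s + 0)) (a : C) :
  kappa (w + a *: u) = kappa w + a^* *: kappa u.
Proof. by rewrite /kappa mulmxDl -scalemxAl cjD cjZ. Qed.

Lemma hform_kappa r s (z y : 'rV[C]_(r + s + 0)) : hform R r s 0 z y = dotp z (kappa y).
Proof. by rewrite hformE kappaE dotp_trmx tr_gram. Qed.

Lemma kappa_coord r s (w w' : 'rV[C]_(r + s + 0)) i j :
  `|kappa w i j - kappa w' i j| = `|w i j - w' i j|.
Proof.
have h : `|hsign R r s j| = 1.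
  rewrite /hsign; case: ifP => _; rewrite ?normr1//.
  have -> : (j < r + s)%N by rewrite -[X in (_ < X)%N]addn0; exact: ltn_ord.
  by rewrite normrN normr1.
rewrite /kappa !mul_mx_diag !mxE -rmorphB norm_conjC -mulrBl normrM.
by rewrite h mulr1.
Qed.

Lemma kappa_ball r s (z : 'rV[C]_(r + s + 0)) (e : C) (w : 'rV[C]_(r + s + 0)) :
  ball (kappa z) e w = ball z e (kappa w).
Proof.
rewrite -{1}[w]kappaK propeqE; split=> -[e0 h]; split => // i j.
  by have := h i j; rewrite -!ball_normE /ball_ /= kappa_coord.
by rewrite -!ball_normE /ball_ /= kappa_coord; have := h i j; rewrite -!ball_normE.
Qed.

Lemma kappa_continuous r s (z : 'rV[C]_(r + s + 0)) : (@kappa r s) @ z --> kappa z.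
Proof.
move=> A /nbhs_ballP [e e0 eA]; apply/nbhs_ballP; exists e => // w zw.
by apply: eA; rewrite kappa_ball kappaK.
Qed.

Lemma near_kappa r s (z : 'rV[C]_(r + s + 0)) (A : set 'rV[C]_(r + s + 0)) :
  nbhs z A -> nbhs (kappa z) [set w | A (kappa w)].
Proof.
move=> /nbhs_ballP [e e0 eA]; apply/nbhs_ballP; exists e => // w.
by rewrite kappa_ball => /eA.
Qed.

Lemma ball_convexC n (c : 'rV[C]_n) (e : C) : convexC (ball c e).
Proof.
move=> z z' [e0 cz] [_ cz'] t /andP[t0 t1]; split=> // i j.
have := cz i j; have := cz' i j.
rewrite -!ball_normE /ball_ /= !mxE => h1 h2.
have -> : c i j - (z i j + (t%:C)%C * (z' i j - z i j)) =
  (1 - (t%:C)%C) * (c i j - z i j) + (t%:C)%C * (c i j - z' i j) by ring.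
have t0' : 0 <= (t%:C)%C :> C by rewrite lecR.
have t1' : 0 <= 1 - (t%:C)%C :> C by rewrite subr_ge0 -[1]/((1%:C)%C) lecR.
apply: le_lt_trans (ler_normD _ _) _; rewrite !normrM (ger0_norm t0') (ger0_norm t1').
have [->|tn] := eqVneq t 0; first by rewrite subr0 mul1r mul0r addr0.
have tp : 0 < (t%:C)%C :> C by rewrite ltcR lt_neqAle eq_sym tn.
rewrite [X in _ < X](_ : e = (1 - (t%:C)%C) * e + (t%:C)%C * e); last by ring.
by apply: ler_ltD; [apply: ler_wpM2l => //; exact: ltW|rewrite ltr_pM2l].
Qed.

Lemma is_derive_conj (h : C -> C) (d : C) : is_derive (0 : C) (1 : C) h d ->
  is_derive (0 : C) (1 : C) (fun s => (h s^*)^*) d^*.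
Proof.
move=> [h1 h2].
have cv : (fun k : C => k^-1 *: (((fun s => (h s^*)^*) \o shift 0) (k *: 1) - (h (0 : C)^*)^*)) @ 0^' --> d^*.
  apply/cvgrPdist_le => e e0; move/cvgrPdist_le: h1 => /(_ e e0).
  rewrite -[lim _]/('D_1 h 0) h2 => /nbhs_ballP [r r0 hr].
  apply/nbhs_ballP; exists r => // k kr k0.
  have := hr k^*; rewrite -!ball_normE /ball_ /= !sub0r !normrN norm_conjC.
  move: kr; rewrite -ball_normE /ball_ /= sub0r normrN => kr /(_ kr).
  rewrite conjC_eq0 => /(_ k0).
  rewrite -[X in X <= _]norm_conjC; congr (`|_| <= e).
  rewrite /GRing.scale /= !mulr1 !addr0 rmorphB rmorphM rmorphB fmorphV /= conjCK.
  by rewrite conjC0.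
apply: DeriveDef; first by apply/cvg_ex; exists d^*.
exact: cvg_lim cv.
Qed.

(** Conjugation in the source, through [kappa], and conjugation in the target compensate each
    other. *)
Lemma hol_at_kappa r s m (f : 'rV[C]_(r + s + 0) -> 'rV[C]_m) (w : 'rV[C]_(r + s + 0)) D :
  hol_at f (kappa w) D -> hol_at (fun w => cj (f (kappa w))) w (gram r s 0 *m cj D).
Proof.
move=> [fc fd]; split.
  move=> phi.
  have e (x : 'rV[C]_m) : dotp (cj x) phi = (dotp x (cj phi))^* by rewrite -dotp_cj cjK.
  rewrite e; under eq_fun do rewrite e.
  have c1 : (fun w => dotp (f (kappa w)) (cj phi)) @ w --> dotp (f (kappa w)) (cj phi).
    move=> A hA; have := @kappa_continuous r s w _ (fc (cj phi) A hA); exact.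
  apply/cvgrPdist_le => eps e0; move/cvgrPdist_le: c1 => /(_ eps e0).
  by apply: filterS => w'; rewrite -rmorphB norm_conjC.
move=> u phi.
have e (x : 'rV[C]_m) : dotp (cj x) phi = (dotp x (cj phi))^* by rewrite -dotp_cj cjK.
have := is_derive_conj (fd (kappa u) (cj phi)).
have -> : (dotp (kappa u *m D) (cj phi))^* = dotp (u *m (gram r s 0 *m cj D)) phi.
  by rewrite -e cjM /kappa cjK mulmxA.
have -> // : (fun s0 : C => (dotp (f (kappa w + s0^* *: kappa u)) (cj phi))^*) =
  fun s0 : C => dotp (cj (f (kappa (w + s0 *: u)))) phi.
by apply/funext => a; rewrite -e kappa_line.
Qed.

Lemma hol_at_mulr n m p (f : 'rV[C]_n -> 'rV[C]_m) (z : 'rV[C]_n) D (M : 'M[C]_(m, p)) :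
  hol_at f z D -> hol_at (fun z => f z *m M) z (D *m M).
Proof.
move=> [fc fd]; split=> [phi|u phi].
  have e (x : 'rV[C]_m) : dotp (x *m M) phi = dotp x (phi *m M^T).
    by rewrite dotp_trmx trmxK.
  rewrite e; under eq_fun do rewrite e; exact: fc.
have e (x : 'rV[C]_m) : dotp (x *m M) phi = dotp x (phi *m M^T).
  by rewrite dotp_trmx trmxK.
rewrite mulmxA e; under eq_fun do rewrite e; exact: fd.
Qed.

Lemma differentiable_hol_at n m (G : 'rV[C]_n -> 'rV[C]_m) (z : 'rV[C]_n) :
  differentiable G z -> exists D, hol_at G z D.
Proof.
move=> dG; exists (lin1_mx ('d G z)); split=> [phi|u phi].
  exact: (dotp_cvgl (differentiable_continuous dG)).
rewrite mul_rV_lin1 /= -(deriveE u dG).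
have h : (fun k : C => k^-1 *: (G (k *: u + z) - G z)) @ 0^' --> 'D_u G z.
  exact: (diff_derivable dG).
have cv : (fun k : C => k^-1 *: (((fun s : C => dotp (G (z + s *: u)) phi) \o shift 0) (k *: 1) - dotp (G (z + 0 *: u)) phi)) @ 0^' --> dotp ('D_u G z) phi.
  have -> : (fun k : C => k^-1 *: (((fun s : C => dotp (G (z + s *: u)) phi) \o shift 0) (k *: 1) - dotp (G (z + 0 *: u)) phi))
    = fun k => dotp (k^-1 *: (G (k *: u + z) - G z)) phi.
    apply/funext => k /=; rewrite dotpZl dotpBl scale0r !addr0 -[_ *: 1]/(_ * 1) mulr1.
    by rewrite [z + _]addrC.
  exact: (dotp_cvgl h).
apply: DeriveDef; first by apply/cvg_ex; exists (dotp ('D_u G z) phi).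
exact: cvg_lim cv.
Qed.

End Polarization.

(** * Continuation over connected sets and linear algebra of Hermitian spans *)

Section Structure.
Variable R : realType.
Local Notation C := (Cplx R).

(** The interior of [X] in [U] is also closed in [U]: near a limit point, [X] is the common zero set
    of holomorphic functions on a convex set, and these vanish near one of its points. [X] is a
    property rather than a function because only local lifts are holomorphic. *)
Lemma connected_uc n (U : set 'rV[C]_n) (X : 'rV[C]_n -> Prop) :
  open U -> connected U ->
  (forall z0, U z0 -> exists (V : set 'rV[C]_n) (I : Type) (psi : I -> 'rV[C]_n -> C),
     [/\ open V, convexC V, V z0, (forall i, lhol V (psi i)) &
        forall z, V z -> (X z <-> forall i, psi i z = 0)]) ->
  (exists2 z1, U z1 & \forall z \near z1, X z) -> forall z, U z -> X z.
Proof.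
move=> oU cU loc [z1 Uz1 Xz1].
pose Xs : set 'rV[C]_n := [set z | X z].
suff e : U `&` Xs° = U.
  by move=> z; rewrite -e => -[_ /interior_subset].
apply: cU; first by exists z1.
  by exists Xs° => //; exact: open_interior.
exists (closure (U `&` Xs°)); first exact: closed_closure.
apply/seteqP; split=> [z Hz|z [Uz Xz]].
  by split; [exact: Hz.1|exact: (@subset_closure _ (U `&` Xs°) z Hz)].
split; first exact: Uz.
have [V [I [psi [oV cV Vz hpsi XV]]]] := loc z Uz.
have nV : nbhs z V by exact: open_nbhs_nbhs.
have [b [[Ub Xb] Vb]] := Xz V nV.
apply: filterS nV => z' Vz'; apply/(XV z' Vz') => i.
apply: (uc_nbhs oV cV (hpsi i) Vb Vz').
have nVb : nbhs b V by exact: open_nbhs_nbhs.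
by apply: filterS (filterI nVb Xb) => w [Vw Xw]; exact: (XV w Vw).1.
Qed.

Lemma kernel_complement N (H : 'M[C]_N) : exists k (B : 'M[C]_(k, N)) (K : 'M[C]_N),
  [/\ K *m H = 0, (1%:M <= B + K)%MS & forall x : 'rV[C]_k, x *m B *m H = 0 -> x = 0].
Proof.
pose K := kermx H.
exists (\rank (K^C)%MS), (row_base (K^C)%MS), K; split; first exact: mulmx_ker.
  rewrite (adds_eqmx (eq_row_base _) (eqmx_refl K)) addsmxC sub1mx.
  exact: addsmx_compl_full.
move=> x xH; have : (x *m row_base (K^C)%MS <= K :&: K^C)%MS.
  rewrite sub_capmx; apply/andP; split; first exact/sub_kermxP.
  by apply: submx_trans (submxMl _ _) _; rewrite eq_row_base.
rewrite capmx_compl submx0 => /eqP xC.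
by apply: (row_free_inj (row_base_free (K^C)%MS)); rewrite mul0mx.
Qed.

(** [S0] is the radical of the form on [S], coming from the kernel of the Gram matrix [H], and [A]
    comes from a complement of that kernel. Nondegeneracy bounds the dimension of [A] by the rank of
    the ambient form, so the bound is independent of t. *)
Lemma herm_decomp r s t (S : 'M[C]_(r + s + t)) :
  exists m (A : 'M[C]_(m, r + s + t)) (S0 : 'M[C]_(r + s + t)),
  [/\ (m <= r + s)%N, A *m gram R r s t *m (cj A)^T \in unitmx,
   (A <= S)%MS, (S0 <= S)%MS & (S <= A + S0)%MS /\ S0 *m gram R r s t *m (cj S)^T = 0].
Proof.
have [H HE] : exists H, H = S *m gram R r s t *m (cj S)^T by eexists.
have HH : (cj H)^T = H.
  by rewrite HE !cjM !trmx_mul cjT cj_gram tr_gram !trmxK cjK !mulmxA.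
have [m [B [K [KH full inj0]]]] := kernel_complement H.
exists m, (B *m S), (K *m S).
have gramE : B *m S *m gram R r s t *m (cj (B *m S))^T = B *m H *m (cj B)^T.
  by rewrite cjM trmx_mul HE !mulmxA.
have inj (x : 'rV[C]_m) : x *m (B *m H *m (cj B)^T) = 0 -> x = 0.
  move=> x0; apply: inj0.
  have y1 : x *m B *m H *m (cj B)^T = 0 by rewrite -x0 !mulmxA.
  have y2 : x *m B *m H *m (cj K)^T = 0.
    by rewrite -HH -mulmxA -trmx_mul -cjM KH cj0 trmx0 mulmx0.
  have [[d1 d2] /= e1] := sub_addsmxP full.
  rewrite -[LHS]mulmx1 -[1%:M]trmx1.
  have -> : (1%:M : 'M[C]_(r + s + t)) = cj (d1 *m B + d2 *m K) by rewrite -e1 /cj map_mx1.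
  by rewrite cjD linearD /= mulmxDr !cjM !trmx_mul !mulmxA y1 y2 !mul0mx addr0.
have unit : B *m S *m gram R r s t *m (cj (B *m S))^T \in unitmx.
  rewrite gramE -row_free_unit -kermx_eq0; apply/eqP/row_matrixP => i.
  by rewrite row0; apply: inj; rewrite -row_mul mulmx_ker row0.
split => //.
- have : (\rank (B *m S *m gram R r s t *m (cj (B *m S))^T) <= \rank (gram R r s t))%N.
    by apply: leq_trans (mxrankM_maxl _ _) (mxrankM_maxr _ _).
  rewrite mxrank_unit// => /leq_trans; apply; exact: rank_gram.
- exact: submxMl.
- exact: submxMl.
split; last by rewrite -!mulmxA [S *m _]mulmxA -HE KH.
rewrite -[X in (X <= _)%MS]mul1mx; apply: submx_trans (submxMr S full) _.
by rewrite addsmxMr.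
Qed.

(** The 2 x 2 minors of x and x T are quadratic in x and vanish near [w], hence everywhere. Basis
    vectors then kill the off-diagonal entries, and sums of two basis vectors equate the diagonal
    ones. *)
Lemma scalar_of_eigen n (T : 'M[C]_n) (w : 'rV[C]_n) :
  (\forall x \near w, exists a : C, x *m T = a *: x) -> exists c : C, T = c%:M.
Proof.
move=> hT.
have minor (y : 'rV[C]_n) i j : (y *m T) 0 i * y 0 j = (y *m T) 0 j * y 0 i.
  have e (x : 'rV[C]_n) k : (x *m T) 0 k = dotp x (delta_mx 0 k *m T^T).
    by rewrite dotp_trmx trmxK dotp_delta.
  apply/eqP; rewrite -subr_eq0; apply/eqP; rewrite !e -!(dotp_delta y).
  have cT : convexC (setT : set 'rV[C]_n) by [].
  have lh (a b : 'rV[C]_n) : lhol setT (fun x : 'rV[C]_n => dotp x a * dotp x b).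
    by apply: lholM; exact: lhol_dotp.
  apply: (@uc_nbhs R n setT (fun y => dotp y (delta_mx 0 i *m T^T) * dotp y (delta_mx 0 j) -
    dotp y (delta_mx 0 j *m T^T) * dotp y (delta_mx 0 i)) w y openT cT) => //.
    exact: (lholB (lh _ _) (lh _ _)).
  apply: filterS hT => x [a xa].
  by rewrite -!e !dotp_delta xa !mxE; ring.
have off i j : i != j -> T i j = 0.
  move=> ij; have := minor (delta_mx 0 i) j i.
  by rewrite -!rowE !mxE !eqxx /= [j == i]eq_sym (negbTE ij) mulr1 mulr0.
have diag i j : T i i = T j j.
  have [->//|ij] := eqVneq i j.
  have := minor (delta_mx 0 i + delta_mx 0 j) i j.
  rewrite mulmxDl -!rowE !mxE !eqxx /= (negbTE ij) [j == i]eq_sym (negbTE ij).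
  by rewrite (off i j ij) (off j i) 1?eq_sym// !addr0 !add0r !mulr1.
case: n T w hT minor off diag => [|n] T w hT minor off diag.
  by exists 0; apply/matrixP => -[].
exists (T 0 0); apply/matrixP => i j; rewrite !mxE.
by case: eqVneq => [->|ij]; rewrite ?mulr1n ?mulr0n; [exact: diag|exact: off].
Qed.

Lemma minors_parallel n (a b : 'rV[C]_n) : b != 0 ->
  (forall i j, a 0 i * b 0 j = a 0 j * b 0 i) -> exists l : C, a = l *: b.
Proof.
move=> /rV0Pn [k bk] h; exists (a 0 k / b 0 k); apply/rowP => i.
by rewrite mxE; apply: (mulIf bk); rewrite h mulrAC divfK.
Qed.

End Structure.

(** * Structure of a local orthogonal map *)

Section Orthogonal.
Variable R : realType.
Local Notation C := (Cplx R).

Lemma hformZ r s t (a b : C) (u v : 'rV[C]_(r + s + t)) :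
  hform R r s t (a *: u) (b *: v) = a * b^* * hform R r s t u v.
Proof. by rewrite !hformE -scalemxAl cjZ dotpZl dotpZr mulrA. Qed.

Lemma hformDl r s t (u u' v : 'rV[C]_(r + s + t)) :
  hform R r s t (u + u') v = hform R r s t u v + hform R r s t u' v.
Proof. by rewrite !hformE mulmxDl dotpDl. Qed.

Lemma hformDr r s t (u v v' : 'rV[C]_(r + s + t)) :
  hform R r s t u (v + v') = hform R r s t u v + hform R r s t u v'.
Proof. by rewrite !hformE cjD dotpDr. Qed.

Lemma hform_mul r s t p q (x : 'rV[C]_p) (y : 'rV[C]_q) (A : 'M[C]_(p, r + s + t)) (B : 'M[C]_(q, r + s + t)) :
  hform R r s t (x *m A) (y *m B) = dotp (x *m (A *m gram R r s t *m (cj B)^T)) (cj y).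
Proof. by rewrite hformE cjM dotp_trmx !mulmxA. Qed.

Lemma local_lift n N (U : set 'rV[C]_n) (F : 'rV[C]_n -> 'rV[C]_N) (z0 : 'rV[C]_n) :
  open U -> proj_holo_map R U F -> U z0 -> exists e (G : 'rV[C]_n -> 'rV[C]_N),
  [/\ 0 < e, ball z0 e `<=` U, hol (ball z0 e) G &
     forall z, ball z0 e z -> exists2 c : C, c != 0 & G z = c *: F z].
Proof.
move=> oU [_ [_ lift]] Uz0.
have [V [[oV Vz0 VU] [G [dG GF]]]] := lift z0 Uz0.
have /nbhs_ballP [e e0 eV] : nbhs z0 V by exact: open_nbhs_nbhs.
exists e, G; split => //.
- by move=> z /eV /VU.
- by move=> z /eV Vz; apply: differentiable_hol_at; exact: dG.
by move=> z /eV /GF [_ [_ [c [c0 Gz]]]]; exists c.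
Qed.

Lemma near_kappa_sym r s (w : 'rV[C]_(r + s + 0)) (A : set 'rV[C]_(r + s + 0)) :
  nbhs (kappa w) A -> nbhs w [set w | A (kappa w)].
Proof. by move=> h; have := near_kappa h; rewrite [kappa (kappa w)]kappaK. Qed.

Section LocalHermitian.
Variables (r s m : nat) (Delta : 'M[C]_m) (za : 'rV[C]_(r + s + 0)) (e : C).
Variable f : 'rV[C]_(r + s + 0) -> 'rV[C]_m.

(* Polarization: antiholomorphic dependence on the second point is turned into
   holomorphic dependence through the isometric involution [kappa]. *)
Lemma hermitian_local_linear :
  0 < e -> Delta \in unitmx -> hform R r s 0 za za = 0 -> ~ ball za e 0 ->
  hol (ball za e) f -> spanning (ball za e) f ->
  (forall z y, ball za e z -> ball za e y -> hform R r s 0 z y = 0 ->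
     dotp (f z *m Delta) (cj (f y)) = 0) ->
  (0 < m)%N -> (m + 3 <= 2 * (r + s + 0))%N ->
  exists (zs : 'rV[C]_(r + s + 0)) (L : 'M[C]_(r + s + 0, m)) (c : C),
  [/\ ball za e zs, c != 0, L *m Delta *m (cj L)^T = c *: gram R r s 0 &
    \forall z \near zs, exists2 rho : C, rho != 0 & f z = rho *: (z *m L)].
Proof.
move=> e0 uD nza V0 hf sf orth m0 mn.
pose V : set 'rV[C]_(r + s + 0) := ball za e.
pose V' : set 'rV[C]_(r + s + 0) := ball (kappa za) e.
have V'E w : V' w = V (kappa w) by rewrite /V' kappa_ball.
pose g w := cj (f (kappa w)) *m Delta^T.
have Vza : V za by exact: ballxx.
have oV : open V by exact: ball_open.
have oV' : open V' by exact: ball_open.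
have cV : convexC V by exact: ball_convexC.
have cV' : convexC V' by exact: ball_convexC.
have V'0 : ~ V' 0 by rewrite V'E /kappa mul0mx cj0.
have fgE z w : dotp (f z) (g w) = dotp (f z *m Delta) (cj (f (kappa w))).
  by rewrite /g dotp_trmx trmxK.
have hg : hol V' g.
  move=> w; rewrite V'E => /hf [D hD]; exists (gram R r s 0 *m cj D *m Delta^T).
  exact: hol_at_mulr (hol_at_kappa hD).
have no : null_orth V V' f g.
  move=> z w Vz; rewrite V'E => V'w zw; rewrite fgE.
  by apply: (orth z (kappa w) Vz V'w); rewrite hform_kappa kappaK.
have sg : spanning V' g.
  move=> phi hphi.
  have : cj (phi *m Delta) = 0.
    apply: sf => z Vz; have := hphi (kappa z); rewrite V'E kappaK => /(_ Vz).
    rewrite /g kappaK dotpC dotp_trmx trmxK -{1}[phi *m Delta]cjK dotp_cj => /eqP.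
    by rewrite conjC_eq0 dotpC => /eqP.
  move=> /eqP; rewrite cj_eq0 => /eqP h.
  by rewrite -[phi](mulmxK uD) h mul0mx.
have V'za : V' (kappa za) by exact: ballxx.
have nzz : dotp za (kappa za) = 0 by rewrite -hform_kappa.
have [z0 [zs [L [Vz0 fz0 Vzs near1 rel]]]] :=
  local_linear oV cV oV' cV' V0 V'0 hf hg no sf sg Vza V'za nzz m0 mn.
have [w2 V'w2 gw2] : exists2 w2, V' w2 & dotp (g w2) (f z0) != 0.
  apply: contrapT => hno; move/negP: fz0; apply; apply/eqP; apply: sg => w V'w.
  by apply/eqP/negPn/negP => hw; apply: hno; exists w.
pose O : set 'rV[C]_(r + s + 0) := [set z | exists2 rho : C, rho != 0 & f z = rho *: (z *m L)].
have nO : nbhs zs (O°) by apply: open_nbhs_nbhs; split; [exact: open_interior|exact: near1].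
have V'zs : V' (kappa zs) by rewrite V'E kappaK.
have nO' : nbhs (kappa zs) [set w | O° (kappa w)].
  exact: near_kappa nO.
have [w1 [Ow1 V'w1 gw1]] := uc_dense oV' cV' (@lhol_hol R _ m V' g (f z0) hg) V'zs V'w2 gw2 nO'.
(* Where [f] is given by [L] at [kappa w], the dual relation [rel] says that w is an eigenvector of
   [T]. Since the Gram matrix squares to 1, [T] scalar means that [L] scales the form by [c]. *)
pose T := gram R r s 0 *m (L *m Delta *m (cj L)^T)^T.
have relT w : V' w -> dotp (g w) (f z0) != 0 -> O (kappa w) ->
    exists2 a : C, a != 0 & w *m T = a *: w.
  move=> V'w gw [rho rho0 frho].
  have z0w : dotp z0 w != 0.
    apply: contra gw => /eqP zw; rewrite dotpC; apply/eqP; exact: no.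
  have fg : dotp (f z0) (g w) != 0 by rewrite dotpC.
  have := rel w V'w.
  have -> : g w *m L^T = rho^* *: (w *m T).
    rewrite /g frho cjZ cjM /kappa cjK -!scalemxAl /T !trmx_mul !trmxK.
    by rewrite !mulmxA.
  rewrite scalerA => e1.
  have nzf : dotp z0 w * rho^* != 0 by apply: mulf_neq0; [exact: z0w|rewrite conjC_eq0; exact: rho0].
  exists ((dotp z0 w * rho^*)^-1 * dotp (f z0) (g w)); first by apply: mulf_neq0; [rewrite invr_eq0; exact: nzf|exact: fg].
  by rewrite -[RHS]scalerA -e1 [RHS]scalerA (mulVf nzf) [RHS]scale1r.
have [c Tc] : exists c : C, T = c%:M.
  apply: (@scalar_of_eigen R _ T w1).
  have [Dg hDg] := hg w1 V'w1.
  have n1 := hol_near_neq0 hDg gw1.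
  have n2 : nbhs w1 V' by exact: open_nbhs_nbhs (conj oV' V'w1).
  have nOw : nbhs (kappa w1) (O°) by apply: open_nbhs_nbhs; split; [exact: open_interior|exact: Ow1].
  apply: filterS (filterI n1 (filterI n2 (near_kappa_sym nOw))) => w [h1 [h2 h3]].
  by have [a _ wa] := relT w h2 h1 (interior_subset h3); exists a.
exists zs, L, c; split; [exact: Vzs| | |exact: near1].
  have [a a0 wa] := relT w1 V'w1 gw1 (interior_subset Ow1).
  apply: contra a0 => /eqP c0; move: wa; rewrite Tc c0 raddf0 mulmx0 => /esym/eqP.
  by rewrite scaler_eq0 => /orP[//|/eqP w10]; case: V'0; rewrite -w10.
apply: trmx_inj; rewrite linearZ /= tr_gram.
by rewrite -[LHS]mul1mx -(gram_sqr R r s) -mulmxA -/T Tc mul_mx_scalar.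
Qed.

End LocalHermitian.

(* [v *m coordp A] is the coordinate vector, in the basis given by the rows of [A], of
   the orthogonal projection of [v] on the nondegenerate space [A] *)
Definition coordp r s t m (A : 'M[C]_(m, r + s + t)) : 'M[C]_(r + s + t, m) :=
  gram R r s t *m (cj A)^T *m invmx (A *m gram R r s t *m (cj A)^T).

Lemma coordp_id r s t m (A : 'M[C]_(m, r + s + t)) :
  A *m gram R r s t *m (cj A)^T \in unitmx -> A *m coordp A = 1%:M.
Proof. by move=> uA; rewrite /coordp !mulmxA mulmxV. Qed.

Lemma coordp_orth r s t m p (A : 'M[C]_(m, r + s + t)) (S0 : 'M[C]_(p, r + s + t)) :
  S0 *m gram R r s t *m (cj A)^T = 0 -> S0 *m coordp A = 0.
Proof. by move=> h; rewrite /coordp !mulmxA h mul0mx. Qed.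

Lemma coordp_decomp r s t m p (A : 'M[C]_(m, r + s + t)) (S0 : 'M[C]_(p, r + s + t)) (v : 'rV[C]_(r + s + t)) :
  A *m gram R r s t *m (cj A)^T \in unitmx -> S0 *m gram R r s t *m (cj A)^T = 0 ->
  (v <= A + S0)%MS -> exists2 b : 'rV[C]_p, v = v *m coordp A *m A + b *m S0 & (b *m S0) *m coordp A = 0.
Proof.
move=> uA hS /sub_addsmxP [[a b] /= vE]; exists b; last by rewrite -mulmxA coordp_orth// mulmx0.
have -> : v *m coordp A = a; last exact: vE.
by rewrite vE mulmxDl -!mulmxA coordp_id// coordp_orth// mulmx1 mulmx0 addr0.
Qed.

(** Linearity of the component in [A] is expressed by 2 x 2 minors: they are holomorphic in a local
    lift, their vanishing is insensitive to rescaling [F], and they make sense where the component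
    vanishes. The proportionality factor found near one point has no such control over [U]. *)
Theorem orthogonal_structure (r s r' s' t' : nat)
    (U : set 'rV[C]_(r + s + 0)) (F : 'rV[C]_(r + s + 0) -> 'rV[C]_(r' + s' + t')) :
  local_orthogonal R r s 0 r' s' t' U F -> (r' + s' + 3 <= 2 * (r + s))%N ->
  null_map R r s 0 r' s' t' U F \/
  exists m (A : 'M[C]_(m, r' + s' + t')) (S0 : 'M[C]_(r' + s' + t'))
    (L : 'M[C]_(r + s + 0, m)) (c : C),
  [/\ A *m gram R r' s' t' *m (cj A)^T \in unitmx,
      S0 *m gram R r' s' t' *m (cj A)^T = 0,
      S0 *m gram R r' s' t' *m (cj S0)^T = 0, c != 0 &
   [/\ forall z, U z -> (F z <= A + S0)%MS,
       forall z, U z -> forall i j, (F z *m coordp A) 0 i * (z *m L) 0 j = (F z *m coordp A) 0 j * (z *m L) 0 i,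
       exists2 z, U z & F z *m coordp A != 0 &
       forall z w, hform R r' s' t' (z *m (L *m A)) (w *m (L *m A)) = c * hform R r s 0 z w]].
Proof.
move=> [[oU [cU [U0 _]]] [[za [Uza nza]] [holF orthF]]] mn.
have [e [G [e0 VU hG GF]]] := local_lift oU holF Uza.
have [S [GS minS]] := family_span (fun x => exists2 z, ball za e z & x = G z).
have FS z : U z -> (F z <= S)%MS.
  move: z; apply: (connected_uc oU cU) => [z0 Uz0|].
    have [e' [G' [e0' VU' hG' GF']]] := local_lift oU holF Uz0.
    exists (ball z0 e'), 'I_(r' + s' + t'), (fun i z => dotp (G' z) (row i (cokermx S)^T)).
    split; [exact: ball_open|exact: ball_convexC|exact: ballxx|by move=> i; exact: lhol_hol|].
    move=> z Vz; have [c c0 ->] := GF' z Vz; rewrite submxE; split.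
      move=> /eqP Fz i; rewrite dotpZl rowE dotp_trmx trmxK Fz dotp0l mulr0 //.
    move=> h; apply/eqP/rowP => i; apply: (mulfI c0).
    have := h i; rewrite dotpZl rowE dotp_trmx trmxK dotp_delta => ->.
    by rewrite mxE mulr0.
  exists za => //.
  have nV : nbhs za (ball za e) by apply: nbhsx_ballx.
  apply: filterS nV => z Vz; have [c c0 Gz] := GF z Vz.
  have := GS (G z); rewrite Gz => /(_ _)/(submx_trans _) h.
  by rewrite -(eqmx_scale _ c0) -Gz; apply: GS; exists z.
have [m [A [S0 [mle uA AS S0S [SAS0 hS0]]]]] := herm_decomp S.
have subS p q (X : 'M[C]_(p, r' + s' + t')) (Y : 'M[C]_(q, r' + s' + t')) :
    (X <= S0)%MS -> (Y <= S)%MS -> X *m gram R r' s' t' *m (cj Y)^T = 0.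
  move=> /submxP [D1 ->] /submxP [D2 ->].
  have -> : D1 *m S0 *m gram R r' s' t' *m (cj (D2 *m S))^T =
      D1 *m (S0 *m gram R r' s' t' *m (cj S)^T) *m (cj D2)^T.
    by rewrite cjM trmx_mul !mulmxA.
  by rewrite hS0 mulmx0 mul0mx.
have S0A := subS _ _ S0 A (submx_refl _) AS.
have S0S0 := subS _ _ S0 S0 (submx_refl _) S0S.
(* If [A] is zero, [S] is contained in its own radical [S0] and is itself a null space containing
   the image. *)
have [m0|m0] := posnP m.
  left; exists S; split; last by move=> z Uz _; exact: FS.
  have SS0 : (S <= S0)%MS.
    apply: submx_trans SAS0 _; rewrite addsmx_sub submx_refl andbT.
    have -> : A = 0; last exact: sub0mx.
    by apply/matrixP => i; have := ltn_ord i; rewrite [X in (_ < X)%N]m0.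
  move=> u v uS vS; rewrite hformE; apply/dotp_mx0.
  exact: (subS _ _ u v (submx_trans uS SS0) vS).
right.
pose Delta := A *m gram R r' s' t' *m (cj A)^T.
pose f z := G z *m coordp A.
have GAS z : ball za e z -> (G z <= A + S0)%MS.
  by move=> Vz; apply: submx_trans SAS0; apply: GS; exists z.
have hf : hol (ball za e) f.
  by move=> z Vz; have [D hD] := hG z Vz; exists (D *m coordp A); exact: hol_at_mulr.
have sf : spanning (ball za e) f.
  move=> phi hphi.
  have : (S <= kermx (coordp A *m phi^T))%MS.
    apply: minS => _ [z Vz ->]; apply/sub_kermxP; rewrite mulmxA.
    by apply/dotp_mx0; exact: hphi.
  move=> /(submx_trans AS) /sub_kermxP; rewrite mulmxA coordp_id// mul1mx => h.
  by apply: trmx_inj; rewrite h trmx0.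
have orth z y : ball za e z -> ball za e y -> hform R r s 0 z y = 0 ->
    dotp (f z *m Delta) (cj (f y)) = 0.
  move=> Vz Vy zy.
  have := orthF z y (VU _ Vz) (VU _ Vy) zy.
  have [c c0 Gz] := GF z Vz; have [d d0 Gy] := GF y Vy.
  move=> F0; have : hform R r' s' t' (G z) (G y) = 0 by rewrite Gz Gy hformZ F0 mulr0.
  have [b GzE _] := coordp_decomp uA S0A (GAS z Vz); have [b' GyE _] := coordp_decomp uA S0A (GAS y Vy).
  have bS0 : hform R r' s' t' (b *m S0) (G y) = 0.
    rewrite hformE; apply/dotp_mx0; apply: (subS _ _ (b *m S0) (G y)); first exact: submxMl.
    by apply: GS; exists y.
  rewrite {1}GzE hformDl bS0 addr0 GyE hformDr !hform_mul.
  have -> : A *m gram R r' s' t' *m (cj S0)^T = 0.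
    have := congr1 (fun M => (cj M)^T) S0A.
    by rewrite cj0 trmx0 !cjM cjT cjK cj_gram !trmx_mul trmxK tr_gram mulmxA.
  by rewrite mulmx0 dotp0l addr0.
have V0 : ~ ball za e 0 by move=> /VU.
have mn' : (m + 3 <= 2 * (r + s + 0))%N by move: mle mn; clear; lia.
have [zs [L [c [Vzs c0 Lc near1]]]] := hermitian_local_linear e0 uA nza V0 hf sf orth m0 mn'.
exists m, A, S0, L, c; split => //; split.
- by move=> z Uz; apply: submx_trans SAS0; exact: FS.
- apply: (connected_uc oU cU) => [z0 Uz0|].
    have [e' [G' [e0' VU' hG' GF']]] := local_lift oU holF Uz0.
    exists (ball z0 e'), ('I_m * 'I_m)%type, (fun p z =>
      dotp (G' z) (delta_mx 0 p.1 *m (coordp A)^T) * dotp z (delta_mx 0 p.2 *m L^T) -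
      dotp (G' z) (delta_mx 0 p.2 *m (coordp A)^T) * dotp z (delta_mx 0 p.1 *m L^T)).
    split; [exact: ball_open|exact: ball_convexC|exact: ballxx| |].
      have lg phi := @lhol_hol R _ _ (ball z0 e') G' phi hG'.
      have ld := @lhol_dotp R (r + s + 0) (ball z0 e').
      by move=> [i j] /=; exact: (lholB (lholM (lg _) (ld _)) (lholM (lg _) (ld _))).
    move=> z Vz; have [d d0 Gz] := GF' z Vz.
    have E1 i : dotp (G' z) (delta_mx 0 i *m (coordp A)^T) = d * (F z *m coordp A) 0 i.
      by rewrite dotp_trmx trmxK dotp_delta Gz -scalemxAl mxE.
    have E2 i : dotp z (delta_mx 0 i *m L^T) = (z *m L) 0 i.
      by rewrite dotp_trmx trmxK dotp_delta.
    split=> [h [i j] /=|h i j]; first by rewrite !E1 !E2 -!mulrA h subrr.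
    have /eqP := h (i, j); rewrite /= !E1 !E2 -!mulrA subr_eq0 => /eqP.
    exact: (mulfI d0).
  exists zs; first exact: VU.
  have nV : nbhs zs (ball za e) by apply: open_nbhs_nbhs; split; [exact: ball_open|].
  apply: filterS (filterI nV near1) => z [Vz [rho rho0 fz]] i j.
  have [d d0 Gz] := GF z Vz; apply: (mulfI d0).
  have E i' : d * (F z *m coordp A) 0 i' = rho * (z *m L) 0 i'.
    have := congr1 (fun x : 'rV[C]_m => x 0 i') fz.
    by rewrite /f Gz -scalemxAl [LHS]mxE [RHS]mxE.
  by rewrite !mulrA !E; ring.
- have [z Vz fz] : exists2 z, ball za e z & f z != 0.
    apply: contrapT => hno.
    have : (const_mx 1 : 'rV[C]_m) = 0.
      apply: sf => z Vz; have [->|fz] := eqVneq (f z) 0; first exact: dotp0l.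
      by case: hno; exists z.
    by move=> /rowP /(_ (Ordinal m0)); rewrite !mxE => /eqP; rewrite oner_eq0.
  exists z; first exact: VU.
  have [d d0 Gz] := GF z Vz; apply: contra fz => /eqP Fz.
  by rewrite /f Gz -scalemxAl Fz scaler0.
move=> z w; rewrite hform_mul cjM trmx_mul -!mulmxA.
have -> : L *m (A *m (gram R r' s' t' *m ((cj A)^T *m (cj L)^T))) = c *: gram R r s 0.
  by rewrite -Lc !mulmxA.
by rewrite -scalemxAr dotpZl hformE.
Qed.

End Orthogonal.

(** * Splitting along a nondegenerate subspace *)

Section Splitting.
Variable R : realType.
Local Notation C := (Cplx R).
Variables (r s t m : nat) (A : 'M[C]_(m, r + s + t)).
Hypothesis uA : A *m gram R r s t *m (cj A)^T \in unitmx.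

(** This complements [A] in the whole space even when the ambient form is degenerate, because the
    form is nondegenerate on [A]. *)
Definition orthc : 'M[C]_(r + s + t) := kermx (gram R r s t *m (cj A)^T).

Lemma orthc_cap : (<<A>> :&: orthc = (0 : 'M[C]_(r + s + t)))%MS.
Proof.
apply/eqP; rewrite -submx0; apply/rV_subP => v; rewrite sub_capmx genmxE.
move=> /andP[/submxP [a ->] /sub_kermxP]; rewrite -mulmxA [A *m _]mulmxA => h.
by rewrite -[a](mulmxK uA) h !mul0mx sub0mx.
Qed.

Lemma orthc_add : ((1%:M : 'M[C]_(r + s + t)) <= <<A>> + orthc)%MS.
Proof.
apply/rV_subP => v _; rewrite -[v](subrK (v *m coordp A *m A)) addrC.
apply: addmx_sub_adds; first by rewrite genmxE submxMl.
apply/sub_kermxP; rewrite mulmxBl.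
have -> : v *m coordp A *m A *m (gram R r s t *m (cj A)^T) =
    v *m (gram R r s t *m (cj A)^T) *m invmx (A *m gram R r s t *m (cj A)^T) *m
    (A *m gram R r s t *m (cj A)^T) by rewrite /coordp !mulmxA.
by rewrite mulmxKV// subrr.
Qed.

Lemma orthc_orth (a b : 'rV[C]_(r + s + t)) :
  (a <= <<A>>)%MS -> (b <= orthc)%MS -> hform R r s t a b = 0.
Proof.
rewrite genmxE => /submxP [x ->] /sub_kermxP h.
have : hform R r s t b (x *m A) = 0.
  by rewrite hformE cjM dotp_trmx -mulmxA h dotp0l.
by move=> h'; rewrite -hform_conj h' conjC0.
Qed.

Lemma orthc_decomp : A != 0 -> orthc != 0 -> orth_decomp R r s t <<A>>%MS orthc.
Proof.
move=> A0 B0; split; [|exact: B0|by rewrite orthc_cap|exact: orthc_add|exact: orthc_orth].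
by apply: contra A0 => /eqP h; rewrite -submx0 -h genmxE.
Qed.

Variable S0 : 'M[C]_(r + s + t).
Hypothesis S0A : S0 *m gram R r s t *m (cj A)^T = 0.

Lemma sub_orthc : (S0 <= orthc)%MS.
Proof. by apply/sub_kermxP; rewrite mulmxA. Qed.

Lemma proj_coordp (v : 'rV[C]_(r + s + t)) : (v <= A + S0)%MS ->
  v *m proj_mx <<A>>%MS orthc = v *m coordp A *m A.
Proof.
move=> /(coordp_decomp uA S0A) [b vE _]; rewrite {1}vE mulmxDl.
rewrite proj_mx_id ?orthc_cap ?genmxE ?submxMl//.
by rewrite proj_mx_0 ?orthc_cap ?addr0//; apply: submx_trans sub_orthc; exact: submxMl.
Qed.

Lemma proj_coordpC (v : 'rV[C]_(r + s + t)) : (v <= A + S0)%MS ->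
  (v *m proj_mx orthc <<A>>%MS <= S0)%MS.
Proof.
have cap : (orthc :&: <<A>> = (0 : 'M[C]_(r + s + t)))%MS by rewrite capmxC orthc_cap.
move=> /(coordp_decomp uA S0A) [b vE _]; rewrite vE mulmxDl.
rewrite proj_mx_0 ?cap ?genmxE ?submxMl// add0r proj_mx_id ?cap ?submxMl//.
by apply: submx_trans sub_orthc; exact: submxMl.
Qed.

(** The component in [S0] is isotropic and orthogonal to [A], so the sign of <F z, F z> can be read
    on the linear component. *)
Lemma hform_coordp (v : 'rV[C]_(r + s + t)) :
  S0 *m gram R r s t *m (cj S0)^T = 0 -> (v <= A + S0)%MS ->
  hform R r s t v v = hform R r s t (v *m coordp A *m A) (v *m coordp A *m A).
Proof.
move=> S0S0 /(coordp_decomp uA S0A) [b vE _].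
have bB : (b *m S0 <= orthc)%MS by apply: submx_trans sub_orthc; exact: submxMl.
have aA : (v *m coordp A *m A <= <<A>>)%MS by rewrite genmxE submxMl.
rewrite {1 2}vE hformDl !hformDr (orthc_orth aA bB) addr0.
rewrite -[hform R r s t (b *m S0) _]hform_conj (orthc_orth aA bB) conjC0 add0r.
by rewrite -[RHS]addr0; congr (_ + _); rewrite hform_mul S0S0 mulmx0 dotp0l.
Qed.

End Splitting.

(** * Null and quasi-linear alternatives, with the scaling constant *)

Section Rigidity.
Variable R : realType.
Local Notation C := (Cplx R).
Variables (r s r' s' t' : nat) (U : set 'rV[C]_(r + s + 0)).
Variable F : 'rV[C]_(r + s + 0) -> 'rV[C]_(r' + s' + t').

(** The scalar [k] is left free so that one statement serves both conclusions: k = 1 for linearity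
    and k = c^(-1/2) for the isometry. The clause with [a >= 0] is what reveals the sign of [c]. *)
Lemma rigidity :
  local_orthogonal R r s 0 r' s' t' U F -> (r' + s' + 3 <= 2 * (r + s))%N ->
  null_map R r s 0 r' s' t' U F \/
  exists (L1 : 'M[C]_(r + s + 0, r' + s' + t')) (c : C),
  [/\ L1 != 0,
      forall z w, hform R r' s' t' (z *m L1) (w *m L1) = c * hform R r s 0 z w,
      forall z, U z -> hform R r s 0 z z != 0 -> c != 0 /\ exists2 a : C, 0 <= a &
        hform R r' s' t' (F z) (F z) = a * (c * hform R r s 0 z z) &
    (forall k : C, k != 0 -> induced_by R r s 0 r' s' t' U F (k *: L1)) \/
    exists A B : 'M[C]_(r' + s' + t'), orth_decomp R r' s' t' A B /\
    (exists z, U z /\ projA R r s 0 r' s' t' A B F z != 0) /\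
    ((L1 <= A)%MS /\ forall k : C, k != 0 ->
       induced_by R r s 0 r' s' t' U (projA R r s 0 r' s' t' A B F) (k *: L1)) /\
    (exists H : 'M[C]_(r' + s' + t'), (H <= B)%MS /\ null_space R r' s' t' H /\
        maps_into R r s 0 r' s' t' U (projA R r s 0 r' s' t' B A F) H)].
Proof.
move=> lo mn; have nz0 : exists2 z : 'rV[C]_(r + s + 0), U z & F z != 0.
  by case: lo => _ [[z [Uz _]] [[F0 _] _]]; exists z => //; exact: F0.
have [nF|[m [A [S0 [L [c [uA S0A S0S0 c0 [FA minors [z0 Uz0 z0A] hL]]]]]]]] := orthogonal_structure lo mn; [by left|right].
have A0 : A != 0.
  apply: contra z0A => /eqP A0; apply/eqP.
  by rewrite -[F z0 *m coordp A]mulmx1 -(coordp_id uA) A0 mul0mx mulmx0.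
have AK (x : 'rV[C]_m) : x *m A *m coordp A = x by rewrite -mulmxA coordp_id// mulmx1.
have par z : U z -> z *m (L *m A) != 0 ->
    exists l : C, F z *m coordp A *m A = l *: (z *m (L *m A)).
  move=> Uz zL; have zL0 : z *m L != 0.
    by apply: contra zL => /eqP zL; rewrite mulmxA zL mul0mx.
  have [l lE] := minors_parallel zL0 (minors z Uz).
  by exists l; rewrite lE -scalemxAl mulmxA.
have parq z (k : C) : U z -> k != 0 -> F z *m coordp A *m A != 0 -> z *m (k *: (L *m A)) != 0 ->
    projeq R (F z *m coordp A *m A) (z *m (k *: (L *m A))).
  move=> Uz k0 Fz zL; split; [exact: Fz|split; [exact: zL|]].
  have zL1 : z *m (L *m A) != 0.
    by apply: contra zL => /eqP zL; rewrite -scalemxAr zL scaler0.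
  have [l lE] := par z Uz zL1; exists (l / k); split.
    rewrite mulf_neq0 ?invr_eq0//; apply: contra Fz => /eqP l0.
    by rewrite lE l0 scale0r.
  by rewrite -scalemxAr scalerA divfK.
have ne z w : hform R r s 0 z w != 0 -> z *m (L *m A) != 0.
  move=> zw; apply: contraNneq (mulf_neq0 c0 zw) => zL.
  by rewrite -hL zL hformE mul0mx dotp0l.
exists (L *m A), c; split.
- have [z [w zw]] : exists z w, hform R r s 0 z w != 0.
    have [z Uz Fz] := nz0; have z0' : z != 0.
      by case: lo => [[_ [_ [U0 _]]] _]; apply: contra_not_neq U0 => <-.
    by have [w zw] := dotp_neq0 z0'; exists z, (kappa w); rewrite hform_kappa kappaK.
  by apply: contra (ne z w zw) => /eqP ->; rewrite mulmx0.
- exact: hL.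
- move=> z Uz zz; split=> //; have [l lE] := par z Uz (ne z z zz).
  exists (l * l^*); first exact: mul_conjC_ge0.
  by rewrite (hform_coordp uA S0A S0S0 (FA z Uz)) lE hformZ hL.
(* A decomposition requires two nonzero summands. If the complement of [A] is zero, so is [S0], and
   [F] itself is linear. *)
have [B0|B0] := eqVneq (orthc A) 0; [left|right].
  have S00 : S0 = 0 by apply/eqP; rewrite -submx0 -B0; exact: sub_orthc.
  have FE z : U z -> F z = F z *m coordp A *m A.
    move=> Uz; have [b FzE _] := coordp_decomp uA S0A (FA z Uz).
    by rewrite {1}FzE S00 mulmx0 addr0.
  by move=> k k0 z Uz Fz zL; rewrite (FE z Uz); apply: parq => //; rewrite -FE.
exists <<A>>%MS, (orthc A); split; first exact: orthc_decomp.
split; [|split; [split|]].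
- exists z0; split=> //; rewrite /projA (proj_coordp uA S0A (FA z0 Uz0)).
  by apply: contra z0A => /eqP h; rewrite -[F z0 *m coordp A]AK h mul0mx.
- by rewrite genmxE submxMl.
- move=> k k0 z Uz; rewrite /projA (proj_coordp uA S0A (FA z Uz)) => Fz zL.
  exact: parq.
exists S0; split; [exact: sub_orthc|split].
  move=> u v /submxP [a ->] /submxP [b ->].
  by rewrite hform_mul S0S0 mulmx0 dotp0l.
by move=> z Uz _; exact: (proj_coordpC uA S0A (FA z Uz)).
Qed.

End Rigidity.

Unset Implicit Arguments.

Theorem mainTheorem11 (R : realType) (r s r' s' t' : nat)
    (U : set 'rV[Cplx R]_(r + s + 0))
    (F : 'rV[Cplx R]_(r + s + 0) -> 'rV[Cplx R]_(r' + s' + t')) :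
  local_orthogonal R r s 0 r' s' t' U F ->
  (r' + s' + 3 <= 2 * (r + s))%N ->
  (null_map R r s 0 r' s' t' U F \/ quasi_linear R r s 0 r' s' t' U F) /\
  ((exists z, U z /\ 0 < hform R r s 0 z z /\ 0 < hform R r' s' t' (F z) (F z)) \/
   (exists z, U z /\ hform R r s 0 z z < 0 /\ hform R r' s' t' (F z) (F z) < 0) ->
   quasi_standard R r s 0 r' s' t' U F).
Proof.
move=> lo mn; have [[H [nH FH]]|[L [c [L0 hL hF split]]]] := rigidity lo mn.
  (* A null map has <F z, F z> = 0 throughout, against the sign hypothesis of the second claim. *)
  split=> [|hz]; first by left; exists H.
  have [z Uz Fz] : exists2 z, U z & hform R r' s' t' (F z) (F z) != 0.
    by case: hz => -[z [Uz [_ Fz]]]; exists z => //; [exact: lt0r_neq0|exact: ltr0_neq0].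
  have F0 : F z != 0 by case: lo => _ [_ [[F0 _] _]]; exact: F0.
  by case/eqP: Fz; apply: nH; exact: FH.
split=> [|hz].
  right; case: split => [ind|[A [B [dec [nz [[LA ind] spl]]]]]]; [left|right].
    by exists L; split=> //; rewrite -[L]scale1r; apply: ind; exact: oner_neq0.
  exists A, B; split; [exact: dec|split; [exact: nz|split; [|exact: spl]]].
  exists L; split; [exact: L0|split; [exact: LA|]].
  by rewrite -[L]scale1r; apply: ind; exact: oner_neq0.
(* In the order of the complex numbers this also says that [c] is real. It follows from <F z, F z> =
   a c <z, z> with [a >= 0], both values being of the same strict sign. *)
have cpos : 0 < c.
  case: hz => -[z [Uz [zz Fz]]].
    have [c0 [a a0 FE]] := hF z Uz (lt0r_neq0 zz).
    move: Fz; rewrite FE mulrA pmulr_lgt0// => ac.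
    have a1 : 0 < a.
      by rewrite lt_neqAle a0 andbT eq_sym; apply: contraTneq ac => ->; rewrite mul0r ltxx.
    by rewrite -(pmulr_rgt0 c a1).
  have [c0 [a a0 FE]] := hF z Uz (ltr0_neq0 zz).
  move: Fz; rewrite FE mulrA nmulr_llt0// => ac.
  have a1 : 0 < a.
    by rewrite lt_neqAle a0 andbT eq_sym; apply: contraTneq ac => ->; rewrite mul0r ltxx.
  by rewrite -(pmulr_rgt0 c a1).
(* A real scalar [k] multiplies the form by its square, so the inverse square root of [c] turns [L]
   into an isometry. *)
pose k : Cplx R := (sqrtC c)^-1.
have k0 : k != 0 by rewrite invr_eq0 sqrtC_eq0 gt_eqF.
have kr : k^* = k by apply: geC0_conj; rewrite invr_ge0 sqrtC_ge0 ltW.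
have kk : k * k * c = 1.
  by rewrite /k -{3}[c]sqrtCK -invfM -expr2 mulVf// expf_neq0// sqrtC_eq0 gt_eqF.
have iso : lin_isometry R r s 0 r' s' t' (k *: L).
  by move=> z w; rewrite -!scalemxAr hformZ hL kr mulrA kk mul1r.
have kL0 : k *: L != 0 by rewrite scaler_eq0 negb_or k0.
case: split => [ind|[A [B [dec [nz [[LA ind] spl]]]]]]; [left|right].
  by exists (k *: L); split; [exact: kL0|split; [exact: iso|exact: ind]].
exists A, B; split; [exact: dec|split; [exact: nz|split; [|exact: spl]]].
exists (k *: L); split; [exact: kL0|split; [|split; [exact: iso|exact: ind]]].
by apply: submx_trans LA; exact: scalemx_sub.
Qed.
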